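(* Let $(\mu,\Gamma,\chi)$ be a probabilistic solution of the single-phase supercooled Stefan problem for $t\in[0,T]$, with an initial condition $(u_0,\Gamma_{0-})$. Let $X$ denote the canonical process on $C([0,T],\mathbb{R}^d)$ and, for $t\in[0,T]$, let the density $u(t,\cdot)$ of the restriction of $\mu\circ X_t^{-1}$ to $\mathbb{R}^d\setminus\Gamma_t$ be extended into $\Gamma_t$ by $0$. Then, $(-u,\Gamma,\chi)$ is a weak solution of the single-phase supercooled Stefan problem with the initial condition $(-u_0,\Gamma_{0-})$.
   Context: Phase condition. For a closed $\Gamma_{0-}\subset\mathbb{R}^d$, a non-decreasing family $\Gamma=\{\Gamma_t\}_{t\in[0,T]}$ of closed subsets of $\mathbb{R}^d$ containing $\Gamma_{0-}$, and $\chi:[0,T]\times\mathbb{R}^d\to[0,\infty)$ locally integrable, the phase condition says that for all $t\in[0,T]$: $$\chi(t,x)\,\mathbf{1}_{\mathbb{R}^d\setminus\bigcup_{0\le s\le t}\Delta\Gamma_s}(x)=\mathbf{1}_{\Gamma_t\setminus\bigcup_{0\le s\le t}\Delta\Gamma_s}(x),\qquad\int_{\Delta\Gamma_s}\chi(t,x)\,\mathrm{d}x=\mathrm{Leb}(\Delta\Gamma_s),\ s\in[0,t],$$ where $\Delta\Gamma_s=\Gamma_s\setminus\Gamma_{s-}$, $\Gamma_{s-}:=\bigcup_{0\le r<s}\Gamma_r$ for $s>0$, $\Gamma_{0-}$ is the given initial set, and the unions $\bigcup_{0\le s\le t}\Delta\Gamma_s$ are taken only over those $s\in[0,t]$ with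 $\mathrm{Leb}(\Delta\Gamma_s)>0$. Probabilistic solution. Let $\Gamma_{0-}\subset\mathbb{R}^d$ be non-empty and closed, and let $u_0$ be a probability density essentially supported in $\mathbb{R}^d\setminus\Gamma_{0-}$. A triplet $(\mu,\Gamma,\chi)$, with a non-decreasing right-continuous ($\Gamma_t=\bigcap_{t<s\le T}\Gamma_s$, $t\in[0,T)$) family $\Gamma=\{\Gamma_t\}_{t\in[0,T]}$ of closed subsets of $\mathbb{R}^d$, a Borel probability measure $\mu$ on $C([0,T],\mathbb{R}^d)$, and $\chi$ satisfying the phase condition, is a probabilistic solution of the single-phase supercooled Stefan problem with the initial condition $(u_0,\Gamma_{0-})$ if (i) $\Gamma_{0-}\subset\Gamma_t$, $t\in[0,T]$; (ii) $\mu$ equals the distribution of $(\xi+B_{t\wedge\widehat\tau})_{t\in[0,T]}$, with $\xi\sim u_0(x)\,\mathrm{d}x$, an independent standard Brownian motion $B$ in $\mathbb{R}^d$, and $\widehat\tau:=\inf\{t\in[0,T]:\xi+B_t\in\Gamma_t\}$; (iii) for the canonical process $X$ on $C([0,T],\mathbb{R}^d)$ and $\tau:=\inf\{t\in[0,T]:X_t\in\Gamma_t\}$, $\int_{\mathbb{R}^d}\varphi(x)\big(\chi(t,x)-\mathbf{1}_{\Gamma_{0-}}(x)\big)\,\mathrm{d}x=\mathbb{E}^\mu[\varphi(X_\tau)\mathbf{1}_{\{\tau\le t\}}]$ for all $\varphi\in C_c^\infty(\mathbb{R}^d,\mathbb{R})$, $t\in[0,T]$. Weak solution. Let $\Gamma_{0-}\subset\mathbb{R}^d$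 be closed and $w_0:\mathbb{R}^d\to(-\infty,0]$ be locally integrable and essentially supported in $\mathbb{R}^d\setminus\Gamma_{0-}$. A weak solution of the single-phase supercooled Stefan problem with the initial condition $(w_0,\Gamma_{0-})$ is a triplet $(w,\Gamma,\chi)$, where $\Gamma=\{\Gamma_t\}_{t\in[0,T]}$ is a non-decreasing family of closed subsets of $\mathbb{R}^d$ containing $\Gamma_{0-}$, and $w:[0,T]\times\mathbb{R}^d\to\mathbb{R}$, $\chi:[0,T]\times\mathbb{R}^d\to[0,\infty)$ are locally integrable, such that the phase condition holds; for all $t\in[0,T]$ and $\varphi\in C_c^\infty([0,t]\times\mathbb{R}^d)$, $$\int_{\mathbb{R}^d}\varphi(t,x)\big(w(t,x)-\chi(t,x)\big)-\varphi(0,x)\big(w_0(x)-\mathbf{1}_{\Gamma_{0-}}(x)\big)\,\mathrm{d}x=\int_0^t\int_{\mathbb{R}^d}\partial_t\varphi(s,x)\big(w(s,x)-\chi(s,x)\big)+\frac12\Delta\varphi(s,x)\,w(s,x)\,\mathrm{d}x\,\mathrm{d}s;$$ and $\mathbf{1}_{\Gamma_t}(x)\,w(t,x)=0$ for almost every $(t,x)\in[0,T]\times\mathbb{R}^d$. Convention: $\inf\varnothing=\infty$. *)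

(* Defs.v *)
From HB Require Import structures.
From mathcomp Require Import all_boot all_order all_algebra.
From mathcomp Require Import all_classical all_reals all_analysis measurable_realfun.
Set Implicit Arguments.
Unset Strict Implicit.
Unset Printing Implicit Defensive.
Import Order.TTheory GRing.Theory Num.Theory.
Import numFieldNormedType.Exports.
Local Open Scope classical_set_scope.
Local Open Scope ring_scope.

(* The Borel sigma-algebra of matrices, hence of R^d = 'rV[R]_d. *)
HB.instance Definition _ (R : realType) (m n : nat) :=
  @isMeasurable.Build (sigma_display (@open 'M[R]_(m, n)))
    'M[R]_(m, n) <<s @open 'M[R]_(m, n) >>
    (@sigma_algebra0 _ setT _) (@sigma_algebraC _ _)
    (@sigma_algebra_bigcup _ setT _).

Section borel_rV.
Context (R : realType).

Lemma measurable_coord n (i : 'I_n) :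
  measurable_fun setT (fun v : 'rV[R]_n => v ord0 i).
Proof.
apply: (measurability _ (RGenOpens.measurableE R)) => _ [_ [a [b ->] <-]].
rewrite setTI; apply: sub_sigma_algebra; apply: open_comp => //.
  by move=> v _; exact: coord_continuous.
Qed.

Lemma open_rV_bigcup_rat n (U : set 'rV[R]_n) : open U ->
  U = \bigcup_(q in [set q : {ffun 'I_n -> rat} * rat |
                 ball (\row_i (ratr (q.1 i) : R)) (ratr q.2) `<=` U])
        ball (\row_i (ratr (q.1 i) : R)) (ratr q.2).
Proof.
move=> oU; apply/seteqP; split; last by move=> x [q] /=; exact.
move=> x Ux; have [e /= e0 eU] : nbhs_ball x U.
  by apply/nbhs_ballP; exact: open_nbhs_nbhs.
have [r] : exists r : rat, ratr r \in `](0 : R), (e / 2)[.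
  by apply: rat_in_itvoo; rewrite divr_gt0.
rewrite in_itv/= => /andP[r0 re].
have qP i : exists q : rat, ratr q \in `](x ord0 i), (x ord0 i + ratr r)[.
  by apply: rat_in_itvoo; rewrite ltrDl.
pose q := [ffun i => projT1 (cid (qP i))].
have qx : ball (\row_i (ratr (q i) : R)) (ratr r) x.
  split => // i j; rewrite !mxE /ball/= ord1 ffunE.
  case: cid => /= s; rewrite in_itv/= => /andP[s1 s2].
  by rewrite gtr0_norm ?subr_gt0// ltrBlDl.
exists (q, r) => //= y qy; apply: eU.
rewrite [e]splitr; apply: (@ball_triangle _ _ (\row_i (ratr (q i) : R))).
  by apply: ball_sym; apply: le_ball qx; exact: ltW.
by apply: le_ball qy; exact: ltW.
Qed.

Lemma measurable_fun_rV d (T : measurableType d) n (f : T -> 'rV[R]_n) :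
  (forall i, measurable_fun setT (fun x => f x ord0 i)) -> measurable_fun setT f.
Proof.
move=> mf; apply: (measurability (@open 'rV[R]_n)) => // _ [U oU <-].
rewrite setTI (open_rV_bigcup_rat oU) preimage_bigcup.
rewrite bigcup_mkcond; apply: countable_bigcupT_measurable => [|q].
  exact/countableP.
case: ifPn => // _; rewrite [X in measurable X](_ : _ =
    if ratr q.2 > 0 :> R then
      \bigcap_(i in [set: 'I_n]) ((fun x => f x ord0 i) @^-1`
        ball (ratr (q.1 i) : R) (ratr q.2 : R)) else set0).
  case: ifPn => // q0; apply: fin_bigcap_measurable => // i _.
  rewrite -[X in measurable X]setTI; apply: mf => //.
  apply: open_measurable. apply: (@ball_open R R^o); exact: q0.
apply/seteqP; split => x /=.
  move=> [q0 qx]; rewrite q0 => i _ /=; have := qx ord0 i.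
  by rewrite mxE.
case: ifPn => // q0 qx; split => // i j.
by rewrite ord1 mxE; exact: qx.
Qed.

End borel_rV.

Section lebesgue_measure_rV.
Context (R : realType).

Definition cons_rV d (z : measurableTypeR R * 'rV[R]_d) : 'rV[R]_d.+1 :=
  row_mx z.1%:M z.2.

Lemma cons_rV0 d (z : measurableTypeR R * 'rV[R]_d) : cons_rV z ord0 ord0 = z.1.
Proof.
rewrite /cons_rV (_ : ord0 = lshift d (ord0 : 'I_1) :> 'I_(1 + d)).
  by rewrite (row_mxEl z.1%:M z.2) mxE eqxx mulr1n.
exact: val_inj.
Qed.

Lemma cons_rV_lift d (z : measurableTypeR R * 'rV[R]_d) (j : 'I_d) :
  cons_rV z ord0 (lift ord0 j) = z.2 ord0 j.
Proof.
rewrite /cons_rV (_ : lift ord0 j = rshift 1 j :> 'I_(1 + d)).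
  exact: (row_mxEr z.1%:M z.2).
exact: val_inj.
Qed.

Lemma measurable_cons_rV d : measurable_fun setT (@cons_rV d).
Proof.
apply: measurable_fun_rV => i.
case: (unliftP ord0 i) => [j ->|->].
  apply: (eq_measurable_fun (fun z : measurableTypeR R * 'rV[R]_d => z.2 ord0 j)) => [z _|].
    by rewrite cons_rV_lift.
  exact: measurableT_comp (@measurable_coord R d j) measurable_snd.
apply: (eq_measurable_fun fst) => [z _|]; last exact: measurable_fst.
by rewrite cons_rV0.
Qed.

HB.instance Definition _ d := isMeasurableFun.Build _ _ _ _ (@cons_rV d)
  (@measurable_cons_rV d).

Definition uncons_rV d (v : 'rV[R]_d.+1) : measurableTypeR R * 'rV[R]_d :=
  (v ord0 ord0, \row_j v ord0 (lift ord0 j)).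

Lemma measurable_uncons_rV d : measurable_fun setT (@uncons_rV d).
Proof.
apply: measurable_fun_pair; first exact: measurable_coord.
apply: measurable_fun_rV => j.
apply: (eq_measurable_fun (fun v : 'rV[R]_d.+1 => v ord0 (lift ord0 j))).
  by move=> v _; rewrite mxE.
exact: measurable_coord.
Qed.

Lemma cons_rVK d : cancel (@cons_rV d) (@uncons_rV d).
Proof.
move=> z; rewrite /uncons_rV cons_rV0 [RHS]surjective_pairing; congr pair.
by apply/rowP => j; rewrite mxE cons_rV_lift.
Qed.

Section lebesgue_measure_rV_step.
Variables (d : nat) (m : {sigma_finite_measure set 'rV[R]_d -> \bar R}).

Definition lebesgue_measure_rV_step : set 'rV[R]_d.+1 -> \bar R :=
  pushforward (lebesgue_measure \x m)%E (@cons_rV d).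

Let mpush : {measure set 'rV[R]_d.+1 -> \bar R} :=
  @measure_function_pushforward__canonical__measure_function_Measure
    _ _ _ _ _ (lebesgue_measure \x m)%E _ (@measurable_cons_rV d).

Let step0 : lebesgue_measure_rV_step set0 = 0%E.
Proof. exact: (measure0 mpush). Qed.

Let step_ge0 A : (0 <= lebesgue_measure_rV_step A)%E.
Proof. exact: (measure_ge0 mpush). Qed.

Let step_sigma_additive : semi_sigma_additive lebesgue_measure_rV_step.
Proof. exact: (@measure_semi_sigma_additive _ _ _ mpush). Qed.

HB.instance Definition _ := isMeasure.Build _ _ _ lebesgue_measure_rV_step
  step0 step_ge0 step_sigma_additive.

Let step_sigma_finite : sigma_finite setT lebesgue_measure_rV_step.
Proof.
have /sigma_finiteP[F [TF ndF Foo]] := sigma_finiteT (@lebesgue_measure R).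
have /sigma_finiteP[G [TG ndG Goo]] := sigma_finiteT m.
exists (fun n => @uncons_rV d @^-1` (F n `*` G n)).
  apply/esym; rewrite -subTset => v _.
  have [[n _ Fn] [k _ Gk]] : (\bigcup_n F n) (uncons_rV v).1 /\
      (\bigcup_n G n) (uncons_rV v).2 by rewrite -TF -TG.
  exists (maxn n k) => //; split => /=.
    by move: Fn; exact/subsetPset/ndF/leq_maxl.
  by move: Gk; exact/subsetPset/ndG/leq_maxr.
move=> n; have [mF Fn] := Foo n; have [mG Gn] := Goo n.
have mFG := measurableX mF mG; split.
  by rewrite -[X in measurable X]setTI; exact: measurable_uncons_rV.
rewrite /lebesgue_measure_rV_step /pushforward -comp_preimage.
rewrite (_ : @uncons_rV d \o @cons_rV d = id); last first.
  by apply/funext => z; exact: cons_rVK.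
by rewrite preimage_id product_measure1E// lte_mul_pinfty// ge0_fin_numE.
Qed.

HB.instance Definition _ := Measure_isSigmaFinite.Build _ _ _
  lebesgue_measure_rV_step step_sigma_finite.

End lebesgue_measure_rV_step.

Fixpoint lebesgue_measure_rV d : {sigma_finite_measure set 'rV[R]_d -> \bar R} :=
  match d with
  | 0 => \d_(0 : 'rV[R]_0)
  | d'.+1 => lebesgue_measure_rV_step (lebesgue_measure_rV d')
  end.

End lebesgue_measure_rV.
Arguments lebesgue_measure_rV {R} d.

Section integrability.
Context (R : realType).

(* Measurability for the mu-completion of the sigma-algebra. The library's
   integral is a supremum over simple functions below the integrand, so that it
   has the expected value on such functions. *)
Definition ae_measurable_on d (X : measurableType d)
    (mu : {measure set X -> \bar R}) (D : set X) (f : X -> R) : Prop :=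
  exists2 g : X -> R, measurable_fun setT g & f = g %[ae mu in D].

Context (d : nat).
Local Notation V := 'rV[R]_d.
Local Notation leb := (@lebesgue_measure_rV R d).

Definition spacetime_measure : {measure set (measurableTypeR R * V) -> \bar R} :=
  (@lebesgue_measure R \x leb)%E.

Definition locally_integrable_rV (f : V -> R) : Prop :=
  ae_measurable_on leb setT f /\
  forall K : set V, compact K -> (\int[leb]_(x in K) `|f x|%:E < +oo)%E.

Definition spacetime_measurable (T : R) (f : R -> V -> R) : Prop :=
  ae_measurable_on spacetime_measure (`[0, T] `*` setT) (fun z => f z.1 z.2).

(* The last clause is what gives a meaning to the integrals of f t at every
   fixed time t, which occur in all the definitions below. *)
Definition locally_integrable_spacetime (T : R) (f : R -> V -> R) : Prop :=
  [/\ spacetime_measurable T f,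
      forall K : set V, compact K ->
        (\int[spacetime_measure]_(z in `[0%R, T] `*` K) `|f z.1 z.2|%:E < +oo)%E &
      forall t : R, t \in `[0, T] -> locally_integrable_rV (f t)].

End integrability.

Section test_functions.
Context (R : realType) (d : nat).
Local Notation V := 'rV[R]_d.

Definition basis_vec (i : 'I_d) : V := delta_mx ord0 i.

Definition partial (i : 'I_d) (f : V -> R) : V -> R :=
  fun x => 'D_(basis_vec i) f x.

Fixpoint Ck (n : nat) (f : V -> R) : Prop :=
  continuous f /\
  match n with
  | 0 => True
  | m.+1 => forall i, (forall x, derivable f x (basis_vec i)) /\ Ck m (partial i f)
  end.

Definition Cc_infty (f : V -> R) : Prop :=
  (forall n, Ck n f) /\ compact (closure [set x | f x != 0]).

Definition time_partial (f : R -> V -> R) : R -> V -> R :=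
  fun t x => derive1 (f ^~ x) t.

Definition space_partial (i : 'I_d) (f : R -> V -> R) : R -> V -> R :=
  fun t => partial i (f t).

Definition laplacian (f : R -> V -> R) : R -> V -> R :=
  fun t x => \sum_(i < d) space_partial i (space_partial i f) t x.

Fixpoint spacetime_Ck (n : nat) (f : R -> V -> R) : Prop :=
  continuous (fun z : R * V => f z.1 z.2) /\
  match n with
  | 0 => True
  | m.+1 =>
    [/\ forall t x, derivable (f ^~ x) t 1,
        spacetime_Ck m (time_partial f) &
        forall i, (forall t x, derivable (f t) x (basis_vec i)) /\
                  spacetime_Ck m (space_partial i f)]
  end.

(* C_c^infty([0, t] x R^d): smooth up to the boundary, that is, restrictions of
   smooth functions on R x R^d, with compact support in [0, t] x R^d; no
   vanishing is required at the times 0 and t. *)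
Definition Cc_infty_upto (t : R) (f : R -> V -> R) : Prop :=
  (forall n, spacetime_Ck n f) /\
  compact (closure [set z : R * V | z.1 \in `[0, t] /\ f z.1 z.2 != 0]).

End test_functions.

Section brownian_motion.
Context (R : realType) (d : nat).
Local Notation V := 'rV[R]_d.
Local Notation leb := (@lebesgue_measure_rV R d).

Definition gaussian_density (v : R) (x : V) : R :=
  \prod_(i < d) normal_pdf 0 (Num.sqrt v) (x ord0 i).

Context (dO : measure_display) (O : measurableType dO).

Definition sigma_generated (I : set R) (B : R -> O -> V) : set_system O :=
  <<s [set F | exists r A, [/\ I r, measurable A & F = B r @^-1` A]] >>.

Definition independent_systems (P : probability O R) (G H : set_system O) :=
  forall E F, G E -> H F -> P (E `&` F) = (P E * P F)%E.

Record standard_brownian_motion (P : probability O R) (B : R -> O -> V) : Prop := {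
  bm_measurable : forall t : R, 0 <= t -> measurable_fun setT (B t) ;
  bm_start : forall w, B 0 w = 0 ;
  bm_continuous : forall w, {within `[0, +oo[, continuous (fun t => B t w)} ;
  bm_gaussian : forall s t : R, 0 <= s -> s < t -> forall A : set V, measurable A ->
    P ((fun w => B t w - B s w) @^-1` A) =
      (\int[leb]_(x in A) (gaussian_density (t - s) x)%:E)%E ;
  bm_independent : forall s t : R, 0 <= s -> s < t ->
    independent_systems P (sigma_generated `[0, s] B)
      (preimage_set_system setT (fun w => B t w - B s w) measurable) }.

End brownian_motion.

(* C([0, T], R^d), with the Borel sigma-algebra of uniform convergence. *)
Definition path_space (R : realType) (d : nat) (T : R) : Type :=
  continuousType (`[0, T]%classic : set R) 'rV[R]_d.

Section path_space.
Context (R : realType) (d : nat) (T : R).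
Local Notation V := 'rV[R]_d.
Local Notation path_space := (path_space d T).

HB.instance Definition _ := Choice.on path_space.
HB.instance Definition _ := isPointed.Build path_space
  (cst 0 : continuousType (`[0, T]%classic : set R) V).

Definition path_open : set_system path_space :=
  @open (initial_topology
    (fun p : path_space => (p : `[0, T]%classic -> V) : {uniform `[0, T]%classic -> V})).

HB.instance Definition _ :=
  @isMeasurable.Build (sigma_display path_open) path_space <<s path_open >>
    (@sigma_algebra0 _ setT _) (@sigma_algebraC _ _)
    (@sigma_algebra_bigcup _ setT _).

(* The value outside [0, T] is a junk value. *)
Definition canonical_process (t : R) (p : path_space) : V := 'valL_0 p t.

End path_space.

Section stefan_problem.
Context (R : realType) (d : nat) (T : R).
Local Notation V := 'rV[R]_d.
Local Notation leb := (@lebesgue_measure_rV R d).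
Implicit Types (G : R -> set V) (chi w u : R -> V -> R).

(* Time-indexed objects are total functions of time, of which only the values
   on [0, T] matter. *)

Definition closed_family G := forall t : R, t \in `[0, T] -> closed (G t).

Definition nondecreasing_family G :=
  forall s t : R, s \in `[0, T] -> t \in `[0, T] -> s <= t -> G s `<=` G t.

Definition right_continuous_family G :=
  forall t : R, t \in `[0, T[ -> G t = \bigcap_(s in `]t, T]) G s.

Definition left_limit (G0 : set V) G (s : R) : set V :=
  if s == 0 then G0 else \bigcup_(r in `[0, s[) G r.

Definition jump (G0 : set V) G (s : R) : set V := G s `\` left_limit G0 G s.

Definition jumps_upto (G0 : set V) G (t : R) : set V :=
  \bigcup_(s in [set s : R | s \in `[0, t] /\ (0 < leb (jump G0 G s))%E]) jump G0 G s.

Definition phase_condition (G0 : set V) G chi : Prop :=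
  forall t : R, t \in `[0, T] ->
    (forall x, chi t x * \1_(~` jumps_upto G0 G t) x =
               \1_(G t `\` jumps_upto G0 G t) x) /\
    (forall s : R, s \in `[0, t] ->
       (\int[leb]_(x in jump G0 G s) (chi t x)%:E = leb (jump G0 G s))%E).

(* inf {t in [0, T] : f t in G t}, with inf of the empty set equal to +oo. *)
Definition hitting_time G (f : R -> V) : \bar R :=
  ereal_inf [set t%:E | t in [set t : R | t \in `[0, T] /\ G t (f t)]].

Definition vanishes_ae_on (A : set V) (f : V -> R) : Prop :=
  {ae leb, forall x, A x -> f x = 0}.

Record probability_density (f : V -> R) : Prop := {
  density_measurable : ae_measurable_on leb setT f ;
  density_ge0 : forall x, 0 <= f x ;
  density_integral : (\int[leb]_x (f x)%:E = 1)%E }.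

(* The law of (xi + B_{t /\ tau}), t in [0, T], with xi ~ u0(x)dx independent
   of B and tau the hitting time of G by xi + B, is mu. *)
Definition is_stopped_brownian_law (u0 : V -> R) G
    (mu : probability (path_space d T) R) : Prop :=
  exists (dO : measure_display) (O : measurableType dO) (P : probability O R)
    (xi : {RV P >-> V}) (B : R -> O -> V) (Y : {RV P >-> path_space d T}),
    [/\ standard_brownian_motion P B,
        forall A : set V, measurable A ->
          distribution P xi A = (\int[leb]_(x in A) (u0 x)%:E)%E,
        independent_systems P (preimage_set_system setT xi measurable)
          (sigma_generated `[0, +oo[ B),
        forall (o : O) (t : R), t \in `[0, T] -> canonical_process t (Y o) =
          xi o + B (fine (Order.min t%:E
                     (hitting_time G (fun s => xi o + B s o)))) o &
        forall A : set (path_space d T), measurable A ->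
          mu A = distribution P Y A].

Record probabilistic_solution (u0 : V -> R) (G0 : set V)
    (mu : probability (path_space d T) R) G chi : Prop := {
  ps_init_nonempty : G0 !=set0 ;
  ps_init_closed : closed G0 ;
  ps_init_density : probability_density u0 ;
  ps_init_support : vanishes_ae_on G0 u0 ;
  ps_closed : closed_family G ;
  ps_nondecreasing : nondecreasing_family G ;
  ps_right_continuous : right_continuous_family G ;
  ps_chi_ge0 : forall (t : R) (x : V), t \in `[0, T] -> 0 <= chi t x ;
  ps_chi_integrable : locally_integrable_spacetime T chi ;
  ps_phase : phase_condition G0 G chi ;
  ps_init_sub : forall t : R, t \in `[0, T] -> G0 `<=` G t ;
  ps_law : is_stopped_brownian_law u0 G mu ;
  ps_growth : forall (phi : V -> R) (t : R), Cc_infty phi -> t \in `[0, T] ->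
    let X (p : path_space d T) s := canonical_process s p in
    let tau (p : path_space d T) := hitting_time G (X p) in
    (\int[leb]_x (phi x * (chi t x - \1_G0 x))%:E =
     'E_mu[fun p => (phi (X p (fine (tau p))) * (tau p <= t%:E)%E%:R)%R])%E }.

Record weak_solution (w0 : V -> R) (G0 : set V) w G chi : Prop := {
  ws_init_closed : closed G0 ;
  ws_init_le0 : forall x, w0 x <= 0 ;
  ws_init_integrable : locally_integrable_rV w0 ;
  ws_init_support : vanishes_ae_on G0 w0 ;
  ws_closed : closed_family G ;
  ws_nondecreasing : nondecreasing_family G ;
  ws_init_sub : forall t : R, t \in `[0, T] -> G0 `<=` G t ;
  ws_integrable : locally_integrable_spacetime T w ;
  ws_chi_ge0 : forall (t : R) (x : V), t \in `[0, T] -> 0 <= chi t x ;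
  ws_chi_integrable : locally_integrable_spacetime T chi ;
  ws_phase : phase_condition G0 G chi ;
  ws_equation : forall (t : R) (phi : R -> V -> R), t \in `[0, T] ->
    Cc_infty_upto t phi ->
    (\int[leb]_x (phi t x * (w t x - chi t x)
                  - phi 0%R x * (w0 x - \1_G0 x))%:E =
     \int[lebesgue_measure]_(s in `[0%R, t]) \int[leb]_x
        (time_partial phi s x * (w s x - chi s x)
         + 2^-1 * laplacian phi s x * w s x)%:E)%E ;
  ws_vanishing : {ae @spacetime_measure R d, forall z,
    z.1 \in `[0, T] -> \1_(G z.1) z.2 * w z.1 z.2 = 0} }.

(* u(t, .) is a density of mu o X_t^-1 restricted to the complement of G t,
   extended by 0. A density is only unique up to null sets for each t, so joint
   measurability of the versions has to be part of the notion. *)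
Record alive_density (mu : probability (path_space d T) R) G u : Prop := {
  ad_jointly_measurable : spacetime_measurable T u ;
  ad_measurable : forall t : R, t \in `[0, T] -> ae_measurable_on leb setT (u t) ;
  ad_ge0 : forall (t : R) (x : V), t \in `[0, T] -> 0 <= u t x ;
  ad_density : forall (t : R) (A : set V), t \in `[0, T] -> measurable A ->
    A `<=` ~` G t ->
    pushforward mu (canonical_process t) A = (\int[leb]_(x in A) (u t x)%:E)%E ;
  ad_extension : forall (t : R) (x : V), t \in `[0, T] -> G t x -> u t x = 0 }.

End stefan_problem.

(* Main.v *)
Require Import Defs.
From HB Require Import structures.
From mathcomp Require Import all_boot all_order all_algebra.
From mathcomp Require Import all_classical all_reals all_analysis.
From mathcomp Require Import measurable_realfun.
From mathcomp Require Import ring lra.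
Import Order.TTheory GRing.Theory Num.Theory.
Import numFieldNormedType.Exports.
Set Implicit Arguments.
Unset Strict Implicit.
Unset Printing Implicit Defensive.
Local Open Scope classical_set_scope.
Local Open Scope ring_scope.

(** Let W = xi + B, let tau be its hitting time of the moving set, and let X_t be W at time min(t,
    tau). The law of X_t is described in two ways.

    On tau > t, X_t has density u(t, .). On tau <= t, X_t equals X_tau, and its law on that event is
    tested by chi(t, .) - 1_{G0} through the growth condition. Hence E psi(X_t) is the integral of
    psi times (u + chi - 1_{G0})(t, .) for every test function psi ([has_integral_growth]).

    On the other hand, the Dynkin formula ([dynkin_formula]) says that E phi(t, X_t) - E phi(0, xi)
    is the integral over 0 < s < t of E d_t phi(s, X_s) + E[1_{tau > s} Delta phi(s, W_s)] / 2.
    Inserting the first description into this formula, and the density u into its last term, gives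
    the weak equation up to sign and up to terms in 1_{G0}. Those terms cancel by the fundamental
    theorem of calculus in time ([indicator_time_derivative]). The assembly is [weak_equation].

    The Dynkin formula is obtained by discretizing time with mesh h and freezing the path at the
    first grid time at which it is no longer alive. Survival up to a grid time belongs to the
    history ([survival_history]), and the next increment is independent of that history. The mean
    change over one step is therefore a Gaussian average ([Rintegral_increment]), which is h/2 times
    the Laplacian up to O(h^{3/2}) ([heat_expansion]). About t/h such errors sum to O(h^{1/2}), and
    the main terms converge to the integral ([coef_cvg], [riemann_sum_cvg]).

    All statements about tau rest on one topological fact: for closed, non-decreasing and
    right-continuous sets, the graph of all (r, x) with x in [G r] is closed in space-time
    ([graph_separation]). Consequently tau is attained, tau > s can be tested at countably many
    times, and a stopped path that is dead at s lies in [G s].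

    Existence of a density ([alive_density_exists]) uses that xi + b is absolutely continuous for
    each fixed b, so W_s is too. Radon-Nikodym on time times space then yields a jointly measurable
    version. *)

(** * Integration preliminaries: null sets, bounded functions, real-valued linearity *)

Section ae_integral.
Context d (T : measurableType d) (R : realType) (mu : {measure set T -> \bar R}).
Local Open Scope ereal_scope.
Import HBNNSimple.

(** The integral is a supremum over simple functions below the integrand. Multiplying such a
    function below [f] by the indicator of the complement of a null set containing the points where
    [f] and [g] differ puts it below [g] and keeps its integral. *)
Lemma ge0_le_integral_ae_eq (f g : T -> \bar R) :
  (forall x, 0 <= f x) -> (forall x, 0 <= g x) -> ae_eq mu setT f g ->
  \int[mu]_x f x <= \int[mu]_x g x.
Proof.
move=> f0 g0 [N [mN N0 fgN]]; rewrite !ge0_integralTE//.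
apply: ge_ereal_sup => _ [h /= hf <-].
have mNC : measurable (~` N) by exact: measurableC.
apply: ereal_sup_ubound; exists (proj_nnsfun h mNC) => /=.
  move=> x; rewrite /= mindicE.
  have [xN|xN] := pselect (N x).
    by rewrite memNset ?mulr0//= => /(_ xN).
  rewrite mem_set// mulr1 (le_trans (hf x))//.
  suff -> : f x = g x by [].
  by apply: contrapT => fgx; apply: xN; apply: fgN => /= /(_ I).
rewrite -!integralT_nnsfun; apply: ge0_ae_eq_integral => //.
- exact/measurable_EFinP.
- exact/measurable_EFinP.
- by move=> x _; rewrite lee_fin.
- by move=> x _; rewrite lee_fin.
- exists N; split => // x /=; apply: contra_notP => xN _.
  by rewrite /= mindicE mem_set// mulr1.
Qed.

(* Unlike [ae_eq_integral], no measurability of [f] or [g] is assumed. *)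
Lemma integral_ae_eqN (D : set T) (f g : T -> \bar R) :
  ae_eq mu D f g -> \int[mu]_(x in D) f x = \int[mu]_(x in D) g x.
Proof.
move=> fg; rewrite integral_mkcond [RHS]integral_mkcond.
have {}fg : ae_eq mu setT (f \_ D) (g \_ D).
  case: fg => N [mN N0 sN]; exists N; split => // x /= H; apply: sN => /= E.
  apply: H => _; rewrite !patchE; case: ifPn => // /[!inE] Dx; exact: E.
move: fg => /ae_eq_funeposneg[fgp fgn].
rewrite integralE [RHS]integralE; congr (_ - _); apply/eqP; rewrite eq_le;
  by rewrite !ge0_le_integral_ae_eq//; exact: ae_eq_sym.
Qed.

End ae_integral.

Section bounded_integrable.
Context d (T : measurableType d) (R : realType).

Lemma integrable_bounded (mu : {finite_measure set T -> \bar R}) (D : set T)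
    (f : T -> R) (M : R) : measurable D -> measurable_fun D f ->
  (forall x, D x -> `|f x| <= M) -> mu.-integrable D (EFin \o f).
Proof.
move=> mD mf fM; have [D0|/set0P[x0 Dx0]] := eqVneq D set0.
  by rewrite D0; exact: integrable_set0.
have M0 : 0 <= M by exact: le_trans (normr_ge0 _) (fM _ Dx0).
apply: (@le_integrable _ _ _ mu D mD _ (EFin \o cst M)).
- exact/measurable_EFinP.
- by move=> x Dx /=; rewrite lee_fin (ger0_norm M0) fM.
- exact: finite_measure_integrable_cst.
Qed.

Lemma Rintegral_cst_probability (P : probability T R) (M : R) :
  \int[P]_x M = M.
Proof.
have := @Rintegral_cst _ _ _ P setT measurableT M.
by rewrite [X in _ * fine X]probability_setT mulr1.
Qed.

Lemma le_normr_Rintegral_probability (P : probability T R) (f : T -> R) (M : R) :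
  measurable_fun setT f -> (forall x, `|f x| <= M) ->
  `|\int[P]_x f x| <= M.
Proof.
move=> mf fM; have iF : P.-integrable setT (EFin \o f).
  by apply: (@integrable_bounded _ _ _ M).
rewrite (le_trans (le_normr_Rintegral _ iF))//.
rewrite -[leRHS](Rintegral_cst_probability P).
apply: le_Rintegral => //; first exact: integrable_norm.
exact: finite_measure_integrable_cst.
Qed.

Lemma cvg_Rintegral_bounded (P : {finite_measure set T -> \bar R}) (D : set T)
    (f_ : nat -> T -> R)
    (f : T -> R) (M : R) : measurable D ->
  (forall n, measurable_fun D (f_ n)) ->
  (forall n x, D x -> `|f_ n x| <= M) ->
  (forall x, D x -> f_ ^~ x @ \oo --> f x) ->
  [/\ measurable_fun D f, P.-integrable D (EFin \o f) &
  (\int[P]_(x in D) f_ n x) @[n --> \oo] --> \int[P]_(x in D) f x].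
Proof.
move=> mD mf_ f_M f_f.
have mf : measurable_fun D f by apply: measurable_fun_cvg mf_ f_f.
have [|||||iF _ cF] := @dominated_convergence _ _ _ P D mD (fun n => EFin \o f_ n)
  (EFin \o f) (EFin \o cst M).
- by move=> n; exact/measurable_EFinP.
- exact/measurable_EFinP.
- apply: aeW => x Dx; apply: cvg_EFin; first exact: nearW.
  exact: f_f.
- exact: finite_measure_integrable_cst.
- by apply: aeW => x n Dx; exact: f_M.
split=> //; apply: fine_cvg.
by rewrite fineK//; exact: integrable_fin_num.
Qed.

End bounded_integrable.

Section real_integrable.
Context d (T : measurableType d) (R : realType) (mu : {measure set T -> \bar R}).
Context (D : set T) (mD : measurable D).
Implicit Types f g : T -> R.

Lemma integrable_EFinD f g : mu.-integrable D (EFin \o f) ->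
  mu.-integrable D (EFin \o g) ->
  mu.-integrable D (fun x => (f x + g x)%:E).
Proof. exact: integrableD. Qed.

Lemma integrable_EFinB f g : mu.-integrable D (EFin \o f) ->
  mu.-integrable D (EFin \o g) ->
  mu.-integrable D (fun x => (f x - g x)%:E).
Proof. exact: integrableB. Qed.

Lemma integrable_EFinZ k f : mu.-integrable D (EFin \o f) ->
  mu.-integrable D (fun x => (k * f x)%:E).
Proof. exact: integrableZl. Qed.

Lemma integral_EFinZ k f : mu.-integrable D (EFin \o f) ->
  (\int[mu]_(x in D) (k * f x)%:E = k%:E * \int[mu]_(x in D) (f x)%:E)%E.
Proof. by move=> fi; under eq_integral do rewrite EFinM; rewrite integralZl. Qed.

Lemma integral_EFinD f g : mu.-integrable D (EFin \o f) ->
  mu.-integrable D (EFin \o g) ->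
  (\int[mu]_(x in D) (f x + g x)%:E =
   \int[mu]_(x in D) (f x)%:E + \int[mu]_(x in D) (g x)%:E)%E.
Proof. by move=> fi gi; under eq_integral do rewrite EFinD; rewrite integralD. Qed.

Lemma integral_EFinB f g : mu.-integrable D (EFin \o f) ->
  mu.-integrable D (EFin \o g) ->
  (\int[mu]_(x in D) (f x - g x)%:E =
   \int[mu]_(x in D) (f x)%:E - \int[mu]_(x in D) (g x)%:E)%E.
Proof. by move=> fi gi; under eq_integral do rewrite EFinB; rewrite integralB. Qed.

End real_integrable.

(** * Joint measurability of functions continuous in time *)

Section joint_measurability.
Context (R : realType).

Lemma floor_approx_cvg (s : R) :
  (Num.floor (n.+1%:R * s))%:~R / n.+1%:R @[n --> \oo] --> s.
Proof.
apply/(@cvgrPdist_le R R^o) => e e0; near=> n.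
have n0 : 0 < n.+1%:R :> R by [].
have /andP[f1 f2] := floor_itv (n.+1%:R * s).
have fs : (Num.floor (n.+1%:R * s))%:~R / n.+1%:R <= s.
  by rewrite ler_pdivrMr// [leRHS]mulrC.
rewrite ger0_norm ?subr_ge0// lerBlDl.
have : n.+1%:R^-1 <= e by near: n; have := near_infty_natSinv_lt (PosNum e0); apply: filterS => m /ltW.
move: f2; rewrite intrD => f2 ne.
rewrite -lerBlDl; apply: le_trans ne.
rewrite -(ler_pM2l n0) mulrBr mulrCA divff ?gt_eqF// mulr1 lerBlDl.
by rewrite ltW.
Unshelve. all: by end_near. Qed.

(** Rounding the time down to the grid of mesh 1/(n+1) gives functions whose preimages are countable
    unions of measurable rectangles. By continuity in time they converge pointwise to [f]. *)
Lemma measurable_uncurry_continuous d (T : measurableType d) (f : R -> T -> R) :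
  (forall x, continuous (f ^~ x)) -> (forall s, measurable_fun setT (f s)) ->
  measurable_fun setT (fun z : measurableTypeR R * T => f z.1 z.2).
Proof.
move=> cf mf.
apply: (@measurable_fun_cvg _ _ _ _ (fun n (z : measurableTypeR R * T) =>
    f ((Num.floor (n.+1%:R * z.1))%:~R / n.+1%:R) z.2)); last first.
  move=> [s x] _ /=; apply: (cvg_comp _ (f ^~ x)); first exact: floor_approx_cvg.
  exact: cf.
move=> n _ B mB; rewrite setTI.
rewrite [X in measurable X](_ : _ = \bigcup_(k in [set: int])
    ([set s : R | Num.floor (n.+1%:R * s) = k] `*`
     (f (k%:~R / n.+1%:R) @^-1` B))); last first.
  apply/seteqP; split => [[s x] /= Bs|[s x] [k _ [/= <-]]]; last by [].
  by exists (Num.floor (n.+1%:R * s)).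
apply: countable_bigcupT_measurable => [|k]; first exact/countableP.
apply: measurableX; last by rewrite -[X in measurable X]setTI; exact: mf.
rewrite [X in measurable X](_ : _ =
  `[k%:~R / n.+1%:R, (k + 1)%:~R / n.+1%:R[%classic)//.
apply/seteqP; split => s /=; rewrite in_itv/=.
  move/eqP; rewrite floor_eq => /andP[k1 k2].
  by rewrite ler_pdivrMr// ltr_pdivlMr// !(mulrC s) k1.
rewrite ler_pdivrMr// ltr_pdivlMr// !(mulrC s) => k12.
by apply/eqP; rewrite floor_eq.
Qed.

End joint_measurability.

(** * Change of density, and freezing of an independent variable *)

Section density.
Local Open Scope charge_scope.
Context d (T : measurableType d) (R : realType).
Local Open Scope ereal_scope.

(** The function [f] agrees almost everywhere with the Radon-Nikodym derivative of [nu], for which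
    the change of variables is known. Integrability of the product comes from the same identity
    applied to the absolute value of [h]. *)
Lemma integral_density (nu : {finite_measure set T -> \bar R})
    (mu : {sigma_finite_measure set T -> \bar R}) (f : T -> R) (h : T -> R) :
  measurable_fun setT f -> (forall x, 0 <= f x)%R ->
  (forall A, measurable A -> nu A = \int[mu]_(x in A) (f x)%:E) ->
  nu.-integrable setT (EFin \o h) -> measurable_fun setT h ->
  mu.-integrable setT (fun x => (h x * f x)%:E) /\
  \int[mu]_x (h x * f x)%:E = \int[nu]_x (h x)%:E.
Proof.
move=> mf f0 nuE ih mh.
have numu : nu `<< mu.
  apply/null_content_dominatesP => A mA A0; rewrite nuE//.
  by apply: null_set_integral => //; exact/measurable_EFinP/measurable_funTS.
have iF : mu.-integrable setT (EFin \o f).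
  apply/integrableP; split; first exact/measurable_EFinP.
  under eq_integral do rewrite /= ger0_norm//.
  by rewrite -nuE// ltey_eq fin_num_measure.
have fE : ae_eq mu setT (EFin \o f) ('d (charge_of_finite_measure nu) '/d mu).
  apply: integral_ae_eq => //.
  move=> A _ mA; rewrite -Radon_Nikodym_integral//=.
  exact/esym/nuE.
have mhf : measurable_fun setT (fun x => (h x * f x)%:E).
  by apply/measurable_EFinP; exact: measurable_funM.
have hf (k : T -> R) : measurable_fun setT k -> nu.-integrable setT (EFin \o k) ->
    \int[mu]_x (k x * f x)%:E = \int[nu]_x (k x)%:E.
  move=> mk ik; rewrite -(Radon_Nikodym_change_of_variables numu measurableT ik).
  apply: ae_eq_integral => //.
  - by apply/measurable_EFinP; exact: measurable_funM.
  - apply: emeasurable_funM; first exact/measurable_EFinP.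
    by apply: (measurable_int mu); exact: Radon_Nikodym_integrable.
  - move: fE; apply: filterS => x /= E Dx.
    by rewrite -E//.
split; last exact: hf.
apply/integrableP; split=> //.
rewrite (_ : (fun x => _) = fun x => (`|h x| * f x)%:E); last first.
  by apply/funext => x; rewrite /= normrM (ger0_norm (f0 x)).
rewrite hf.
- by case/integrableP : ih.
- exact: measurableT_comp.
- exact: integrable_norm.
Qed.

End density.

Section independence.
Context d d1 d2 (O : measurableType d) (T1 : measurableType d1)
  (T2 : measurableType d2) (R : realType) (P : probability O R).
Variables (W : O -> T1) (Y : O -> T2) (F : T1 * T2 -> R) (M : R).
Hypotheses (mW : measurable_fun setT W) (mY : measurable_fun setT Y).
Hypothesis mF : measurable_fun setT F.
Hypothesis FM : forall z, `|F z| <= M.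
Hypothesis WY : forall A B, measurable A -> measurable B ->
  P (W @^-1` A `&` Y @^-1` B) = (P (W @^-1` A) * P (Y @^-1` B))%E.

HB.instance Definition _ := isMeasurableFun.Build _ _ _ _ W mW.
HB.instance Definition _ := isMeasurableFun.Build _ _ _ _ Y mY.
Let WYpair x := (W x, Y x).
Let mWY : measurable_fun setT WYpair.
Proof. exact: measurable_fun_pair. Qed.
HB.instance Definition _ := isMeasurableFun.Build _ _ _ _ WYpair mWY.

(** Independence makes the joint law a product, and Fubini integrates [Y] out with [W] frozen. When
    [W] is the identity into the sample space with a smaller sigma-algebra, this does the work of a
    conditional expectation. *)
Lemma Rintegral_independent : \int[P]_x F (W x, Y x) =
  \int[P]_x \int[distribution P Y]_y F (W x, y).
Proof.
have iF (m : probability (T1 * T2)%type R) : m.-integrable setT (EFin \o F).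
  exact: (@integrable_bounded _ _ _ m setT F M).
have E (X : set (T1 * T2)) : measurable X ->
    (distribution P W \x distribution P Y)%E X = distribution P WYpair X.
  by move=> mX; exact: product_measure_unique.
have iF' : (distribution P W \x distribution P Y)%E.-integrable setT (EFin \o F).
  apply/integrableP; split; first exact/measurable_EFinP.
  have /integrableP[_] := iF (distribution P WYpair).
  rewrite (eq_measure_integral (distribution P W \x distribution P Y)%E)//.
  by move=> A mA _; apply/esym/E.
have : (\int[P]_x (F (W x, Y x))%:E = \int[P]_x
    (\int[distribution P Y]_y F (W x, y))%:E)%E; last by rewrite /Rintegral => ->.
transitivity (\int[distribution P WYpair]_z (F z)%:E)%E.
  rewrite integral_distribution//; first exact/measurable_EFinP.
  apply: (@integrable_bounded _ _ _ P setT (F \o WYpair) M) => //.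
    exact: measurableT_comp.
  by move=> x _; exact: FM.
transitivity (\int[(distribution P W \x distribution P Y)%E]_z (F z)%:E)%E.
  by apply: eq_measure_integral => A mA _; exact/esym/E.
rewrite -(integral12_prod_meas1 iF').
have FE x : fubini_F (distribution P Y) (EFin \o F) x =
    (\int[distribution P Y]_y F (x, y))%:E.
  rewrite /fubini_F/= /Rintegral fineK//; apply: integrable_fin_num => //.
  apply: (@integrable_bounded _ _ _ _ setT (fun y => F (x, y)) M) => //.
  exact: (measurableT_comp mF (pair1_measurable _)).
have mG : measurable_fun setT (fubini_F (distribution P Y) (EFin \o F)).
  exact: measurable_fubini_F iF'.
rewrite integral_distribution//.
  by apply: eq_integral => x _; rewrite -FE.
rewrite (_ : _ \o _ = EFin \o (fun x => \int[distribution P Y]_y F (W x, y))).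
  apply: (@integrable_bounded _ _ _ _ _ _ M) => //.
    apply/measurable_EFinP.
    rewrite (_ : _ \o _ = fubini_F (distribution P Y) (EFin \o F) \o W).
      exact: measurableT_comp.
    by apply/funext => x /=; rewrite FE.
  move=> x _; apply: le_normr_Rintegral_probability => //.
  exact: (measurableT_comp mF (pair1_measurable _)).
by apply/funext => x /=; rewrite FE.
Qed.

End independence.

Definition pushforward_measure d1 d2 (T1 : measurableType d1)
    (T2 : measurableType d2) (R : realType) (m : {measure set T1 -> \bar R})
    (f : T1 -> T2) (mf : measurable_fun setT f) : {measure set T2 -> \bar R} :=
  @measure_function_pushforward__canonical__measure_function_Measure
    _ _ _ _ _ m _ mf.

(** * Borel structure on row vectors, and translation invariance of Lebesgue measure *)

Section borel_row_vectors.
Context (R : realType) (n : nat).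
Local Notation V := 'rV[R]_n.

Lemma open_measurable_rV (U : set V) : open U -> measurable U.
Proof. exact: sub_sigma_algebra. Qed.

Lemma closed_measurable_rV (F : set V) : closed F -> measurable F.
Proof.
move=> cF; rewrite -[F]setCK; apply: measurableC; apply: open_measurable_rV.
exact: closed_openC.
Qed.

Lemma continuous_measurable_rV (f : V -> R) :
  continuous f -> measurable_fun setT f.
Proof.
move=> cf; apply: (measurability _ (RGenOpens.measurableE R)) => _ [_ [a [b ->] <-]].
rewrite setTI; apply: open_measurable_rV; apply: open_comp => //.
Qed.

Lemma measurable_rV_coord d (T : measurableType d) (f : T -> V) i :
  measurable_fun setT f -> measurable_fun setT (fun x => f x ord0 i).
Proof. by move=> mf; exact: measurableT_comp (@measurable_coord R n i) mf. Qed.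

Lemma measurable_rVD d (T : measurableType d) (f g : T -> V) :
  measurable_fun setT f -> measurable_fun setT g ->
  measurable_fun setT (fun x => f x + g x).
Proof.
move=> mf mg; apply: measurable_fun_rV => i.
under eq_fun do rewrite mxE.
by apply: measurable_funD; exact: measurable_rV_coord.
Qed.

Lemma measurable_rVB d (T : measurableType d) (f g : T -> V) :
  measurable_fun setT f -> measurable_fun setT g ->
  measurable_fun setT (fun x => f x - g x).
Proof.
move=> mf mg; apply: measurable_fun_rV => i.
under eq_fun do rewrite !mxE.
by apply: measurable_funB; exact: measurable_rV_coord.
Qed.

Lemma measurable_uncurry_rV d (T : measurableType d) (f : R -> T -> V) :
  (forall x, continuous (f ^~ x)) -> (forall s, measurable_fun setT (f s)) ->
  measurable_fun setT (fun z : measurableTypeR R * T => f z.1 z.2).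
Proof.
move=> cf mf; apply: measurable_fun_rV => i.
apply: (@measurable_uncurry_continuous R _ T (fun s x => f s x ord0 i)).
  move=> x s; apply: (@continuous_comp _ _ _ (f ^~ x) (fun v : V => v ord0 i)).
    exact: cf.
  exact: coord_continuous.
by move=> s; exact: measurable_rV_coord.
Qed.

End borel_row_vectors.

Section translation_invariance.
Context (R : realType).
Local Open Scope ereal_scope.

Lemma lebesgue_measure_translation (a : R) (A : set (measurableTypeR R)) :
  measurable A -> lebesgue_measure ((fun x => x + a)%R @^-1` A) = lebesgue_measure A.
Proof.
have ma : measurable_fun setT (fun x : measurableTypeR R => (x + a)%R : measurableTypeR R).
  exact: measurable_funD.
move=> mA; rewrite [RHS](@lebesgue_measure_unique R (pushforward_measure lebesgue_measure ma))//.
move=> _ [[x y] _ <-] /=; rewrite /pushforward (_ : _ @^-1` _ = `](x - a)%R, (y - a)%R]%classic).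
  by rewrite !lebesgue_measure_itv/= !lte_fin ltrD2r -!EFinD (_ : y - a - (x - a) = y - x)%R//; ring.
by apply/seteqP; split => z /=; rewrite !in_itv/= ltrBlDr lerBrDr.
Qed.

(** Induction on the dimension: the translated product measure agrees with the product measure on
    rectangles, hence everywhere. This is what makes a shift of [xi] by a fixed vector absolutely
    continuous in [started_null]. *)
Lemma lebesgue_measure_rV_translation d (v : 'rV[R]_d) (A : set 'rV[R]_d) :
  measurable A -> lebesgue_measure_rV d ((fun x => x + v)%R @^-1` A) =
                  lebesgue_measure_rV d A.
Proof.
elim: d v A => [|d IH] v A mA.
  congr (lebesgue_measure_rV 0 _); apply/funext => x /=.
  by congr A; apply/rowP => -[].
rewrite /= /lebesgue_measure_rV_step /pushforward.
have ms : measurable_fun setT (fun z : measurableTypeR R * 'rV[R]_d =>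
    ((z.1 + (uncons_rV v).1)%R : measurableTypeR R, (z.2 + (uncons_rV v).2)%R)).
  apply: measurable_fun_pair; first exact: measurable_funD.
  exact: measurable_rVD.
rewrite [RHS](@product_measure_unique _ _ _ _ _ lebesgue_measure (lebesgue_measure_rV d)
  (pushforward_measure (lebesgue_measure \x lebesgue_measure_rV d) ms)) /=.
- rewrite /pushforward; congr (_ _); apply/funext => z /=; congr A.
  apply/rowP => i; rewrite mxE; case: (unliftP ord0 i) => [j ->|->].
    by rewrite !cons_rV_lift/= !mxE.
  by rewrite !cons_rV0.
- move=> B C mB mC; rewrite /pushforward.
  rewrite (_ : _ @^-1` _ = ((fun x => x + v ord0 ord0)%R @^-1` B) `*`
    ((fun x => x + (uncons_rV v).2)%R @^-1` C))//.
  rewrite product_measure1E//.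
  + by rewrite IH//; congr (_ * _); exact: lebesgue_measure_translation.
  + rewrite -[X in measurable X]setTI.
    have : measurable_fun setT (fun x : measurableTypeR R =>
       (x + v ord0 ord0)%R : measurableTypeR R) by exact: measurable_funD.
    exact.
  + rewrite -[X in measurable X]setTI.
    have : measurable_fun setT (fun x : 'rV[R]_d => x + (uncons_rV v).2)%R by exact: measurable_rVD.
    exact.
- by rewrite -[X in measurable X]setTI; exact: measurable_cons_rV.
Qed.

End translation_invariance.

(** * Moments of the normal law, Taylor bounds and the one-dimensional expansion *)

Section normal_moments.
Context (R : realType).
Notation leb1 := (@lebesgue_measure R).

(** The integrals over growing symmetric intervals converge to the full integral by domination, and
    the fundamental theorem of calculus identifies them with boundary terms. Normal moments follow
    once the integrand is recognized as a derivative. *)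
Lemma integral_derivative0 (F f : R -> R) :
  (forall x : R, is_derive x (1 : R) F (f x)) -> continuous f ->
  leb1.-integrable setT (EFin \o f) ->
  F n.+1%:R - F (- n.+1%:R) @[n --> \oo] --> (0 : R) ->
  (\int[leb1]_x (f x)%:E = 0)%E.
Proof.
move=> dF cf intf Fn.
have cF : continuous F.
  by move=> x; apply/differentiable_continuous/derivable1_diffP; case: (dF x).
pose D n : set R := `[(- n.+1%:R)%R, n.+1%:R]%classic.
have mf : measurable_fun setT f by exact: continuous_measurable_fun.
have mD n : measurable (D n) by exact: measurable_itv.
have cvgD : (\int[leb1]_x ((f \_ (D n)) x)%:E @[n --> \oo] --> \int[leb1]_x (f x)%:E)%E.
  have [|||||_ _] := @dominated_convergence _ _ _ leb1 setT measurableT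
    (fun n => EFin \o (f \_ (D n))) (EFin \o f) (EFin \o (fun x => `|f x|)).
  - move=> n; apply/measurable_EFinP; have [+ _] := measurable_restrictT f (mD n).
    by apply; exact: measurable_funTS.
  - exact/measurable_EFinP.
  - apply: aeW => x _; apply: cvg_EFin; first exact: nearW.
    apply: cvg_near_cst; near=> n; rewrite /= patchE mem_set//=.
    rewrite /D/= in_itv/= -ler_norml (@le_trans _ _ n%:R)//; last by rewrite ler_nat.
    by near: n; exact: nbhs_infty_ger.
  - exact: integrable_norm.
  - apply: aeW => x n _; rewrite /= lee_fin patchE.
    by case: ifPn => // _; rewrite normr0.
  exact.
have ED n : (\int[leb1]_x ((f \_ (D n)) x)%:E = (F n.+1%:R - F (- n.+1%:R))%:E)%E.
  under eq_integral do rewrite -[(_ \_ _ _)%:E]/((EFin \o _) _) -restrict_EFin.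
  rewrite -integral_mkcond EFinB; apply: continuous_FTC2.
  - by rewrite -subr_gt0 opprK addr_gt0.
  - exact: continuous_subspaceT.
  - split.
    + by move=> x _; case: (dF x).
    + apply: cvg_at_right_filter; exact: cF.
    + apply: cvg_at_left_filter; exact: cF.
  - by move=> x _; rewrite derive1E; case: (dF x).
have : (\int[leb1]_x ((f \_ (D n)) x)%:E @[n --> \oo] --> 0)%E.
  under eq_fun do rewrite ED.
  by apply: cvg_EFin => //; exact: nearW.
exact: cvg_unique cvgD.
Unshelve. all: by end_near. Qed.

Context (s : R) (s0 : 0 < s).
Let s_neq0 : s != 0. Proof. by rewrite gt_eqF. Qed.
Let p := normal_pdf 0 s.
Let p_ge0 x : 0 <= p x. Proof. exact: normal_pdf_ge0. Qed.
Let mp : measurable_fun setT p. Proof. exact: measurable_normal_pdf. Qed.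
Let cp : continuous p. Proof. exact: continuous_normal_pdf. Qed.

Lemma is_derive_normal_pdf (x : R) : is_derive x (1 : R) p (- (x / s ^+ 2) * p x).
Proof.
rewrite /p normal_pdfE// /normal_fun.
rewrite [X in is_derive _ _ X _](_ : _ = (normal_peak s \*: (expR \o
   (fun x => - (s ^+ 2 *+ 2)^-1 * (x ^+ 2)))))%R; last first.
  by apply/funext => y /=; rewrite subr0 !mulNr [X in - X]mulrC.
apply: is_derive_eq => /=.
rewrite subr0 /GRing.scale/= ?mulr1.
rewrite [X in _ = _ * (_ * expR X)](_ : _ = - (s ^+ 2 *+ 2)^-1 * x ^+ 2); last by ring.
by rewrite -mulr_natr; field.
Qed.

(** Half of the Gaussian exponent absorbs the cube, and the other half is the exponent of the normal
    law with deviation sqrt 2 times [s]. Integrability of cubic growth and a third-moment bound then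
    follow from the total mass of a wider normal law. *)
Lemma normal_pdf_cube x :
  `|x| ^+ 3 * p x <= 48 * s ^+ 3 * normal_pdf 0 (Num.sqrt 2 * s) x.
Proof.
have t0 : Num.sqrt 2 * s != 0 by rewrite mulf_neq0// gt_eqF// sqrtr_gt0.
rewrite /p !normal_pdfE// /normal_fun !subr0.
pose z := `|x| / (2 * s).
have z0 : 0 <= z by rewrite divr_ge0// mulr_ge0// ltW.
have xz : `|x| = 2 * s * z by rewrite /z; field.
have x2 : x ^+ 2 = 4 * s ^+ 2 * z ^+ 2 by rewrite -[LHS]real_normK ?num_real// xz; ring.
have -> : - x ^+ 2 / (s ^+ 2 *+ 2) = - z ^+ 2 - z ^+ 2.
  by rewrite x2 -mulr_natr; field.
have -> : - x ^+ 2 / ((Num.sqrt 2 * s) ^+ 2 *+ 2) = - z ^+ 2.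
  by rewrite exprMn sqr_sqrtr// x2 -mulr_natr; field.
have pk : normal_peak s <= 2 * normal_peak (Num.sqrt 2 * s).
  rewrite /normal_peak exprMn sqr_sqrtr//.
  have a0 : 0 < s ^+ 2 * pi *+ 2 by rewrite pmulrn_lgt0// mulr_gt0 ?exprn_gt0 ?pi_gt0.
  rewrite (_ : 2 * s ^+ 2 * pi *+ 2 = 2 * (s ^+ 2 * pi *+ 2)); last by ring.
  rewrite sqrtrM// invfM mulrA.
  rewrite ler_peMl ?invr_ge0//.
  rewrite ler_pdivlMr ?sqrtr_gt0// mul1r.
  have {2}-> : 2 = Num.sqrt (2 ^+ 2) :> R by rewrite sqrtr_sqr ger0_norm.
  by rewrite ler_wsqrtr// -natrX ler_nat.
(* Here [|x|] is 2 s z, so the cube is 8 s^3 z^3. The factor 3 comes from z^3 <= 3 (1 + z^4/2) and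
   exp(z^2) >= 1 + z^4/2. The final 48 is 24 times the bound 2 on the ratio sqrt 2 of the peaks. *)
have e3 : `|x| ^+ 3 * expR (- z ^+ 2) <= 24 * s ^+ 3.
  rewrite expRN ler_pdivrMr ?expR_gt0// xz.
  have := @expR_ge1Dxn R (z ^+ 2) 1 (sqr_ge0 _); rewrite -exprM => ez.
  have -> : (2 * s * z) ^+ 3 = 8 * s ^+ 3 * z ^+ 3 by ring.
  apply: (@le_trans _ _ (8 * s ^+ 3 * (3 * (1 + z ^+ 4 / 2)))).
    rewrite ler_wpM2l//; first by rewrite mulr_ge0// exprn_ge0// ltW.
    nra.
  have -> : 24 * s ^+ 3 * expR (z ^+ 2) = 8 * s ^+ 3 * (3 * expR (z ^+ 2)) by ring.
  by rewrite !ler_wpM2l// mulr_ge0// exprn_ge0// ltW.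
rewrite expRD.
have -> : `|x| ^+ 3 * (normal_peak s * (expR (- z ^+ 2) * expR (- z ^+ 2))) =
  (`|x| ^+ 3 * expR (- z ^+ 2)) * (normal_peak s * expR (- z ^+ 2)) by ring.
have -> : 48 * s ^+ 3 * (normal_peak (Num.sqrt 2 * s) * expR (- z ^+ 2)) =
  (24 * s ^+ 3) * (2 * normal_peak (Num.sqrt 2 * s) * expR (- z ^+ 2)) by ring.
apply: ler_pM => //.
- by rewrite mulr_ge0 ?expR_ge0// normal_peak_ge0.
- by rewrite ler_wpM2r// expR_ge0.
Qed.

Let cube_ge (a : R) : 0 <= a -> (a <= 1 + 1 * a ^+ 3) /\ (a ^+ 2 <= 1 + 1 * a ^+ 3).
Proof.
move=> a0; have := mulr_ge0 (addr_ge0 a0 ler01) (sqr_ge0 (a - 1)).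
rewrite (_ : (a + 1) * (a - 1) ^+ 2 = a ^+ 3 - a ^+ 2 - a + 1); last by ring.
by have := sqr_ge0 a; split; lra.
Qed.

Lemma integrable_mul_normal_pdf (q : R -> R) (a b : R) :
  measurable_fun setT q -> (forall x, `|q x| <= a + b * `|x| ^+ 3) ->
  leb1.-integrable setT (fun x => (q x * p x)%:E).
Proof.
move=> mq qab.
have a0 : 0 <= a by have := qab 0; rewrite normr0 expr0n/= mulr0 addr0; exact: le_trans.
apply: (@le_integrable _ _ _ leb1 setT measurableT _ (fun x => (a * p x +
    `|b| * (48 * s ^+ 3) * normal_pdf 0 (Num.sqrt 2 * s) x)%:E)).
- by apply/measurable_EFinP; exact: measurable_funM.
- move=> x _ /=; rewrite lee_fin.
  rewrite [leRHS]ger0_norm; last first.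
    by rewrite addr_ge0// mulr_ge0 ?normal_pdf_ge0// mulr_ge0// mulr_ge0// exprn_ge0// ltW.
  rewrite normrM (ger0_norm (p_ge0 x)).
  apply: (@le_trans _ _ ((a + `|b| * `|x| ^+ 3) * p x)).
    rewrite ler_wpM2r// (le_trans (qab x))// lerD2l ler_wpM2r ?exprn_ge0//.
    exact: ler_norm.
  rewrite mulrDl lerD2l -[leLHS]mulrA -[leRHS]mulrA.
  by apply: ler_wpM2l => //; exact: normal_pdf_cube.
- by apply: integrable_EFinD => //; apply: integrable_EFinZ => //;
    exact: integrable_normal_pdf.
Qed.

Lemma normal_moment0 : (\int[leb1]_x (p x)%:E = 1)%E.
Proof. exact: integral_normal_pdf. Qed.

Lemma normal_moment1 : (\int[leb1]_x (x * p x)%:E = 0)%E.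
Proof.
apply: (@integral_derivative0 (fun x => - (s ^+ 2) * p x)).
- move=> x; have dp := is_derive_normal_pdf x.
  rewrite [X in is_derive _ _ X _](_ : _ = (- s ^+ 2) \*: p)%R//.
  by apply: is_derive_eq => /=; rewrite /GRing.scale/=; field.
- by move=> x; apply: cvgM; [exact: cvg_id|exact: cp].
- apply: (@integrable_mul_normal_pdf id 1 1) => // x.
  by have [] := cube_ge (normr_ge0 x).
- apply: cvg_near_cst; near=> n.
  rewrite (_ : p (- n.+1%:R) = p n.+1%:R) ?subrr//.
  by rewrite /p !normal_pdfE// /normal_fun !subr0 sqrrN.
Unshelve. all: by end_near. Qed.

Lemma normal_moment2 : (\int[leb1]_x (x ^+ 2 * p x)%:E = (s ^+ 2)%:E)%E.
Proof.
have i2 : leb1.-integrable setT (fun x => (x ^+ 2 * p x)%:E).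
  apply: (@integrable_mul_normal_pdf (fun x => x ^+ 2) 1 1) => // x.
  by rewrite normrX; have [] := cube_ge (normr_ge0 x).
have i0 : leb1.-integrable setT (fun x => (s ^+ 2 * p x)%:E).
  by apply: integrable_EFinZ => //; exact: integrable_normal_pdf.
suff : (\int[leb1]_x ((x ^+ 2 - s ^+ 2) * p x)%:E = 0)%E.
  under eq_integral do rewrite mulrBl.
  rewrite integral_EFinB//.
  have -> : (\int[leb1]_x (s ^+ 2 * p x)%:E = (s ^+ 2)%:E)%E.
    by rewrite integral_EFinZ ?normal_moment0 ?mule1//; exact: integrable_normal_pdf.
  by move/eqP; rewrite sube_eq// ?add0e; [move/eqP|exact: integrable_fin_num].
(* The derivative of p is -x p / s^2, so this function is an antiderivative of (x^2 - s^2) p. *)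
apply: (@integral_derivative0 (fun x => - (s ^+ 2) * (x * p x))).
- move=> x; have dp := is_derive_normal_pdf x.
  rewrite [X in is_derive _ _ X _](_ : _ = (- s ^+ 2) \*: (id * p))%R//.
  by apply: is_derive_eq => /=; rewrite /GRing.scale/=; field.
- move=> x; apply: cvgM; last exact: cp.
  by apply: cvgB; [exact: (@exprn_continuous R 2)|exact: cvg_cst].
- rewrite (_ : _ \o _ = (fun x => (x ^+ 2 * p x)%:E) \- (fun x => (s ^+ 2 * p x)%:E))%E.
    exact: integrableB.
  by apply/funext => x /=; rewrite mulrBl EFinB.
(* The boundary terms tend to 0: at x >= 1, x^2 p(x) is at most x^3 p(x), which is at most [K], so x
   p(x) is at most K/x. *)
- set K := 48 * s ^+ 3 * normal_peak (Num.sqrt 2 * s).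
  have t0 : Num.sqrt 2 * s != 0 by rewrite mulf_neq0// gt_eqF// sqrtr_gt0.
  have s3 : 0 <= s ^+ 3 by rewrite exprn_ge0// ltW.
  have K0 : 0 <= K by rewrite /K mulr_ge0 ?normal_peak_ge0// mulr_ge0.
  have bd n : `|n.+1%:R * p n.+1%:R| <= K * n.+1%:R^-1.
    rewrite ger0_norm ?mulr_ge0// ler_pdivlMr//.
    apply: le_trans (_ : n.+1%:R ^+ 3 * p n.+1%:R <= _).
      rewrite mulrAC ler_wpM2r// -expr2 ler_weXn2l// ler1n//.
    have := normal_pdf_cube n.+1%:R; rewrite ger0_norm// => /le_trans; apply.
    apply: ler_wpM2l; first by rewrite mulr_ge0.
    exact: normal_pdf_ub.
  have c0 : n.+1%:R * p n.+1%:R @[n --> \oo] --> (0 : R).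
    apply/cvgr0Pnorm_lt => e e0; near=> n.
    apply: le_lt_trans (bd n) _; rewrite ltr_pdivrMr// -ltr_pdivrMl//.
    apply: (@lt_le_trans _ _ n.+1%:R)=> //.
    rewrite -natr1 ltr_pwDr//; near: n; exact: nbhs_infty_ger.
  rewrite (_ : (fun n => _) = (fun n => - (s ^+ 2 *+ 2) * (n.+1%:R * p n.+1%:R))).
    by rewrite -(mulr0 (- (s ^+ 2 *+ 2))); apply: cvgM => //; exact: cvg_cst.
  apply/funext => n; rewrite (_ : p (- n.+1%:R) = p n.+1%:R); first ring.
  by rewrite /p !normal_pdfE// /normal_fun !subr0 sqrrN.
Unshelve. all: by end_near. Qed.

Lemma normal_abs_moment3 :
  (\int[leb1]_x (`|x| ^+ 3 * p x)%:E <= (48 * s ^+ 3)%:E)%E.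
Proof.
have i3 : leb1.-integrable setT (fun x => (`|x| ^+ 3 * p x)%:E).
  apply: (@integrable_mul_normal_pdf (fun x => `|x| ^+ 3) 0 1) => //.
    by apply: measurable_funX; exact: normr_measurable.
  by move=> x; rewrite normrX normr_id add0r mul1r.
have -> : (48 * s ^+ 3)%:E = (\int[leb1]_x
    ((48 * s ^+ 3) * normal_pdf 0 (Num.sqrt 2 * s) x)%:E)%E.
  by rewrite integral_EFinZ ?integral_normal_pdf ?mule1//; exact: integrable_normal_pdf.
apply: le_integral => //.
  by apply: integrable_EFinZ => //; exact: integrable_normal_pdf.
by move=> x _; rewrite lee_fin normal_pdf_cube.
Qed.

(** The inequality between arithmetic and geometric means, |x| <= s/2 + x^2/(2s), reduces the claim
    to the moments of order 0 and 2. *)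
Lemma normal_abs_moment1 : (\int[leb1]_x (`|x| * p x)%:E <= s%:E)%E.
Proof.
have i2 : leb1.-integrable setT (fun x => (x ^+ 2 * p x)%:E).
  apply: (@integrable_mul_normal_pdf (fun x => x ^+ 2) 1 1) => // x.
  by rewrite normrX; have [] := cube_ge (normr_ge0 x).
have i0 : leb1.-integrable setT (EFin \o p) by exact: integrable_normal_pdf.
have iZ0 := integrable_EFinZ measurableT (s / 2) i0.
have iZ2 := integrable_EFinZ measurableT (2 * s)^-1 i2.
apply: (@le_trans _ _ (\int[leb1]_x (s / 2 * p x + (2 * s)^-1 * (x ^+ 2 * p x))%:E)%E).
  apply: le_integral => //.
  - apply: (@integrable_mul_normal_pdf (fun x => `|x|) 1 1) => // x.
    by rewrite normr_id; have [] := cube_ge (normr_ge0 x).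
  - exact: integrable_EFinD.
  - move=> x _; rewrite lee_fin mulrA -mulrDl ler_wpM2r//.
    rewrite -subr_ge0 (_ : _ - _ = (`|x| - s) ^+ 2 / (2 * s)).
      by rewrite divr_ge0 ?sqr_ge0// mulr_ge0// ltW.
    by rewrite -(real_normK (num_real x)); field.
rewrite integral_EFinD// !integral_EFinZ// normal_moment0 normal_moment2.
rewrite -!EFinM -EFinD lee_fin.
by rewrite le_eqVlt; apply/orP; left; apply/eqP; field.
Qed.

End normal_moments.

Section taylor.
Context (R : realType).

Lemma mean_value_bound (r dr : R -> R) (K a : R) :
  (forall x : R, is_derive x (1 : R) r (dr x)) -> r 0 = 0 ->
  (forall b, `|b| <= `|a| -> `|dr b| <= K) -> `|r a| <= K * `|a|.
Proof.
move=> dr_ r0 drK.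
have cr : continuous r.
  by move=> x; apply/differentiable_continuous/derivable1_diffP; case: (dr_ x).
have [a0|a0] := leP 0 a.
  have [c] := MVT_segment a0 (fun x _ => dr_ x) (continuous_subspaceT cr).
  rewrite in_itv/= r0 !subr0 => /andP[c0 ca] ->.
  by rewrite normrM ler_wpM2r// drK// !ger0_norm.
have [c] := MVT_segment (ltW a0) (fun x _ => dr_ x) (continuous_subspaceT cr).
rewrite in_itv/= r0 !sub0r => /andP[c0 ca] /eqP; rewrite eqr_oppLR => /eqP ->.
rewrite normrN normrM normrN ler_wpM2r// drK//.
by rewrite (ler0_norm ca) (ler0_norm (ltW a0)) lerN2.
Qed.

(** The mean value bound is applied to the remainder and to its derivative. The constant is cruder
    than M/6, but only the order 3 matters. *)
Lemma taylor2_bound (g g1 g2 : R -> R) (M a : R) :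
  (forall x : R, is_derive x (1 : R) g (g1 x)) ->
  (forall x : R, is_derive x (1 : R) g1 (g2 x)) ->
  (forall x, `|g2 x - g2 0| <= M * `|x|) ->
  `|g a - (g 0 + g1 0 * a + g2 0 / 2 * a ^+ 2)| <= M * `|a| ^+ 3.
Proof.
move=> dg dg1 g2M.
have M0 : 0 <= M.
  by have := g2M 1; rewrite normr1 mulr1; exact: le_trans.
rewrite (_ : M * `|a| ^+ 3 = (M * `|a| * `|a|) * `|a|); last by ring.
apply: (@mean_value_bound (fun x => g x - (g 0 + g1 0 * x + g2 0 / 2 * x ^+ 2))
  (fun x => g1 x - (g1 0 + g2 0 * x))).
- move=> x.
  rewrite [X in is_derive _ _ X _](_ : _ = g - (cst (g 0) + (g1 0) \*: id +
     (g2 0 / 2) \*: (id ^+ 2)))//.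
  have dgx := dg x; apply: is_derive_eq.
  by rewrite /GRing.scale/= ; field.
- by rewrite mulr0 expr0n/= mulr0 !addr0 subrr.
move=> b ba.
apply: (@le_trans _ _ (M * `|a| * `|b|)); last by rewrite ler_wpM2l// mulr_ge0.
apply: (@mean_value_bound (fun x => g1 x - (g1 0 + g2 0 * x)) (fun x => g2 x - g2 0)).
- move=> x.
  rewrite [X in is_derive _ _ X _](_ : _ = g1 - (cst (g1 0) + (g2 0) \*: id))//.
  have dgx := dg1 x; apply: is_derive_eq.
  by rewrite /GRing.scale/=; field.
- by rewrite mulr0 addr0 subrr.
- by move=> c cb; rewrite (le_trans (g2M c))// ler_wpM2l// (le_trans cb).
Qed.

End taylor.

Section normal_expansion.
Context (R : realType).
Notation leb1 := (@lebesgue_measure R).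

(** The linear term integrates to 0 and the quadratic one to [c2 * s ^+ 2]. The three error terms
    fit the induction over coordinates: [E] is the error of the coordinates already averaged, [N]
    bounds the variation of their second derivatives along the new direction, and [M] is the Taylor
    remainder. *)
Lemma normal_expansion (s : R) (G : R -> R) (c0 c1 c2 E N M : R) : 0 < s ->
  0 <= E -> 0 <= N -> 0 <= M ->
  measurable_fun setT G ->
  (forall a, `|G a - (c0 + c1 * a + c2 * a ^+ 2)| <= E + N * `|a| + M * `|a| ^+ 3) ->
  `|\int[leb1]_a (G a * normal_pdf 0 s a) - (c0 + c2 * s ^+ 2)| <=
  E + N * s + 48 * M * s ^+ 3.
Proof.
move=> s0 E0 N0 M0 mG GB; set p := normal_pdf 0 s.
have p0 x : 0 <= p x by exact: normal_pdf_ge0.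
have cube (a : R) : 0 <= a -> a <= 1 + a ^+ 3.
  move=> a0; have := mulr_ge0 (addr_ge0 a0 ler01) (sqr_ge0 (a - 1)).
  rewrite (_ : (a + 1) * (a - 1) ^+ 2 = a ^+ 3 - a ^+ 2 - a + 1); last by ring.
  by have := sqr_ge0 a; lra.
pose q a := c0 + c1 * a + c2 * a ^+ 2.
have mq : measurable_fun setT q.
  apply: measurable_funD; last by apply: measurable_funM => //; exact: measurable_funX.
  by apply: measurable_funD => //; exact: measurable_funM.
have iD : leb1.-integrable setT (fun a => ((G a - q a) * p a)%:E).
  apply: (@integrable_mul_normal_pdf _ _ s0 (fun a => G a - q a) (E + N) (N + M)).
    exact: measurable_funB.
  move=> a; apply: le_trans (GB a) _.
  rewrite mulrDl -!addrA lerD2l addrA lerD2r.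
  by have := ler_wpM2l N0 (cube _ (normr_ge0 a)); lra.
have i0 : leb1.-integrable setT (fun a => (p a)%:E) by exact: integrable_normal_pdf.
have i1 : leb1.-integrable setT (fun a => (a * p a)%:E).
  apply: (@integrable_mul_normal_pdf _ _ s0 id 1 1) => // a.
  by rewrite mul1r; exact: cube.
have i2 : leb1.-integrable setT (fun a => (a ^+ 2 * p a)%:E).
  apply: (@integrable_mul_normal_pdf _ _ s0 (fun a => a ^+ 2) 1 1).
    exact: measurable_funX.
  move=> a; rewrite normrX; have := mulr_ge0 (addr_ge0 (normr_ge0 a) ler01) (sqr_ge0 (`|a| - 1)).
  rewrite (_ : (`|a| + 1) * (`|a| - 1) ^+ 2 = `|a| ^+ 3 - `|a| ^+ 2 - `|a| + 1); last by ring.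
  by have := normr_ge0 a; lra.
have j0 := integrable_EFinZ measurableT c0 i0.
have j1 := integrable_EFinZ measurableT c1 i1.
have j2 := integrable_EFinZ measurableT c2 i2.
have j01 := integrable_EFinD measurableT j0 j1.
have jq := integrable_EFinD measurableT j01 j2.
have qE a : (c0 * p a + c1 * (a * p a) + c2 * (a ^+ 2 * p a))%:E = (q a * p a)%:E.
  by congr EFin; rewrite /q; ring.
have iq : leb1.-integrable setT (fun a => (q a * p a)%:E).
  by rewrite -(funext qE).
have Eq : (\int[leb1]_a (q a * p a)%:E = (c0 + c2 * s ^+ 2)%:E)%E.
  under eq_integral do rewrite -qE.
  rewrite integral_EFinD// integral_EFinD// !integral_EFinZ//.
  have E2 : (\int[leb1]_a (a ^+ 2 * p a)%:E = (s ^+ 2)%:E)%E by exact: normal_moment2.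
  by rewrite normal_moment0 normal_moment1// E2 mule1 mule0 adde0.
have iG : leb1.-integrable setT (fun a => (G a * p a)%:E).
  have := integrable_EFinD measurableT iD iq.
  by apply: eq_integrable => // a _; congr EFin; rewrite /=; ring.
have iB : leb1.-integrable setT
    (fun a => (E * p a + N * (`|a| * p a) + M * (`|a| ^+ 3 * p a))%:E).
  have := @integrable_mul_normal_pdf _ _ s0
    (fun a => E + N * `|a| + M * `|a| ^+ 3) (E + N) (N + M).
  rewrite (_ : (fun x => _) = (fun x => (E * p x + N * (`|x| * p x) + M * (`|x| ^+ 3 * p x))%:E)).
    apply.
      apply: measurable_funD; last by apply: measurable_funM => //; apply: measurable_funX; exact: normr_measurable.
      by apply: measurable_funD => //; apply: measurable_funM => //; exact: normr_measurable.
    move=> a; rewrite ger0_norm ?addr_ge0 ?mulr_ge0//.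
    by have := ler_wpM2l N0 (cube _ (normr_ge0 a)); lra.
  by apply/funext => x; congr EFin; rewrite /p; ring.
have ED : \int[leb1]_a ((G a - q a) * p a) = \int[leb1]_a (G a * p a) - (c0 + c2 * s ^+ 2).
  rewrite /Rintegral; under [in LHS]eq_integral do rewrite mulrBl.
  by rewrite integral_EFinB// Eq fineB//; exact: integrable_fin_num.
suff : `|\int[leb1]_a ((G a - q a) * p a)| <= E + N * s + 48 * M * s ^+ 3 by rewrite ED.
apply: le_trans (le_normr_Rintegral _ iD) _ => //.
have iN (k : nat) : (0 < k < 4)%N -> leb1.-integrable setT (fun a => (`|a| ^+ k * p a)%:E).
  move=> k4; apply: (@integrable_mul_normal_pdf _ _ s0 (fun a => `|a| ^+ k) 1 1).
    by apply: measurable_funX; exact: normr_measurable.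
  move=> a; rewrite normrX normr_id.
  have := mulr_ge0 (addr_ge0 (normr_ge0 a) ler01) (sqr_ge0 (`|a| - 1)).
  rewrite (_ : (`|a| + 1) * (`|a| - 1) ^+ 2 = `|a| ^+ 3 - `|a| ^+ 2 - `|a| + 1); last by ring.
  have := sqr_ge0 `|a|; have := normr_ge0 a.
  by case: k k4 => [//|[|[|[|//]]]] _; rewrite ?expr1; lra.
have n1 : leb1.-integrable setT (fun a => (`|a| * p a)%:E) by exact: (iN 1).
have n3 := iN 3 isT.
rewrite -lee_fin fineK; last exact/integrable_fin_num/integrable_norm.
apply: (@le_trans _ _ (\int[leb1]_a
    (E * p a + N * (`|a| * p a) + M * (`|a| ^+ 3 * p a))%:E)%E).
  apply: le_integral => //; first exact: integrable_norm.
  move=> a _; rewrite lee_fin normrM (ger0_norm (p0 a)).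
  have -> : E * p a + N * (`|a| * p a) + M * (`|a| ^+ 3 * p a) =
    (E + N * `|a| + M * `|a| ^+ 3) * p a by ring.
  by apply: ler_wpM2r => //; exact: GB.
have k0 := integrable_EFinZ measurableT E i0.
have k1 := integrable_EFinZ measurableT N n1.
have k3 := integrable_EFinZ measurableT M n3.
have k01 := integrable_EFinD measurableT k0 k1.
rewrite integral_EFinD// integral_EFinD// !integral_EFinZ//.
rewrite normal_moment0// mule1 !EFinD leeD//; first rewrite leeD2lE//.
  by rewrite EFinM lee_wpmul2l ?lee_fin// normal_abs_moment1.
rewrite (_ : 48 * M * s ^+ 3 = M * (48 * s ^+ 3)); last by ring.
by rewrite EFinM lee_wpmul2l ?lee_fin// normal_abs_moment3.
Qed.

End normal_expansion.

(** * Gaussian averages in dimension d and the heat expansion *)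

Section integral_rV.
Context (R : realType).
Notation leb := (@lebesgue_measure_rV R).
Local Open Scope ereal_scope.

Lemma ge0_integral_rVS d (f : 'rV[R]_d.+1 -> R) : measurable_fun setT f ->
  (forall x, 0 <= f x)%R ->
  \int[leb d.+1]_x (f x)%:E =
  \int[lebesgue_measure]_a \int[leb d]_y (f (cons_rV (a, y)))%:E.
Proof.
move=> mf f0.
transitivity (\int[pushforward_measure (lebesgue_measure \x leb d) (@measurable_cons_rV R d)]_x (f x)%:E).
  exact: eq_measure_integral.
rewrite ge0_integral_pushforward//; last 2 first.
- exact/measurable_EFinP.
- by move=> x _; rewrite lee_fin.
rewrite preimage_setT (@fubini_tonelli1 _ _ _ _ _ _ _ _)//.
- apply/measurable_EFinP; exact: measurableT_comp.
- by move=> z; rewrite /= lee_fin.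
Qed.

Lemma integral_rVS d (f : 'rV[R]_d.+1 -> R) :
  (leb d.+1).-integrable setT (EFin \o f) ->
  measurable_fun setT (fun a => \int[leb d]_y (f (cons_rV (a, y)))%:E) /\
  \int[leb d.+1]_x (f x)%:E =
  \int[lebesgue_measure]_a \int[leb d]_y (f (cons_rV (a, y)))%:E.
Proof.
move=> fi.
have mf : measurable_fun setT f by apply/measurable_EFinP; exact: measurable_int fi.
have fi' : (lebesgue_measure \x leb d).-integrable setT ((EFin \o f) \o @cons_rV R d).
  apply/integrableP; split.
    by apply/measurable_EFinP; exact: measurableT_comp.
  case/integrableP : fi => _; apply: le_lt_trans.
  rewrite (@ge0_integral_rVS d (fun x => `|f x|%R))//; last exact: measurableT_comp.
  rewrite (@fubini_tonelli1 _ _ _ _ _ _ _ _)//.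
  by apply/measurable_EFinP; apply: measurableT_comp => //; exact: measurableT_comp.
split; first exact: (measurable_fubini_F fi').
transitivity (\int[pushforward_measure (lebesgue_measure \x leb d) (@measurable_cons_rV R d)]_x (f x)%:E).
  exact: eq_measure_integral.
rewrite integral_pushforward//; last exact/measurable_EFinP.
by rewrite preimage_setT -(integral12_prod_meas1 fi').
Qed.

End integral_rV.

Section gaussian.
Context (R : realType).
Notation leb := (@lebesgue_measure_rV R).
Variable h : R.
Hypothesis h0 : 0 < h.
Let s := Num.sqrt h.
Let s0 : 0 < s. Proof. by rewrite sqrtr_gt0. Qed.

Lemma gaussian_densityS d (z : measurableTypeR R * 'rV[R]_d) :
  gaussian_density h (cons_rV z) = normal_pdf 0 s z.1 * gaussian_density h z.2.
Proof.
rewrite /gaussian_density big_ord_recl cons_rV0; congr (_ * _).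
by apply: eq_bigr => i _; rewrite cons_rV_lift.
Qed.

Lemma gaussian_density_ge0 d (x : 'rV[R]_d) : 0 <= gaussian_density h x.
Proof. by apply: prodr_ge0 => i _; exact: normal_pdf_ge0. Qed.

Lemma measurable_gaussian_density d : measurable_fun setT (@gaussian_density R d h).
Proof.
apply: measurable_prod => i _; apply: measurableT_comp (@measurable_coord R d i).
exact: measurable_normal_pdf.
Qed.

Lemma integral_gaussian_density d :
  (\int[leb d]_x (gaussian_density h x)%:E = 1)%E.
Proof.
elim: d => [|d IH].
  rewrite /= integral_dirac//; last first.
    by apply/measurable_EFinP; exact: measurable_gaussian_density.
  by rewrite diracT mul1e /gaussian_density big_ord0.
rewrite ge0_integral_rVS; [|exact: measurable_gaussian_density|exact: gaussian_density_ge0].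
rewrite -(integral_normal_pdf 0 s); apply: eq_integral => a _.
under eq_integral do rewrite gaussian_densityS/= EFinM.
rewrite ge0_integralZl//.
- by rewrite IH mule1.
- by apply/measurable_EFinP; exact: measurable_gaussian_density.
- by move=> y _; rewrite lee_fin gaussian_density_ge0.
- by rewrite lee_fin normal_pdf_ge0.
Qed.

Lemma integrable_gaussian d (F : 'rV[R]_d -> R) (B : R) : measurable_fun setT F ->
  (forall x, `|F x| <= B) ->
  (leb d).-integrable setT (fun x => (F x * gaussian_density h x)%:E).
Proof.
move=> mF FB.
have ig : (leb d).-integrable setT (fun x => (gaussian_density h x)%:E).
  apply/integrableP; split; first by apply/measurable_EFinP; exact: measurable_gaussian_density.
  under eq_integral do rewrite /= ger0_norm ?gaussian_density_ge0//.
  by rewrite integral_gaussian_density ltry.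
apply: le_integrable (integrable_EFinZ measurableT B ig) => //.
  apply/measurable_EFinP; apply: measurable_funM => //.
  exact: measurable_gaussian_density.
move=> x _; rewrite /= lee_fin !normrM ler_wpM2r//.
by rewrite (le_trans (FB x))// ler_norm.
Qed.

Lemma gaussian_Rintegral_le d (F : 'rV[R]_d -> R) (B : R) : measurable_fun setT F ->
  (forall x, `|F x| <= B) -> `|\int[leb d]_x (F x * gaussian_density h x)| <= B.
Proof.
move=> mF FB; have iF := integrable_gaussian mF FB.
apply: le_trans (le_normr_Rintegral _ iF) _ => //.
have B0 : 0 <= B by exact: le_trans (FB 0).
rewrite -lee_fin fineK; last exact/integrable_fin_num/integrable_norm.
apply: (@le_trans _ _ (\int[leb d]_x (B * gaussian_density h x)%:E)%E).
  apply: le_integral => //; first exact: integrable_norm.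
    apply: (@integrable_gaussian d (cst B) B) => // x.
    by rewrite ger0_norm.
  move=> x _; rewrite lee_fin normrM (ger0_norm (gaussian_density_ge0 _)).
  by rewrite ler_wpM2r// gaussian_density_ge0.
under eq_integral do rewrite EFinM.
rewrite ge0_integralZl//; first by rewrite integral_gaussian_density mule1.
- by apply/measurable_EFinP; exact: measurable_gaussian_density.
- by move=> y _; rewrite lee_fin gaussian_density_ge0.
Qed.

Lemma gaussian_RintegralS d (F : 'rV[R]_d.+1 -> R) (B : R) : measurable_fun setT F ->
  (forall x, `|F x| <= B) ->
  let G a := \int[leb d]_y (F (cons_rV (a, y)) * gaussian_density h y) in
  measurable_fun setT G /\
  \int[leb d.+1]_x (F x * gaussian_density h x) =
  \int[lebesgue_measure]_a (G a * normal_pdf 0 s a).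
Proof.
move=> mF FB G; have iF := integrable_gaussian mF FB.
have iFa a : (leb d).-integrable setT
    (fun y => (F (cons_rV (a, y)) * gaussian_density h y)%:E).
  apply: (@integrable_gaussian _ _ B) => //.
  exact: (measurableT_comp mF (measurableT_comp (@measurable_cons_rV R d)
    (pair1_measurable (a : measurableTypeR R)))).
have GE a : (\int[leb d]_y (F (cons_rV (a, y)) * gaussian_density h (cons_rV (a, y)))%:E =
    (G a * normal_pdf 0 s a)%:E)%E.
  under eq_integral do rewrite gaussian_densityS/= mulrCA.
  rewrite integral_EFinZ//; last exact: iFa.
  rewrite [in RHS](mulrC (G a)) EFinM; congr (_ * _)%E.
  by rewrite /G /Rintegral fineK//; exact: integrable_fin_num.
have [mG EG] := integral_rVS iF; split; last first.
  by rewrite /Rintegral EG; congr fine; apply: eq_integral => a _; rewrite GE.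
(* Fubini gives measurability of [G] times the normal density. Dividing by that positive continuous
   density recovers [G]. *)
have p0 a : normal_pdf 0 s a != 0.
  by rewrite normal_pdfE ?gt_eqF// mulr_gt0 ?expR_gt0// normal_peak_gt0 ?gt_eqF.
rewrite (_ : G = fun a => fine ((\int[leb d]_y (F (cons_rV (a, y)) *
    gaussian_density h (cons_rV (a, y)))%:E)%E) / normal_pdf 0 s a).
  apply: measurable_funM; first exact: measurableT_comp mG.
  apply: (@continuous_measurable_fun R) => a; apply: cvgV => //.
  by apply: continuous_normal_pdf; rewrite gt_eqF.
by apply/funext => a; rewrite GE/= mulfK.
Qed.

Lemma measurable_comb d n (e : 'I_d -> 'rV[R]_n) (x : 'rV[R]_n) :
  measurable_fun setT (fun y : 'rV[R]_d => x + \sum_i y ord0 i *: e i).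
Proof.
apply: measurable_fun_rV => j.
rewrite (_ : (fun _ => _) = (fun y : 'rV[R]_d => x ord0 j +
    \sum_(i < d) y ord0 i * e i ord0 j)).
  apply: measurable_funD => //; apply: measurable_sum => i.
  by apply: measurable_funM => //; exact: measurable_coord.
apply/funext => y; rewrite mxE summxE; congr (_ + _).
by apply: eq_bigr => i _; rewrite mxE.
Qed.

(** The recursion adds the cost of one more coordinate: 48 from its third moment, and [d'] as a
    crude bound for the d'/2 caused by the change of the other [d'] second derivatives along it. *)
Fixpoint heat_constant (d : nat) : R :=
  if d is d'.+1 then heat_constant d' + d'%:R + 48 else 0.

Lemma heat_constant_ge0 d : 0 <= heat_constant d.
Proof. by elim: d => //= d IH; rewrite !addr_ge0. Qed.

(* Tonelli reduces the claim to one Gaussian coordinate at a time; in each of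
   them the second order Taylor polynomial is integrated exactly. *)
Lemma heat_expansion n d (e : 'I_d -> 'rV[R]_n) (psi : 'rV[R]_n -> R)
    (g1 g2 : 'I_d -> 'rV[R]_n -> R) (B M : R) :
  0 <= M -> measurable_fun setT psi -> (forall x, `|psi x| <= B) ->
  (forall i x (a : R), is_derive a (1 : R) (fun b => psi (x + b *: e i)) (g1 i (x + a *: e i))) ->
  (forall i x (a : R), is_derive a (1 : R) (fun b => g1 i (x + b *: e i)) (g2 i (x + a *: e i))) ->
  (forall i j x a, `|g2 i (x + a *: e j) - g2 i x| <= M * `|a|) ->
  forall x,
  `|\int[leb d]_y (psi (x + \sum_i y ord0 i *: e i) * gaussian_density h y) -
    (psi x + h / 2 * \sum_i g2 i x)| <= heat_constant d * M * s ^+ 3.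
Proof.
move=> M0 mpsi psiB.
have s2 : s ^+ 2 = h by rewrite sqr_sqrtr// ltW.
elim: d e g1 g2 => [|d IH] e g1 g2 dpsi dg1 g2M x.
  rewrite /= mul0r mul0r /Rintegral integral_dirac//; last first.
    apply/measurable_EFinP; apply: measurable_funM.
      exact: measurableT_comp (measurable_comb _ _).
    exact: measurable_gaussian_density.
  rewrite diracT mul1e/= /gaussian_density !big_ord0 mulr0 !addr0 mulr1 subrr.
  by rewrite normr0.
have [mG ->] := @gaussian_RintegralS d
  (fun y => psi (x + \sum_i y ord0 i *: e i)) B
  (measurableT_comp mpsi (measurable_comb e x)) (fun y => psiB _).
set G := (fun a => _) in mG *.
have GE a : G a = \int[leb d]_y (psi (x + a *: e ord0 +
    \sum_i y ord0 i *: e (lift ord0 i)) * gaussian_density h y).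
  apply: eq_Rintegral => y _; congr (psi _ * _).
  rewrite big_ord_recl cons_rV0/= addrA; congr (_ + _).
  by apply: eq_bigr => i _; rewrite cons_rV_lift.
have IHa a := IH (e \o lift ord0) (g1 \o lift ord0) (g2 \o lift ord0)
  (fun i => dpsi (lift ord0 i)) (fun i => dg1 (lift ord0 i))
  (fun i j => g2M (lift ord0 i) (lift ord0 j)) (x + a *: e ord0).
pose c0 := psi x + h / 2 * \sum_i g2 (lift ord0 i) x.
have := @normal_expansion R s G c0 (g1 ord0 x) (g2 ord0 x / 2)
  (heat_constant d * M * s ^+ 3) (h / 2 * (d%:R * M)) M s0.
rewrite [X in `|_ - X|](_ : _ = psi x + h / 2 * \sum_i g2 i x); last first.
  by rewrite /c0 s2 big_ord_recl mulrDr -addrA; congr (_ + _); rewrite addrC; congr (_ + _); ring.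
move=> H; apply: le_trans (H _ _ _ _ _) _ => //.
- exact: mulr_ge0 (mulr_ge0 (heat_constant_ge0 _) M0) (exprn_ge0 _ (ltW s0)).
- by rewrite mulr_ge0 ?divr_ge0 ?mulr_ge0// ltW.
- move=> a.
  have T := @taylor2_bound R (fun b => psi (x + b *: e ord0))
     (fun b => g1 ord0 (x + b *: e ord0)) (fun b => g2 ord0 (x + b *: e ord0)) M a
     (dpsi ord0 x) (dg1 ord0 x).
  rewrite !scale0r !addr0 in T; have {}T := T (g2M ord0 ord0 x).
  have S : `|\sum_i g2 (lift ord0 i) (x + a *: e ord0) - \sum_i g2 (lift ord0 i) x|
      <= d%:R * M * `|a|.
    rewrite -sumrB (le_trans (ler_norm_sum _ _ _))//.
    rewrite (le_trans (ler_sum _ (fun i _ => g2M (lift ord0 i) ord0 x a)))//.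
    by rewrite sumr_const card_ord -mulrA mulr_natl.
  have {}IHa := IHa a; rewrite -GE /= in IHa.
  rewrite (_ : G a - _ = (G a - (psi (x + a *: e ord0) +
      h / 2 * \sum_i g2 (lift ord0 i) (x + a *: e ord0))) +
    h / 2 * (\sum_i g2 (lift ord0 i) (x + a *: e ord0) - \sum_i g2 (lift ord0 i) x) +
    (psi (x + a *: e ord0) - (psi x + g1 ord0 x * a + g2 ord0 x / 2 * a ^+ 2))); last first.
    by rewrite /c0; ring.
  apply: le_trans (ler_normD _ _) (lerD _ T).
  apply: le_trans (ler_normD _ _) (lerD IHa _).
  have h2 : 0 <= h / 2 by rewrite divr_ge0// ltW.
  by rewrite normrM (ger0_norm h2) -[leRHS]mulrA; apply: ler_wpM2l.
- rewrite /= -{1}s2.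
  have s3 : 0 <= s ^+ 3 by rewrite exprn_ge0// ltW.
  have dM : 0 <= d%:R * M * s ^+ 3 by rewrite mulr_ge0// mulr_ge0.
  rewrite (_ : (_ + d%:R + 48) * M * s ^+ 3 = heat_constant d * M * s ^+ 3 +
    s ^+ 2 / 2 * (d%:R * M) * s + 48 * M * s ^+ 3 + d%:R * M * s ^+ 3 / 2); last by field.
  by rewrite lerDl divr_ge0.
Qed.

End gaussian.

(** * Hitting times of a moving closed set along continuous paths *)

Lemma within_continuous_ball (R : realType) (U V : pseudoMetricType R)
    (A : set U) (f : U -> V) (x : U) (e : R) : 0 < e ->
  {within A, continuous f} -> A x -> \forall y \near x, A y -> ball (f x) e (f y).
Proof.
move=> e0 /subspace_continuousP/[apply] /(_ _ (nbhsx_ballx (f x) e e0)).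
exact.
Qed.

Lemma ratr_unit_itv (R : realType) (s : R) (q : rat) : 0 <= s -> 0 <= q <= 1 ->
  s * ratr q \in `[0, s].
Proof.
move=> s0 /andP[q0 q1]; rewrite in_itv/= mulr_ge0 ?ler0q//= ler_piMr//.
by rewrite -(rmorph1 (@ratr R)) ler_rat.
Qed.

Lemma countable_bigcap_measurable dO (O : measurableType dO) (I : countType)
    (P : set I) (F : I -> set O) : (forall i, P i -> measurable (F i)) ->
  measurable (\bigcap_(i in P) F i).
Proof.
move=> mF; rewrite -[X in measurable X]setCK setC_bigcap bigcup_mkcond.
apply: measurableC; apply: countable_bigcupT_measurable => [|i].
  exact/countableP.
by case: ifPn => // /[!inE] Pi; exact/measurableC/mF.
Qed.

Section hitting.
Context (R : realType) (d : nat) (T : R).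
Local Notation V := 'rV[R]_d.
Variable G : R -> set V.
Hypothesis cG : closed_family T G.
Hypothesis ndG : nondecreasing_family T G.
Hypothesis rcG : right_continuous_family T G.

(** A pathwise form of the event that the hitting time exceeds [s], free of infima;
    [lt_hitting_time] links the two. *)
Definition alive (f : R -> V) (s : R) : Prop :=
  forall r, r \in `[0, s] -> ~ G r (f r).

Lemma aliveS (f : R -> V) (s t : R) : s <= t -> alive f t -> alive f s.
Proof.
move=> st ft r; rewrite in_itv/= => /andP[r0 rs]; apply: ft.
by rewrite in_itv/= r0 (le_trans rs).
Qed.

(** This says that the space-time graph of [G] is closed. By right continuity [x] already lies
    outside some [G q] with q > r (q = T if r = T). A ball around [x] avoids the closed set [G q],
    hence by monotonicity all sets up to time q. *)
Lemma graph_separation (r : R) (x : V) : r \in `[0, T] -> ~ G r x ->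
  exists2 e : R, 0 < e & forall r' x', r' \in `[0, T] -> `|r - r'| < e ->
    ball x e x' -> ~ G r' x'.
Proof.
move=> rT Gx; have := rT; rewrite in_itv/= => /andP[r0].
have avoid (q : R) : q \in `[0, T] -> ~ G q x -> exists2 e : R, 0 < e & ball x e `<=` ~` G q.
  move=> qT Gq; have /nbhs_ballP[e /= e0 H] : nbhs x (~` G q).
    by apply: open_nbhs_nbhs; split => //; exact/closed_openC/cG.
  by exists e.
rewrite le_eqVlt => /predU1P[rE|rltT].
  subst r; have [e e0 H] := avoid _ rT Gx; exists e => // r' x' r'T _ xx'.
  move=> G'; apply: (H _ xx'); apply: ndG G' => //.
  by move: r'T; rewrite in_itv/= => /andP[].
have [q [/andP[rq qT] Gq]] : exists q, r < q <= T /\ ~ G q x.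
  apply: contrapT => H; apply: Gx; rewrite rcG; last by rewrite in_itv/= r0.
  move=> q /=; rewrite in_itv/= => rqT; apply: contrapT => Gq; apply: H; by exists q.
have qT' : q \in `[0, T] by rewrite in_itv/= qT andbT (le_trans r0)// ltW.
have [e e0 H] := avoid _ qT' Gq; exists (Num.min e (q - r)).
  by rewrite lt_min e0 subr_gt0.
move=> r' x' r'T; rewrite lt_min => /andP[_ rr'] xx' G'.
apply: (H x'); first by apply: le_ball xx'; rewrite ge_min lexx.
apply: ndG G' => //; rewrite ltW// -(subrK r q) -ltrBlDr.
by rewrite (le_lt_trans (ler_norm _))// distrC.
Qed.

(** A quantified separation: the space-time neighbourhood of size 1/(n+1) misses the graph of [G].
    Having a fixed size, the condition passes from a dense set of times to all times, and for fixed
    [n] and [r] it is closed in the point. *)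
Definition avoided (n : nat) (r : R) : set V :=
  [set x | forall r' x', r' \in `[0, T] -> `|r - r'| < n.+1%:R^-1 ->
    ball x n.+1%:R^-1 x' -> ~ G r' x'].

Lemma closed_avoided n r : closed (avoided n r).
Proof.
rewrite (_ : avoided n r = ~` \bigcup_(p in [set p : R * V | [/\ p.1 \in `[0, T],
    `|r - p.1| < n.+1%:R^-1 & G p.1 p.2]]) ball p.2 n.+1%:R^-1).
  by apply: open_closedC; apply: bigcup_open => p _; exact: ball_open.
apply/seteqP; split => x /=.
  move=> H [[r' x'] /= [r'T rr' G'] b]; apply: (H r' x') => //.
  exact: ball_sym.
move=> H r' x' r'T rr' b G'; apply: H; exists (r', x') => //=.
exact: ball_sym.
Qed.

(** Compactness of [0, s] turns pointwise separation into a uniform [n]; conversely, a hit at [r]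
    would fall in the neighbourhood of a nearby test time. Rational multiples of [s] are dense in
    [0, s] and never exceed [s], so the resulting event depends only on the path up to time [s]. *)
Lemma alive_avoided (f : R -> V) (s : R) : s \in `[0, T] ->
  {within `[0, T], continuous f} ->
  alive f s <-> exists n, forall q : rat, 0 <= q <= 1 ->
    avoided n (s * ratr q) (f (s * ratr q)).
Proof.
rewrite in_itv/= => /andP[s0 sT] cf; split.
  move=> fs; have : near_covering `[0, s]%classic.
    by apply/compact_near_coveringP; exact: segment_compact.
  move=> /near_covering_withinP/(_ nat \oo (fun n r => avoided n r (f r)) _).
  case.
    move=> r /= rs; have rT : r \in `[0, T].
      by move: rs; rewrite !in_itv/= => /andP[-> /le_trans->].
    have [e e0 H] := graph_separation rT (fs r rs).
    have e2 : 0 < e / 2 by rewrite divr_gt0.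
    have : \forall r' \near r, r' \in `[0, T] -> ball (f r) (e / 2) (f r').
      exact: within_continuous_ball.
    move=> N1.
    have N2 : \forall r' \near r, `|r - r'| < e / 2.
      by apply/nbhs_ballP; exists (e / 2).
    exists ([set r' | (r' \in `[0, T] -> ball (f r) (e / 2) (f r')) /\ `|r - r'| < e / 2],
        [set n | n.+1%:R^-1 < e / 2]) => /=.
      split; first exact: filterI.
      exact: near_infty_natSinv_lt (PosNum e2).
    move=> [r' n] /= [[b1 b2] ne] r's t x tT r't bx; apply: (H t x) => //.
      rewrite [e]splitr (le_lt_trans (ler_distD r' _ _))// ltrD//.
      exact: lt_trans ne.
    rewrite [e]splitr; apply: (@ball_triangle _ _ (f r')).
      apply: b1; move: r's; rewrite !in_itv/= => /andP[-> /le_trans->]//.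
    by apply: le_ball bx; exact: ltW.
  move=> n _ /(_ n (leqnn n)) H; exists n => q q01; apply: H => /=.
  exact: ratr_unit_itv.
move=> [n H] r rs; have rT : r \in `[0, T].
  by move: rs; rewrite !in_itv/= => /andP[-> /le_trans->].
move: rs; rewrite in_itv/= => /andP[r0 rs].
have n0 : 0 < n.+1%:R^-1 :> R by rewrite invr_gt0.
have : \forall r' \near r, r' \in `[0, T] -> ball (f r) n.+1%:R^-1 (f r').
  exact: within_continuous_ball.
move=> /nbhs_ballP[e /= e0 He].
pose e' := Num.min e n.+1%:R^-1.
have e'0 : 0 < e' by rewrite lt_min e0.
(* The rational is sought strictly below r/s, which keeps it at most 1; the cases s = 0 and r = 0
   are served by q = 0. *)
have [q q01 qr] : exists2 q : rat, 0 <= q <= 1 & `|s * ratr q - r| < e'.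
  have [sE|sn0] := eqVneq s 0.
    exists 0; first by rewrite lexx ler01.
    have rE : r = 0 by apply/eqP; rewrite eq_le r0 -{1}sE rs.
    by rewrite sE rE mul0r subrr normr0.
  have sp : 0 < s by rewrite lt_def sn0.
  have [r0'|rn0] := eqVneq r 0.
    by exists 0; rewrite ?lexx ?ler01// rmorph0 mulr0 r0' subrr normr0.
  have rp : 0 < r by rewrite lt_def rn0.
  have [q] : exists q : rat, ratr q \in `](Num.max 0 ((r - e') / s)), (r / s)[.
    apply: rat_in_itvoo; rewrite gt_max divr_gt0//= ltr_pM2r ?invr_gt0//.
    by rewrite ltrBlDr ltrDl.
  rewrite in_itv/= gt_max => /andP[/andP[q0 q1] q2]; exists q.
    apply/andP; split; first by rewrite -(ler0q R) ltW.
    rewrite -(ler_rat R) (rmorph1 (@ratr R)) ltW// (lt_le_trans q2)//.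
    by rewrite ler_pdivrMr// mul1r.
  move: q1 q2; rewrite ltr_pdivrMr// ltr_pdivlMr// !(mulrC (ratr q)) => q1 q2.
  by rewrite ltr0_norm ?subr_lt0// opprB ltrBlDr -ltrBlDl.
have sq : s * ratr q \in `[0, T].
  have := ratr_unit_itv s0 q01.
  by rewrite !in_itv/= => /andP[-> /le_trans->].
move: qr; rewrite lt_min => /andP[qe qn].
apply: (H q q01 r (f r) rT qn); apply: ball_sym; apply: He => //.
by rewrite /ball/= distrC.
Qed.

Lemma measurable_alive dO (O : measurableType dO) (W : R -> O -> V) (s : R) :
  s \in `[0, T] -> (forall o, {within `[0, T], continuous (W ^~ o)}) ->
  (forall r, r \in `[0, s] -> measurable_fun setT (W r)) ->
  measurable [set o | alive (W ^~ o) s].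
Proof.
move=> sT cW mW.
rewrite (_ : [set o | _] = \bigcup_n \bigcap_(q in [set q : rat | 0 <= q <= 1])
    (W (s * ratr q) @^-1` avoided n (s * ratr q))).
  apply: bigcupT_measurable => n; apply: countable_bigcap_measurable => q /= q01.
  rewrite -[X in measurable X]setTI; apply: mW => //.
    by apply: ratr_unit_itv => //; move: sT; rewrite in_itv/= => /andP[].
  by apply: closed_measurable_rV; exact: closed_avoided.
apply/seteqP; split => o /=.
  by move=> /(alive_avoided sT (cW o))[n H]; exists n => // q; exact: H.
move=> [n _ H]; apply/(alive_avoided sT (cW o)); exists n => q; exact: H.
Qed.

(** For a path alive at [s], separation at (s, f s) and continuity leave a margin [m] without hits
    after [s]. The infimum is therefore at least s + m, and the inequality is strict. *)
Lemma lt_hitting_time (f : R -> V) (s : R) : s \in `[0, T] ->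
  {within `[0, T], continuous f} ->
  (s%:E < hitting_time T G f)%E <-> alive f s.
Proof.
move=> sT cf; split.
  move=> H r rs Gr; move: H; apply/negP; rewrite -leNgt.
  apply: (@le_trans _ _ r%:E); last by move: rs; rewrite lee_fin in_itv/= => /andP[].
  apply: ereal_inf_lbound; exists r => //=; split => //.
  by move: rs sT; rewrite !in_itv/= => /andP[-> rs] /andP[_]; exact: le_trans.
move=> fs; have Gs : ~ G s (f s).
  by apply: fs; move: sT; rewrite !in_itv/= lexx => /andP[->].
have [e e0 H] := graph_separation sT Gs.
have : \forall r \near s, r \in `[0, T] -> ball (f s) e (f r).
  exact: within_continuous_ball.
move=> /nbhs_ballP[e1 /= e10 He1].
pose m := Num.min e e1.
have m0 : 0 < m by rewrite lt_min e0.
apply: (@lt_le_trans _ _ (s + m)%:E); first by rewrite lte_fin ltrDl.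
apply: le_ereal_inf_tmp => _ [r /= [rT Gr] <-]; rewrite lee_fin leNgt; apply/negP => rsm.
have [rs|sr] := leP r s.
  by apply: (fs r) => //; move: rT; rewrite !in_itv/= rs => /andP[->].
have srm : `|s - r| < m by rewrite distrC gtr0_norm ?subr_gt0// ltrBlDl.
move: srm; rewrite lt_min => /andP[d1 d2].
by apply: (H r (f r)) => //; exact: He1.
Qed.

(** The infimum is attained: the path is not alive at tau, so it hits at some r <= tau, and r = tau
    by minimality. *)
Lemma hitting_time_le (f : R -> V) (t : R) : t \in `[0, T] ->
  {within `[0, T], continuous f} -> (hitting_time T G f <= t%:E)%E ->
  exists tau, [/\ tau \in `[0, t], hitting_time T G f = tau%:E, G tau (f tau) &
    forall s, s < tau -> alive f s].
Proof.
move=> tT cf ht.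
have : (0%:E <= hitting_time T G f)%E.
  by apply: le_ereal_inf_tmp => _ [r /= [rT Gr] <-]; move: rT; rewrite in_itv/= lee_fin => /andP[].
case E : (hitting_time T G f) ht => [tau| |]//; rewrite !lee_fin => taut tau0.
have tauT : tau \in `[0, T].
  by move: tT; rewrite !in_itv/= tau0/= => /andP[_]; exact: le_trans.
exists tau; rewrite in_itv/= tau0 taut.
have na : ~ alive f tau by move=> /(lt_hitting_time tauT cf); rewrite E ltxx.
split => //.
- have [r [rt Gr]] : exists r, r \in `[0, tau] /\ G r (f r).
    by apply: contrapT => H; apply: na => r rt Gr; apply: H; exists r.
  suff -> : tau = r by [].
  move: (rt); rewrite in_itv/= => /andP[r0 rtau].
  apply/eqP; rewrite eq_le rtau andbT -lee_fin -E.
  apply: ereal_inf_lbound; exists r => //=; split => //.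
  by move: tauT; rewrite !in_itv/= r0 => /andP[_]; exact: le_trans.
- move=> s st; have [s0|s0] := ltP s 0.
    by move=> r; rewrite in_itv/= => /andP[r0 rs]; have := le_lt_trans (le_trans r0 rs) s0; rewrite ltxx.
  have sT : s \in `[0, T].
    by move: tauT; rewrite !in_itv/= s0 => /andP[_]; apply: le_trans; exact: ltW.
  by apply/(lt_hitting_time sT cf); rewrite E lte_fin.
Qed.

End hitting.

(** * Independence of Brownian increments from the past *)

Section increments.
Context (R : realType) (d : nat) (dO : measure_display) (O : measurableType dO).
Local Notation V := 'rV[R]_d.
Variables (P : probability O R) (xi : O -> V) (B : R -> O -> V).
Hypothesis mxi : measurable_fun setT xi.
Hypothesis BM : standard_brownian_motion P B.
Hypothesis xiB : independent_systems P (preimage_set_system setT xi measurable)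
  (sigma_generated `[0, +oo[ B).

(** Rectangles that form a pi-system generating the sigma-algebra of [xi] and of [B] up to time [s].
    Independence is checked on them and extended by uniqueness of measures. *)
Definition start_history (s : R) : set_system O :=
  [set E | exists A F, [/\ measurable A, sigma_generated `[0, s] B F &
    E = xi @^-1` A `&` F]].

Let sub_sigma_generated (I : set R) : I `<=` `[0, +oo[ ->
  sigma_generated I B `<=` measurable.
Proof.
move=> I0; apply: smallest_sub; first exact: sigma_algebra_measurable.
move=> _ [r [A [Ir mA ->]]]; rewrite -[X in measurable X]setTI.
apply: (bm_measurable BM) => //.
by have := I0 _ Ir; rewrite /= in_itv/= andbT.
Qed.

Let itv0 (s : R) : `[0, s]%classic `<=` `[(0 : R), +oo[%classic.
Proof. by move=> r /=; rewrite !in_itv/= andbT => /andP[]. Qed.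

Let generators (I : set R) : set_system O :=
  [set F | exists r A, [/\ I r, measurable A & F = B r @^-1` A]].

Let sub_itv (I J : set R) : I `<=` J -> sigma_generated I B `<=` sigma_generated J B.
Proof.
move=> IJ; apply: smallest_sub; first exact: smallest_sigma_algebra.
move=> _ [r [A [rI mA ->]]]; apply: sub_sigma_algebra.
by exists r, A; split => //; exact: IJ.
Qed.

Let measurable_increment (s t : R) : 0 <= s -> 0 <= t ->
  @measurable_fun _ _ (g_sigma_algebraType (generators `[0, +oo[)) _ setT
    (fun o => B t o - B s o).
Proof.
have mB r : 0 <= r ->
    @measurable_fun _ _ (g_sigma_algebraType (generators `[0, +oo[)) _ setT (B r).
  move=> r0 _ A mA; rewrite setTI; apply: sub_sigma_algebra; exists r, A.
  by rewrite /= in_itv/= r0.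
by move=> s0 t0; apply: measurable_rVB; exact: mB.
Qed.

Lemma start_history_sub (s : R) : start_history s `<=` measurable.
Proof.
move=> _ [A [F [mA sF ->]]]; apply: measurableI.
  by rewrite -[X in measurable X]setTI; exact: mxi.
exact: sub_sigma_generated sF.
Qed.

Lemma start_historyI (s : R) : setI_closed (start_history s).
Proof.
move=> _ _ [A [F [mA sF ->]]] [A' [F' [mA' sF' ->]]].
exists (A `&` A'), (F `&` F'); split; first exact: measurableI.
  exact: (@measurableI _ (g_sigma_algebraType (generators `[0, s]%classic))).
by rewrite preimage_setI setIACA.
Qed.

(** As functions of [E], both sides are finite measures. On rectangles they agree by independence of
    [xi] from [B], followed by independence of the increment from the past of [B]. *)
Lemma start_history_independent (s t : R) (E : set O) (C : set V) :
  0 <= s -> s < t -> <<s start_history s >> E -> measurable C ->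
  P (E `&` (fun o => B t o - B s o) @^-1` C) =
  (P E * P ((fun o => B t o - B s o)%R @^-1` C))%E.
Proof.
move=> s0 st sE mC; set D := _ @^-1` C.
have t0 : 0 <= t by rewrite (le_trans s0)// ltW.
have mD : measurable D.
  rewrite -[X in measurable X]setTI; apply: measurable_rVB => //.
    exact: (bm_measurable BM).
  exact: (bm_measurable BM).
have PD0 : 0 <= fine (P D) by rewrite fine_ge0.
have -> : P (E `&` D) = mrestr P mD E by [].
rewrite muleC -[in RHS](fineK (fin_num_measure P D mD)).
change (mrestr P mD E = mscale (NngNum PD0) P E).
have sT r : sigma_generated `[0, r] B setT.
  exact: (@measurableT _ (g_sigma_algebraType (generators `[0, r]%classic))).
have PP : P setT = 1%E by exact: probability_setT.
apply: (@g_sigma_algebra_measure_unique _ R O (start_history s)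
  (@start_history_sub s) (fun=> setT)) => //.
- by move=> _; exists setT, setT; split => //; rewrite preimage_setT setTI.
- by rewrite bigcup_const//; exists 0%N.
- exact: start_historyI.
- move=> _ [A [F [mA sF ->]]].
  have sD : sigma_generated `[0, +oo[ B D.
    have := @measurable_increment s t s0 t0 measurableT C mC.
    by rewrite setTI.
  have sFD : sigma_generated `[0, +oo[ B (F `&` D).
    apply: (@measurableI _ (g_sigma_algebraType (generators `[0, +oo[%classic))) => //.
    exact: sub_itv sF.
  have xA : preimage_set_system setT xi measurable (xi @^-1` A).
    by exists A => //; rewrite setTI.
  change (P ((xi @^-1` A `&` F) `&` D) = (fine (P D))%:E * P (xi @^-1` A `&` F))%E.
  rewrite -setIA (xiB xA sFD) (xiB xA (sub_itv (@itv0 s) sF)).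
  rewrite (bm_independent BM s0 st sF); last by exists C => //; rewrite setTI.
  by rewrite fineK ?fin_num_measure// muleA muleC.
- move=> _; apply: (@le_lt_trans _ _ 1%E); last exact: ltry.
  by change (P (setT `&` D) <= 1)%E; rewrite setTI probability_le1.
Qed.

Lemma measurable_start_history (s r : R) : r \in `[0, s] ->
  @measurable_fun _ _ (g_sigma_algebraType (start_history s)) _ setT
    (fun o => xi o + B r o).
Proof.
move=> rs; apply: measurable_rVD => _ A mA; rewrite setTI; apply: sub_sigma_algebra.
  exists A, setT; split => //; last by rewrite setIT.
  exact: (@measurableT _ (g_sigma_algebraType (generators `[0, s]%classic))).
exists setT, (B r @^-1` A); split => //; last by rewrite preimage_setT setTI.
by apply: sub_sigma_algebra; exists r, A.
Qed.

(** The Markov property in integrated form: with the history up to [s] frozen, the remaining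
    increment is a centred Gaussian of variance t - s. *)
Lemma Rintegral_increment (s t : R) (E : set O) (phi : V -> R) (M : R) :
  0 <= s -> s < t -> <<s start_history s >> E ->
  measurable_fun setT phi -> (forall x, `|phi x| <= M) ->
  \int[P]_o (\1_E o * phi (xi o + B t o)) =
  \int[P]_o (\1_E o * \int[lebesgue_measure_rV d]_y
     (phi (xi o + B s o + y) * gaussian_density (t - s) y)).
Proof.
move=> s0 st sE mphi phiM.
have t0 : 0 <= t by rewrite (le_trans s0)// ltW.
have ts : 0 < t - s by rewrite subr_gt0.
pose T1 := g_sigma_algebraType (start_history s).
have mid : @measurable_fun _ _ O T1 setT id.
  move=> _ A mA; rewrite setTI preimage_id.
  apply: (smallest_sub _ _ mA); first exact: sigma_algebra_measurable.
  exact: start_history_sub.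
pose Y o := B t o - B s o.
have mY : measurable_fun setT Y.
  by apply: measurable_rVB => //; exact: (bm_measurable BM).
pose F (z : T1 * V) := \1_E z.1 * phi (xi z.1 + B s z.1 + z.2).
have mF : measurable_fun setT F.
  apply: measurable_funM.
    have mE : @measurable_fun _ _ T1 _ setT (\1_E : T1 -> R).
      exact: measurable_indic.
    exact: (measurableT_comp mE (@measurable_fst _ _ T1 V)).
  apply: measurableT_comp => //; apply: measurable_rVD; last exact: measurable_snd.
  apply: (@measurableT_comp _ _ _ _ _ _ (fun o : T1 => xi o + B s o)) => //.
  by apply: measurable_start_history; rewrite in_itv/= s0 lexx.
have FM z : `|F z| <= M.
  rewrite normrM indicE (le_trans _ (phiM (xi z.1 + B s z.1 + z.2)))//.
  by rewrite ler_piMl// normr_nat; case: (_ \in _).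
have indep A C : measurable A -> measurable C ->
    P ((id : O -> T1) @^-1` A `&` Y @^-1` C) = (P (id @^-1` A) * P (Y @^-1` C))%E.
  by move=> mA mC; rewrite !preimage_id; apply: start_history_independent.
have := Rintegral_independent mid mY mF FM indep.
rewrite (_ : (fun x => F (id x, Y x)) = fun o => \1_E o * phi (xi o + B t o)); last first.
  by apply/funext => o; rewrite /F/= /Y -addrA [B s o + _]addrC subrK.
move=> ->; apply: eq_Rintegral => o _.
rewrite /F/=.
set nu := distribution _ _.
have nuE (A : set V) : measurable A -> nu A = (\int[lebesgue_measure_rV d]_(x in A) (gaussian_density (t - s) x)%:E)%E.
  by move=> mA; rewrite -(bm_gaussian BM s0 st).
have mh : measurable_fun setT (fun y => phi (xi o + B s o + y)).
  by apply: measurableT_comp => //; exact: measurable_rVD.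
have ih : nu.-integrable setT (EFin \o (fun y => phi (xi o + B s o + y))).
  by apply: (@integrable_bounded _ _ _ nu setT _ M).
have [_ E1] := integral_density (@measurable_gaussian_density R (t - s) d)
  (@gaussian_density_ge0 R (t - s) d) nuE ih mh.
by rewrite RintegralZl// /Rintegral E1.
Qed.

End increments.

(** * Riemann sums of random coefficients, and measurability of Gaussian averages *)

Section riemann.
Context (R : realType).
Notation leb1 := (@lebesgue_measure R).

(** The sum is the integral of the step function equal to [c n k] on the k-th cell. These functions
    are bounded by [M] and converge pointwise to [L], so dominated convergence applies, and
    measurability of [L] comes out of the limit. *)
Lemma riemann_sum_cvg (t M : R) (c : nat -> nat -> R) (L : R -> R) : 0 < t ->
  (forall n k, (k <= n)%N -> `|c n k| <= M) ->
  (forall s, 0 < s < t ->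
    c n (Num.truncn (s / (t / n.+1%:R))) @[n --> \oo] --> L s) ->
  [/\ measurable_fun `]0, t[ L, leb1.-integrable `]0, t[ (EFin \o L) &
   \sum_(k < n.+1) c n k * (t / n.+1%:R) @[n --> \oo] -->
     \int[leb1]_(s in `]0, t[) L s].
Proof.
move=> t0 cM cL; pose h n : R := t / n.+1%:R.
have h0 n : 0 < h n by rewrite divr_gt0.
pose I n k : set R := `[(k%:R * h n)%R, (k.+1%:R * h n)%R[%classic.
have mI n k : measurable (I n k) by exact: measurable_itv.
pose f n (s : R) := \sum_(k < n.+1) c n k * \1_(I n k) s.
pose D : set R := `]0, t[%classic.
have mD : measurable D by exact: measurable_itv.
have If n s : D s -> (Num.truncn (s / h n) <= n)%N /\ f n s = c n (Num.truncn (s / h n)).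
  rewrite /D/= in_itv/= => /andP[s0 st].
  have sh0 : 0 <= s / h n by rewrite divr_ge0// ltW.
  have IE k : (s \in I n k) = (k == Num.truncn (s / h n)).
    apply/idP/eqP; rewrite /I inE /= in_itv/=.
      by rewrite -ler_pdivlMr// -ltr_pdivrMr// => sk; apply/esym/truncn_def.
    by move=> ->; rewrite -ler_pdivlMr// -ltr_pdivrMr// truncn_itv.
  have Tn : (Num.truncn (s / h n) <= n)%N.
    rewrite -ltnS truncn_lt_nat// ltr_pdivrMr// /h mulrCA divff ?mulr1//.
  split => //; rewrite /f (bigD1 (Ordinal (Tn : (_ < n.+1)%N)))//= indicE IE eqxx mulr1.
  rewrite big1 ?addr0// => k kn; rewrite indicE IE.
  rewrite (_ : (_ == _) = false) ?mulr0//; apply/negbTE.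
  by apply: contra kn => /eqP ke; apply/eqP/val_inj.
have mf n : measurable_fun D (f n).
  apply: measurable_funTS; apply: measurable_sum => k.
  apply: measurable_funM => //; exact: measurable_indic.
have cf s : D s -> f n s @[n --> \oo] --> L s.
  move=> Ds; rewrite (_ : f ^~ s = fun n => c n (Num.truncn (s / h n))).
    by apply: cL; move: Ds; rewrite /D/= in_itv.
  by apply/funext => n; have [] := If n s Ds.
have mL : measurable_fun D L by exact: measurable_fun_cvg cf.
have Doo : (lebesgue_measure D < +oo)%E.
  by rewrite /D lebesgue_measure_itv/= lte_fin t0 oppr0 adde0 ltry.
have iM (k : R) : leb1.-integrable D (EFin \o cst k).
  apply: measurable_bounded_integrable => //.
  exact: bounded_cst.
have [|||||iL _ cI] := @dominated_convergence _ _ _ leb1 D mD (fun n => EFin \o f n)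
  (EFin \o L) (EFin \o cst M).
- by move=> n; apply/measurable_EFinP; exact: mf.
- by apply/measurable_EFinP.
- apply: aeW => s Ds; apply: cvg_EFin; first exact: nearW.
  exact: cf.
- exact: iM.
- by apply: aeW => s n Ds; rewrite /= lee_fin; have [sn ->] := If n s Ds; exact: cM.
split => //.
have E n : (\int[leb1]_(s in D) (f n s)%:E = (\sum_(k < n.+1) c n k * h n)%:E)%E.
  have tn : n.+1%:R * h n = t by rewrite /h mulrCA divff ?mulr1.
  transitivity (\int[leb1]_(s in `[0%R, t[) (f n s)%:E)%E.
    rewrite (@integral_itv_obnd_cbnd R 0 (BLeft t) (EFin \o f n))//.
    by apply/measurable_EFinP; exact: mf.
  have mD' : measurable (`[0, t[%classic : set R) by exact: measurable_itv.
  have Doo' : (lebesgue_measure (`[0%R, t[%classic : set R) < +oo)%E.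
    by rewrite lebesgue_measure_itv/= lte_fin t0 oppr0 adde0 ltry.
  have i1 k : leb1.-integrable `[0, t[ (EFin \o \1_(I n k)).
    apply: measurable_bounded_integrable => //; first by apply: measurable_indic; exact: mI.
    exists 1; split; first exact: num_real.
    move=> x x1 s _ /=; rewrite (le_trans _ (ltW x1))// indicE normr_nat.
    by case: (_ \in _).
  under eq_integral do rewrite /f -sumEFin.
  rewrite integral_sum//=; last first.
    by move=> k; exact: integrable_EFinZ.
  rewrite -sumEFin; apply: eq_bigr => k _.
  rewrite integral_EFinZ//.
  have Ih : lebesgue_measure (I n k) = (h n)%:E.
    rewrite /I lebesgue_measure_itv/= lte_fin ltr_pM2r// ltr_nat ltnSn.
    by rewrite -EFinB -mulrBl -natrB// subSnn mul1r.
  rewrite integral_indic; [|exact: mD'|exact: mI].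
  rewrite (_ : I n k `&` _ = I n k); first by rewrite EFinM -Ih.
  apply/setIidPl => s; rewrite /I /= !in_itv/= => /andP[s1 s2].
  rewrite (le_trans (mulr_ge0 (ler0n _ _) (ltW (h0 n))) s1)/=.
  by rewrite (lt_le_trans s2)// -[leRHS]tn ler_pM2r// ler_nat.
have := fine_cvg (f := fun n => (\int[leb1]_(s in D) (f n s)%:E)%E).
have -> : fine \o (fun n => \int[leb1]_(s in D) (f n s)%:E)%E =
    fun n => \sum_(k < n.+1) c n k * (t / n.+1%:R).
  by apply/funext => n /=; rewrite E.
by apply; rewrite fineK//; exact: integrable_fin_num.
Qed.

End riemann.

Lemma within_continuous_cvg (R : realType) (V : pseudoMetricType R) (A : set R)
    (f : R -> V) (u : nat -> R) (l : R) :
  {within A, continuous f} -> A l -> (forall n, A (u n)) -> u @ \oo --> l ->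
  f (u n) @[n --> \oo] --> f l.
Proof.
move=> /subspace_continuousP/[apply] fl Au ul.
move=> U /fl fU; have : \forall n \near \oo, A (u n) -> U (f (u n)) by exact: ul fU.
by rewrite !near_simpl; apply: filterS => n; exact.
Qed.

(** Adding [M] makes the integrand nonnegative, so that Tonelli gives measurability; the constant
    integrates to [M] and is subtracted again. *)
Lemma measurable_gaussian_average (R : realType) d (h M : R) (phi : 'rV[R]_d -> R) :
  measurable_fun setT phi -> (forall x, `|phi x| <= M) ->
  measurable_fun setT (fun x : 'rV[R]_d => \int[lebesgue_measure_rV d]_y
    (phi (x + y) * gaussian_density h y)).
Proof.
move=> mphi phiM; pose f (z : 'rV[R]_d * 'rV[R]_d) :=
  ((phi (z.1 + z.2) + M) * gaussian_density h z.2)%:E.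
have madd : measurable_fun setT (fun z : 'rV[R]_d * 'rV[R]_d => phi (z.1 + z.2)).
  apply: measurableT_comp => //; apply: measurable_rVD; first exact: measurable_fst.
  exact: measurable_snd.
have mf : measurable_fun setT f.
  apply/measurable_EFinP; apply: measurable_funM; first exact: measurable_funD.
  apply: (measurableT_comp (@measurable_gaussian_density R h d)).
  exact: measurable_snd.
have f0 z : (0 <= f z)%E.
  rewrite lee_fin mulr_ge0 ?gaussian_density_ge0// -lerBlDr sub0r.
  by have := phiM (z.1 + z.2); rewrite ler_norml => /andP[].
have := @measurable_fun_fubini_tonelli_F _ _ _ _ _ (lebesgue_measure_rV d) f mf f0.
move=> mF; rewrite (_ : (fun x : 'rV[R]_d => _) = fun x =>
    fine (fubini_F (lebesgue_measure_rV d) f x) - M).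
  by apply: measurable_funB => //; exact: measurableT_comp.
apply/funext => x; rewrite /fubini_F /f/=.
under [in RHS]eq_integral do rewrite mulrDl.
have mx : measurable_fun setT (fun y => phi (x + y)).
  by apply: measurableT_comp => //; exact: measurable_rVD.
have i1 : (lebesgue_measure_rV d).-integrable setT
    (fun y => (M * gaussian_density h y)%:E).
  by apply: (@integrable_gaussian _ _ _ (cst M) `|M|).
have i2 : (lebesgue_measure_rV d).-integrable setT
    (fun y => (phi (x + y) * gaussian_density h y)%:E).
  exact: integrable_gaussian.
have i0 : (lebesgue_measure_rV d).-integrable setT
    (fun y => (1 * gaussian_density h y)%:E).
  by apply: (@integrable_gaussian _ _ _ (cst 1) 1) => // y; rewrite normr1.
have i0' : (lebesgue_measure_rV d).-integrable setT
    (EFin \o @gaussian_density R d h).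
  by apply: eq_integrable i0 => // y _; rewrite mul1r.
rewrite integral_EFinD// fineD ?integrable_fin_num// [X in _ + fine X]integral_EFinZ//.
by rewrite integral_gaussian_density// mule1 /= addrK.
Qed.

(** * The stopped process and its approximation on a time grid *)

Section stopped_process.
Context (R : realType) (d : nat) (T : R) (dO : measure_display)
  (O : measurableType dO).
Local Notation V := 'rV[R]_d.
Variables (P : probability O R) (xi : O -> V) (B : R -> O -> V) (G : R -> set V).
Hypothesis T0 : 0 < T.
Hypothesis mxi : measurable_fun setT xi.
Hypothesis BM : standard_brownian_motion P B.
Hypothesis xiB : independent_systems P (preimage_set_system setT xi measurable)
  (sigma_generated `[0, +oo[ B).
Hypothesis cG : closed_family T G.
Hypothesis ndG : nondecreasing_family T G.
Hypothesis rcG : right_continuous_family T G.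

Definition started (r : R) (o : O) : V := xi o + B r o.
Local Notation W := started.

Definition stopping (s : R) (o : O) : R :=
  fine (Order.min s%:E (hitting_time T G (W ^~ o))).

Definition survival (s : R) : set O := [set o | alive G (W ^~ o) s].

Lemma started_measurable r : 0 <= r -> measurable_fun setT (W r).
Proof. by move=> r0; apply: measurable_rVD => //; exact: bm_measurable BM _ _. Qed.

Lemma started_continuous o : {within `[0, T], continuous (W ^~ o)}.
Proof.
have c : {within `[0, +oo[, continuous (W ^~ o)}.
  by move=> r; apply: continuousD; [exact: cst_continuous|exact: (bm_continuous BM)].
apply: continuous_subspaceW c => r /=; rewrite !in_itv/= andbT.
by case/andP.
Qed.

(** The measurability of survival is proved for an arbitrary sigma-algebra for which the positions
    up to [s] are measurable, so it can be applied with the history itself. *)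
Lemma survival_history s : s \in `[0, T] -> <<s start_history xi B s >> (survival s).
Proof.
move=> sT; have := @measurable_alive R d T G cG ndG rcG _
  (g_sigma_algebraType (start_history xi B s)) W s sT started_continuous.
by apply => r rs; exact: measurable_start_history.
Qed.

Lemma survival_measurable s : s \in `[0, T] -> measurable (survival s).
Proof.
move=> sT; apply: measurable_alive sT started_continuous _ => // r.
by rewrite in_itv/= => /andP[r0 _]; exact: started_measurable.
Qed.

Lemma stoppingE s o : 0 <= s -> s <= T -> o \in survival s -> stopping s o = s.
Proof.
rewrite inE /survival/= => s0 sT As; have sT' : s \in `[0, T] by rewrite in_itv/= s0.
have /(lt_hitting_time cG ndG rcG sT' (@started_continuous o)) H := As.
by rewrite /stopping min_l// ltW.
Qed.

Lemma stopping_itv s o : 0 <= s -> s <= T -> 0 <= stopping s o <= s.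
Proof.
move=> s0 sT; have : (0%:E <= hitting_time T G (W ^~ o))%E.
  apply: le_ereal_inf_tmp => _ [r /= [rT Gr] <-]; move: rT.
  by rewrite in_itv/= lee_fin => /andP[].
rewrite /stopping; case: (hitting_time _ _ _) => [r| |]//.
  rewrite lee_fin => r0; rewrite -EFin_min/= le_min s0 r0/=.
  by rewrite ge_min lexx.
by rewrite min_l ?leey//= s0 lexx.
Qed.

Lemma stopping_lipschitz s s' o : 0 <= s -> s <= s' -> s' <= T ->
  0 <= stopping s' o - stopping s o <= s' - s.
Proof.
move=> s0 ss' sT; have : (0%:E <= hitting_time T G (W ^~ o))%E.
  apply: le_ereal_inf_tmp => _ [r /= [rT Gr] <-]; move: rT.
  by rewrite in_itv/= lee_fin => /andP[].
rewrite /stopping; case: (hitting_time _ _ _) => [r| |]//.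
  rewrite lee_fin => r0; rewrite -!EFin_min/=.
  by case: (leP s r); case: (leP s' r) => ? ?; apply/andP; split; lra.
by rewrite !min_l ?leey//= subr_ge0 ss' lexx.
Qed.

Lemma stopping_dead s s' o : 0 <= s -> s <= s' -> s' <= T ->
  o \notin survival s -> stopping s' o = stopping s o.
Proof.
move=> s0 ss' sT; rewrite notin_setE => nA.
have sT' : s \in `[0, T] by rewrite in_itv/= s0 (le_trans ss').
have H : (hitting_time T G (W ^~ o) <= s%:E)%E.
  by rewrite leNgt; apply/negP => /(lt_hitting_time cG ndG rcG sT' (@started_continuous o)).
by rewrite /stopping !min_r// (le_trans H).
Qed.

Section grid.
Variable h : R.
Hypothesis h0 : 0 < h.

(** The path is frozen at the first grid time at which it is dead, which may lie up to one mesh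
    after the true hitting time. In this way the decision to move during a step depends only on the
    history at the start of the step. *)
Fixpoint grid_stopped (k : nat) (o : O) : V :=
  if k is k'.+1 then
    if o \in survival (k'%:R * h) then W (k'.+1%:R * h) o else grid_stopped k' o
  else W 0 o.
Local Notation X := grid_stopped.

Lemma grid_ge0 k : 0 <= k%:R * h. Proof. exact: mulr_ge0 (ler0n _ _) (ltW h0). Qed.

Lemma grid_survivalS k : survival (k.+1%:R * h) `<=` survival (k%:R * h).
Proof. by move=> o; apply: aliveS; rewrite ler_wpM2r ?ler_nat// ltW. Qed.

Lemma grid_stopped_survival k o : o \in survival (k%:R * h) -> X k o = W (k%:R * h) o.
Proof.
case: k => [|k]; first by rewrite mul0r.
by move=> /set_mem/grid_survivalS/mem_set /= ->.
Qed.

Lemma measurable_grid_stopped k : k%:R * h <= T -> measurable_fun setT (X k).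
Proof.
elim: k => [|k IH] kT /=; first exact: started_measurable.
have kT' : k%:R * h <= T by rewrite (le_trans _ kT)// ler_wpM2r ?ler_nat// ltW.
apply: measurable_fun_ifT.
- apply: (measurable_fun_bool true) => /=.
  rewrite setTI [X in measurable X](_ : _ = survival (k%:R * h)).
    by apply: survival_measurable; rewrite in_itv/= grid_ge0.
  by apply/seteqP; split => o /=; [exact: set_mem|exact: mem_set].
- exact/started_measurable/grid_ge0.
- exact: IH.
Qed.

(** The grid process sits at a value of the path whose time is within one mesh of the true stopped
    time. After death both times stay constant, which is the induction step. *)
Lemma grid_stopped_near k o : k%:R * h <= T ->
  exists2 r, 0 <= r <= T & X k o = W r o /\ `|r - stopping (k%:R * h) o| <= h.
Proof.
elim: k => [|k IH] kT.
  exists 0; first by rewrite lexx ltW.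
  have := @stopping_itv 0 o (lexx 0) (ltW T0); rewrite mul0r => s00.
  by rewrite (_ : stopping 0 o = 0) ?subrr ?normr0 ?(ltW h0)//; apply/eqP; rewrite eq_le andbC.
have kk : k%:R * h <= k.+1%:R * h by rewrite ler_wpM2r ?ler_nat// ltW.
have kT' : k%:R * h <= T by exact: le_trans kT.
have [Ak|nAk] := boolP (o \in survival (k%:R * h)).
  exists (k.+1%:R * h); first by rewrite grid_ge0.
  rewrite /= Ak; split => //.
  have := stoppingE (grid_ge0 k) kT' Ak.
  have /andP[h1 h2] := stopping_lipschitz o (grid_ge0 k) kk kT.
  have /andP[_ h3] := stopping_itv o (grid_ge0 k.+1) kT => E.
  rewrite ger0_norm ?subr_ge0// lerBlDr; apply: (@le_trans _ _ (h + stopping (k%:R * h) o)).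
    by rewrite E -natr1 mulrDl mul1r addrC.
  by rewrite lerD2l -subr_ge0.
have [r r0 [Xr rh]] := IH kT'; exists r => //; rewrite /= (negbTE nAk).
by rewrite (stopping_dead (grid_ge0 k) kk kT nAk).
Qed.

End grid.

End stopped_process.

(** * The Dynkin formula for the stopped process *)

Section dynkin.
Context (R : realType) (d : nat) (T : R) (dO : measure_display)
  (O : measurableType dO).
Local Notation V := 'rV[R]_d.
Local Notation leb := (@lebesgue_measure_rV R d).
Variables (P : probability O R) (xi : O -> V) (B : R -> O -> V) (G : R -> set V).
Hypothesis T0 : 0 < T.
Hypothesis mxi : measurable_fun setT xi.
Hypothesis BM : standard_brownian_motion P B.
Hypothesis xiB : independent_systems P (preimage_set_system setT xi measurable)
  (sigma_generated `[0, +oo[ B).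
Hypothesis cG : closed_family T G.
Hypothesis ndG : nondecreasing_family T G.
Hypothesis rcG : right_continuous_family T G.
Local Notation W := (started xi B).
Local Notation tau_at := (stopping T xi B G).
Local Notation A := (survival xi B G).

Variables (t : R) (phi psi : R -> V -> R) (g1 g2 : 'I_d -> R -> V -> R) (M : R).
Hypothesis t0 : 0 < t.
Hypothesis tT : t <= T.
Hypothesis phiM : forall s x, 0 <= s <= t -> `|phi s x| <= M.
Hypothesis cphi : forall s, continuous (phi s).
Hypothesis d1 : forall i s x (a : R), is_derive a (1 : R)
  (fun b => phi s (x + b *: basis_vec R i)) (g1 i s (x + a *: basis_vec R i)).
Hypothesis d2 : forall i s x (a : R), is_derive a (1 : R)
  (fun b => g1 i s (x + b *: basis_vec R i)) (g2 i s (x + a *: basis_vec R i)).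
Hypothesis g2lip : forall i j s x a, 0 <= s <= t ->
  `|g2 i s (x + a *: basis_vec R j) - g2 i s x| <= M * `|a|.
Hypothesis g2M : forall i s x, 0 <= s <= t -> `|g2 i s x| <= M.
Hypothesis dpsi : forall s x, is_derive s (1 : R) (phi ^~ x) (psi s x).
Hypothesis psiM : forall s x, 0 < s < t -> `|psi s x| <= M.
Hypothesis cpsi : continuous (fun z : R * V => psi z.1 z.2).
Hypothesis cg2 : forall i, continuous (fun z : R * V => g2 i z.1 z.2).

Let M0 : 0 <= M.
Proof. by have := @phiM 0 0; rewrite lexx (ltW t0) => /(_ isT); exact: le_trans. Qed.

Let mphi s : measurable_fun setT (phi s).
Proof. exact: continuous_measurable_rV. Qed.

Let lap (s : R) (x : V) : R := 2^-1 * \sum_i g2 i s x.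

Let mg2 i s : measurable_fun setT (g2 i s).
Proof.
apply: continuous_measurable_rV => x.
apply: (@continuous_comp _ _ _ (fun x => (s, x)) (fun z => g2 i z.1 z.2)).
  apply: (@cvg_pair _ _ _ (nbhs x) (nbhs s) (nbhs x) _ _ _ (cst s) id); [exact: cvg_cst|exact: cvg_id].
exact: cg2.
Qed.

Let mlap s : measurable_fun setT (lap s).
Proof. by apply: measurable_funM => //; exact: measurable_sum. Qed.

Let lapM s x : 0 <= s <= t -> `|lap s x| <= d%:R * M.
Proof.
move=> st; rewrite /lap normrM ger0_norm ?invr_ge0//.
apply: (@le_trans _ _ (1 * `|\sum_i g2 i s x|)).
  by apply: ler_wpM2r => //; lra.
rewrite mul1r (le_trans (ler_norm_sum _ _ _))//.
rewrite (le_trans (ler_sum _ (fun i _ => g2M i x st)))//.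
by rewrite sumr_const card_ord mulr_natl.
Qed.

Let mW r : 0 <= r -> measurable_fun setT (W r).
Proof. exact: (started_measurable mxi BM). Qed.

Let indic_le1 (E : set O) o : `|\1_E o : R| <= 1.
Proof. by rewrite indicE normr_nat; case: (_ \in _). Qed.

Let Rintegral_diff (f g : O -> R) (K : R) : measurable_fun setT f ->
  measurable_fun setT g -> (forall o, `|f o| <= K) -> (forall o, `|g o| <= K) ->
  \int[P]_o f o - \int[P]_o g o = \int[P]_o (f o - g o).
Proof.
move=> mf mg fK gK; rewrite RintegralB//;
  exact: (@integrable_bounded _ _ _ P setT _ K).
Qed.

(* The Gaussian average over the independent increment on [s, s + h] is the
   heat semigroup, expanded to first order in h. *)
Let one_step (s h : R) : 0 <= s -> 0 < h -> s + h <= t ->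
  `|\int[P]_o (\1_(A s) o * phi (s + h) (W (s + h) o)) -
    \int[P]_o (\1_(A s) o * phi (s + h) (W s o)) -
    h * \int[P]_o (\1_(A s) o * lap (s + h) (W s o))| <=
  heat_constant R d * M * Num.sqrt h ^+ 3.
Proof.
move=> s0 h0 sht; set r := s + h; have rs : r - s = h by rewrite /r addrAC subrr add0r.
have sr : s < r by rewrite -subr_gt0 rs.
have r0t : 0 <= r <= t by rewrite sht andbT (le_trans s0)// ltW.
have sT : s \in `[0, T] by rewrite in_itv/= s0 (le_trans _ tT)// (le_trans _ sht)// ltW.
have mA : measurable (A s) by exact: (survival_measurable mxi BM cG ndG rcG sT).
have mi : measurable_fun setT (\1_(A s) : O -> R) by exact: measurable_indic.
rewrite (@Rintegral_increment R d dO O P xi B mxi BM xiB s r (A s) (phi r) M)//; last 2 first.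
- exact: (survival_history BM cG ndG rcG sT).
- by move=> x; exact: phiM.
rewrite rs.
set I := fun x => \int[leb]_y (phi r (x + y) * gaussian_density h y).
have mI : measurable_fun setT I.
  by apply: (@measurable_gaussian_average _ _ _ M) => // x; exact: phiM.
have IM x : `|I x| <= M.
  apply: gaussian_Rintegral_le; last by move=> y; exact: phiM.
  by apply: measurableT_comp => //; exact: measurable_rVD.
have heat x : `|I x - phi r x - h * lap r x| <= heat_constant R d * M * Num.sqrt h ^+ 3.
  have := @heat_expansion R h h0 d d (@basis_vec R d) (phi r) (g1 ^~ r) (g2 ^~ r) M M M0
    (mphi r) (fun x => phiM x r0t) (fun i x a => d1 i r x a) (fun i x a => d2 i r x a)
    (fun i j x a => g2lip i j x a r0t) x.
  rewrite (_ : (fun y : V => phi r (x + \sum_i y ord0 i *: basis_vec R i) * _) =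
      fun y => phi r (x + y) * gaussian_density h y); last first.
    by apply/funext => y; congr (phi r (x + _) * _); exact/esym/row_sum_delta.
  by rewrite (_ : h / 2 * _ = h * lap r x) ?opprD ?addrA// /lap mulrA.
have mIW : measurable_fun setT (fun o => \1_(A s) o * I (W s o)).
  by apply: measurable_funM => //; apply: measurableT_comp => //; exact: mW.
have mpW : measurable_fun setT (fun o => \1_(A s) o * phi r (W s o)).
  by apply: measurable_funM => //; apply: measurableT_comp => //; exact: mW.
have mlW : measurable_fun setT (fun o => \1_(A s) o * lap r (W s o)).
  by apply: measurable_funM => //; apply: measurableT_comp => //; exact: mW.
have bd (f : V -> R) K : (forall x, `|f x| <= K) -> forall o, `|\1_(A s) o * f (W s o)| <= K.
  move=> fK o; rewrite normrM (le_trans _ (fK (W s o)))//.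
  by rewrite ler_piMl.
rewrite (Rintegral_diff mIW mpW (bd _ _ IM) (bd _ _ (fun x => phiM x r0t))).
rewrite -RintegralZl//; last first.
  apply: (@integrable_bounded _ _ _ P setT _ (d%:R * M)) => // o _.
  by apply: bd => x; exact: lapM.
rewrite (@Rintegral_diff _ _ (2 * M + h * (d%:R * M))).
- apply: le_normr_Rintegral_probability.
    apply: measurable_funB; first exact: measurable_funB.
    exact: measurable_funM.
  move=> o; rewrite (_ : _ - _ = \1_(A s) o * (I (W s o) - phi r (W s o) - h * lap r (W s o))).
    by apply: (bd (fun x => I x - phi r x - h * lap r x)).
  by ring.
- exact: measurable_funB.
- exact: measurable_funM.
- move=> o; rewrite (le_trans (ler_normB _ _))// mulrDl mul1r -[leLHS]addr0.
  rewrite !lerD// ?(bd _ _ IM) ?(bd _ _ (fun x => phiM x r0t))//.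
  by rewrite mulr_ge0 ?mulr_ge0// ltW.
- move=> o; rewrite normrM (ger0_norm (ltW h0)) -[leLHS]add0r lerD ?mulr_ge0//.
  rewrite ler_wpM2l ?(ltW h0)//.
  by apply: bd => x; exact: lapM.
Qed.

Let h (n : nat) : R := t / n.+1%:R.
Let h_gt0 n : 0 < h n. Proof. by rewrite divr_gt0. Qed.
Let h_cvg0 : h n @[n --> \oo] --> (0 : R).
Proof. by rewrite -(mulr0 t); apply: cvgM; [exact: cvg_cst|exact: cvg_harmonic]. Qed.

Let squeeze_h (u : nat -> R) (l K : R) : (forall n, `|u n - l| <= K * h n) ->
  u n @[n --> \oo] --> l.
Proof.
move=> H; apply/subr_cvg0; apply: (@norm_cvg0 R R^o).
apply: (@squeeze_cvgr _ _ _ _ (cst 0) (fun n => K * h n)).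
- by apply: nearW => n; rewrite /= normr_ge0 H.
- exact: cvg_cst.
- by rewrite -(mulr0 K); apply: cvgM => //; exact: cvg_cst.
Qed.

Let pt (n k : nat) : R := k%:R * h n.
Let pt_ge0 n k : 0 <= pt n k. Proof. exact: mulr_ge0 (ler0n _ _) (ltW (h_gt0 n)). Qed.
Let ptS n k : pt n k.+1 = pt n k + h n.
Proof. by rewrite /pt -natr1 mulrDl mul1r. Qed.
Let pt_last n : pt n n.+1 = t.
Proof. by rewrite /pt /h mulrCA divff ?mulr1. Qed.
Let pt_le n k : (k <= n.+1)%N -> pt n k <= t.
Proof. by move=> kn; rewrite -(pt_last n) ler_wpM2r ?ler_nat// ltW. Qed.
Let ptT n k : (k <= n.+1)%N -> pt n k <= T.
Proof. by move=> kn; rewrite (le_trans (pt_le kn)). Qed.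
Let pt_itv n k : (k <= n.+1)%N -> pt n k \in `[0, T].
Proof. by move=> kn; rewrite in_itv/= pt_ge0 ptT. Qed.

Let X n k := grid_stopped xi B G (h n) k.
Let mX n k : (k <= n.+1)%N -> measurable_fun setT (X n k).
Proof.
move=> kn; apply: (measurable_grid_stopped mxi BM cG ndG rcG (h_gt0 n)).
exact: ptT.
Qed.

Let phi_increment (a b : R) x : 0 <= a -> a < b -> b <= t ->
  exists2 c, a < c < b & phi b x - phi a x = psi c x * (b - a).
Proof.
move=> a0 ab bt; have cp : continuous (phi ^~ x).
  by move=> r; apply/differentiable_continuous/derivable1_diffP; case: (dpsi r x).
have [c cab E] := MVT ab (fun r _ => dpsi r x) (continuous_subspaceT cp).
by exists c => //; move: cab; rewrite in_itv.
Qed.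

Let drift n k : R := \int[P]_o
  ((phi (pt n k.+1) (X n k o) - phi (pt n k) (X n k o)) / h n).
(** Survival is tested at the right end of the step, although the one-step estimate produces the
    left end. Only from the right do the indicators converge at every [s], to that of tau > s; left
    ends would also keep paths with tau = s. *)
Let diffusion n k : R :=
  \int[P]_o (\1_(A (pt n k.+1)) o * lap (pt n k.+1) (W (pt n k) o)).

Let mdrift n k : (k <= n)%N -> measurable_fun setT (fun o =>
  (phi (pt n k.+1) (X n k o) - phi (pt n k) (X n k o)) / h n).
Proof.
move=> kn; apply: measurable_funM => //; apply: measurable_funB;
  by apply: measurableT_comp => //; apply: mX; rewrite ltnW.
Qed.

Let driftM n k o : (k <= n)%N ->
  `|(phi (pt n k.+1) (X n k o) - phi (pt n k) (X n k o)) / h n| <= M.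
Proof.
move=> kn; have [] := @phi_increment (pt n k) (pt n k.+1) (X n k o) (pt_ge0 n k) _ _.
- by rewrite ptS ltrDl.
- exact: pt_le.
move=> c /andP[c1 c2] ->; rewrite ptS addrAC subrr add0r mulfK ?gt_eqF//.
apply: psiM; rewrite (le_lt_trans (pt_ge0 n k) c1)/= (lt_le_trans c2)//.
exact: pt_le.
Qed.

Let mA n k : (k <= n.+1)%N -> measurable (A (pt n k)).
Proof. by move=> kn; apply: (survival_measurable mxi BM cG ndG rcG); exact: pt_itv. Qed.

Let mdiffusion n k r : (k <= n.+1)%N -> 0 <= r ->
  measurable_fun setT (fun o => \1_(A (pt n k)) o * lap (pt n k) (W r o)).
Proof.
move=> kn r0; apply: measurable_funM; first by apply: measurable_indic; exact: mA.
by apply: measurableT_comp => //; exact: mW.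
Qed.

Let indicM (E : set O) r (f : V -> R) (K : R) o : (forall x, `|f x| <= K) ->
  `|\1_E o * f (W r o)| <= K.
Proof.
by move=> fK; rewrite normrM (le_trans _ (fK (W r o)))// ler_piMl.
Qed.

Let coef_bound n k : (k <= n)%N -> `|drift n k + diffusion n k| <= M + d%:R * M.
Proof.
move=> kn; rewrite (le_trans (ler_normD _ _))// lerD//.
  apply: le_normr_Rintegral_probability; first exact: mdrift.
  by move=> o; exact: driftM.
apply: le_normr_Rintegral_probability; first exact: mdiffusion.
by move=> o; apply: indicM => x; apply: lapM; rewrite pt_ge0 pt_le.
Qed.

Let E n k : R := \int[P]_o phi (pt n k) (X n k o).
Let m n k : R := \int[P]_o (\1_(A (pt n k)) o : R).

(** The step is split into a change of time at a frozen position, which is exactly the drift term,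
    and a change of position at a frozen time. The latter vanishes for dead paths and is governed by
    [one_step] for the others. The last error term pays for moving the survival test to the right
    end. *)
Let grid_step n k : (k <= n)%N ->
  `|E n k.+1 - E n k - (drift n k + diffusion n k) * h n| <=
  heat_constant R d * M * Num.sqrt (h n) ^+ 3 + h n * (d%:R * M) * (m n k - m n k.+1).
Proof.
move=> kn; have kn1 : (k <= n.+1)%N by rewrite ltnW.
set r := pt n k.+1; set s := pt n k.
have r0t : 0 <= r <= t by rewrite pt_ge0 pt_le.
have s0t : 0 <= s <= t by rewrite pt_ge0 pt_le.
have rE : r = s + h n by exact: ptS.
have phir x : `|phi r x| <= M by exact: phiM.
have phis x : `|phi s x| <= M by exact: phiM.
have mp u v : (v <= n.+1)%N -> measurable_fun setT (fun o => phi u (X n v o)).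
  by move=> vn; apply: measurableT_comp => //; exact: mX.
have mi v : (v <= n.+1)%N -> measurable_fun setT (\1_(A (pt n v)) : O -> R).
  by move=> vn; apply: measurable_indic; exact: mA.
have D1 : \int[P]_o phi r (X n k o) - E n k = drift n k * h n.
  rewrite (Rintegral_diff (mp r k kn1) (mp s k kn1) (fun o => phir _) (fun o => phis _)).
  rewrite -RintegralZr//; last first.
    by apply: (@integrable_bounded _ _ _ P setT _ M) => //; [exact: mdrift|move=> o _; exact: driftM].
  by apply: eq_Rintegral => o _; rewrite divfK// gt_eqF.
have D2 : E n k.+1 - \int[P]_o phi r (X n k o) =
    \int[P]_o (\1_(A s) o * phi r (W r o)) - \int[P]_o (\1_(A s) o * phi r (W s o)).
  rewrite (Rintegral_diff (mp r k.+1 kn) (mp r k kn1) (fun o => phir _) (fun o => phir _)).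
  rewrite (@Rintegral_diff _ _ M).
  - apply: eq_Rintegral => o _; rewrite indicE.
    rewrite [X n k.+1 o](_ : _ = if o \in A s then W r o else X n k o)//.
    have [oA|nA] := boolP (o \in A s); last by rewrite !mul0r !subrr.
    by rewrite /X (grid_stopped_survival (h_gt0 n) oA) !mul1r.
  - apply: measurable_funM; first exact: (mi k kn1).
    by apply: measurableT_comp => //; exact: (mW (pt_ge0 n k.+1)).
  - apply: measurable_funM; first exact: (mi k kn1).
    by apply: measurableT_comp => //; exact: (mW (pt_ge0 n k)).
  - by move=> o; exact: indicM.
  - by move=> o; exact: indicM.
have D3 := @one_step s (h n) (pt_ge0 n k) (h_gt0 n); rewrite -rE in D3.
have {}D3 := D3 (pt_le (kn : (k.+1 <= n.+1)%N)).
set J := \int[P]_o (\1_(A s) o * lap r (W s o)) in D3.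
have lapr x : `|lap r x| <= d%:R * M by exact: lapM.
have mJ v : (v <= n.+1)%N -> measurable_fun setT (fun o => \1_(A (pt n v)) o * lap r (W s o)).
  move=> vn; apply: measurable_funM; first exact: mi.
  by apply: measurableT_comp => //; exact: (mW (pt_ge0 n k)).
(* Survival at the right end implies survival at the left end, so the difference of indicators is
   nonnegative and its mean is the loss of survival probability in the step. *)
have D4 : `|J - diffusion n k| <= d%:R * M * (m n k - m n k.+1).
  rewrite /J /diffusion (Rintegral_diff (mJ k kn1) (mJ k.+1 kn)
    (fun o => indicM _ _ _ lapr) (fun o => indicM _ _ _ lapr)).
  have ind1 v o : `|\1_(A (pt n v)) o : R| <= 1 by [].
  rewrite (Rintegral_diff (mi k kn1) (mi k.+1 kn) (ind1 k) (ind1 k.+1)).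
  have mD : measurable_fun setT (fun o => \1_(A (pt n k)) o * lap r (W s o) -
      \1_(A (pt n k.+1)) o * lap r (W s o)).
    by apply: measurable_funB; exact: mJ.
  have iD : P.-integrable setT (EFin \o (fun o => \1_(A (pt n k)) o * lap r (W s o) -
      \1_(A (pt n k.+1)) o * lap r (W s o))).
    apply: (@integrable_bounded _ _ _ P setT _ (d%:R * M + d%:R * M)) => // o _.
    by rewrite (le_trans (ler_normB _ _))// lerD//; exact: indicM.
  have i1 : P.-integrable setT (EFin \o (fun o => \1_(A (pt n k)) o - \1_(A (pt n k.+1)) o : R)).
    apply: (@integrable_bounded _ _ _ P setT _ (1 + 1)).
    - by [].
    - by apply: measurable_funB; exact: mi.
    - by move=> o _; rewrite (le_trans (ler_normB _ _))// lerD.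
  rewrite (le_trans (le_normr_Rintegral _ iD))// -RintegralZl//.
  apply: le_Rintegral => //.
  - exact: integrable_norm.
  - exact: integrable_EFinZ.
  - move=> o _.
    have ge0 : 0 <= \1_(A (pt n k)) o - \1_(A (pt n k.+1)) o :> R.
      rewrite subr_ge0 !indicE ler_nat.
      case: (boolP (o \in A (pt n k.+1))) => //.
      by move=> /set_mem/(grid_survivalS (h_gt0 n))/mem_set ->.
    rewrite -mulrBl normrM (ger0_norm ge0) [leRHS]mulrC.
    by apply: ler_wpM2l => //; exact: lapr.
rewrite (_ : E n k.+1 - E n k - _ =
  (\int[P]_o (\1_(A s) o * phi r (W r o)) - \int[P]_o (\1_(A s) o * phi r (W s o)) -
   h n * J) + h n * (J - diffusion n k)); last first.
  by rewrite -D2 mulrDl -D1; ring.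
rewrite (le_trans (ler_normD _ _))// lerD// normrM (ger0_norm (ltW (h_gt0 n))).
by rewrite -[leRHS]mulrA ler_wpM2l// ltW.
Qed.

(** Adding n+1 errors of order h^{3/2} with (n+1) h = t leaves the square root of h. The survival
    losses telescope to at most 1, so the second error stays of order h. *)
Let grid_total n :
  `|E n n.+1 - E n 0 - \sum_(k < n.+1) (drift n k + diffusion n k) * h n| <=
  (heat_constant R d * M * t) * Num.sqrt (h n) + d%:R * M * h n.
Proof.
have m1 k : (k <= n.+1)%N -> 0 <= m n k <= 1.
  move=> kn; apply/andP; split; first by apply: Rintegral_ge0 => o _; rewrite indicE.
  apply: le_trans (ler_norm _) _; apply: le_normr_Rintegral_probability => //.
  by apply: measurable_indic; exact: mA.
have mE : \sum_(k < n.+1) (m n k - m n k.+1) = m n 0%N - m n n.+1.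
  rewrite -(big_mkord xpredT (fun k => m n k - m n k.+1)).
  rewrite (eq_bigr (fun k => (- m n k.+1) - (- m n k))); last first.
    by move=> k _; rewrite opprK addrC.
  by rewrite (@telescope_sumr _ 0 n.+1 (fun k => - m n k))// opprK addrC.
rewrite -(@telescope_sumr _ 0 n.+1 (E n))// big_mkord -sumrB.
rewrite (le_trans (ler_norm_sum _ _ _))//.
apply: (@le_trans _ _ (\sum_(k < n.+1) (heat_constant R d * M * Num.sqrt (h n) ^+ 3 +
   h n * (d%:R * M) * (m n k - m n k.+1)))).
  by apply: ler_sum => k _; apply: grid_step; rewrite -ltnS.
rewrite big_split/= sumr_const card_ord -mulr_sumr.
rewrite mE lerD//.
  rewrite -mulr_natl (_ : Num.sqrt (h n) ^+ 3 = h n * Num.sqrt (h n)); last first.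
    by rewrite exprS sqr_sqrtr 1?mulrC// ltW.
  rewrite le_eqVlt; apply/orP; left; apply/eqP.
  rewrite -[in RHS](pt_last n) /pt; ring.
rewrite [leLHS](_ : _ = d%:R * M * h n * (m n 0%N - m n n.+1)); last by ring.
apply: ler_piMr; first by rewrite !mulr_ge0// ltW.
have := m1 0%N (leq0n _); have := m1 n.+1 (leqnn _).
by move=> /andP[? ?] /andP[? ?]; lra.
Qed.

Let squeezed s n : 0 < s < t -> let k := Num.truncn (s / h n) in
  [/\ (k <= n)%N, pt n k <= s, s < pt n k.+1 & pt n k.+1 <= s + h n].
Proof.
move=> /andP[s0 st] k.
have sh0 : 0 <= s / h n by rewrite divr_ge0// ltW.
have /andP[k1 k2] := truncn_itv sh0.
have k1' : pt n k <= s by rewrite /pt -ler_pdivlMr.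
split => //.
- by rewrite -ltnS truncn_lt_nat// ltr_pdivrMr// -/(pt n n.+1) pt_last.
- by rewrite /pt -ltr_pdivrMr.
- by rewrite ptS lerD2r.
Qed.

Let L (s : R) : R := \int[P]_o psi s (W (tau_at s o) o) +
  \int[P]_o (\1_(A s) o * lap s (W s o)).

Let cvg_uncurry (f : R -> V -> R) (u : nat -> R) (v : nat -> V) s x :
  continuous (fun z : R * V => f z.1 z.2) ->
  u @ \oo --> s -> v @ \oo --> x -> f (u n) (v n) @[n --> \oo] --> f s x.
Proof.
move=> cf us vx; apply: (@cvg_comp _ _ _ (fun n => (u n, v n)) (fun z => f z.1 z.2) _ (nbhs (s, x))).
  exact: (@cvg_pair _ _ _ _ (nbhs s) (nbhs x) _ _ _ u v).
exact: (cf (s, x)).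
Qed.

Let cvg_started (u : nat -> R) r o : 0 <= r <= T -> (forall n, 0 <= u n <= T) ->
  u @ \oo --> r -> W (u n) o @[n --> \oo] --> W r o.
Proof.
move=> rT uT; apply: (within_continuous_cvg (f := W ^~ o)
  (@started_continuous R d T dO O P xi B BM o)).
  by rewrite /= in_itv.
by move=> n; rewrite /= in_itv; exact: uT.
Qed.

Let clap : continuous (fun z : R * V => lap z.1 z.2).
Proof.
have H := @continuous_big R 'I_d +%R 0 xpredT (@add_continuous R^o)
  (R * V)%type (index_enum 'I_d) (fun i z => g2 i z.1 z.2) (fun i _ => @cg2 i).
move=> z; apply: (@continuousM R _ (cst 2^-1) _ z _ (H z)).
exact: cst_continuous.
Qed.

(** Dominated convergence over the sample space, applied separately to the drift and to the
    diffusion coefficient of the cell containing [s]. *)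
Let coef_cvg s : 0 < s < t ->
  drift n (Num.truncn (s / h n)) + diffusion n (Num.truncn (s / h n))
    @[n --> \oo] --> L s.
Proof.
move=> st; pose k n := Num.truncn (s / h n).
have kP n := squeezed n st.
have kn n : (k n <= n)%N by have [] := kP n.
have /andP[s0 s1] := st.
have sT : s <= T by rewrite (le_trans _ tT)// ltW.
have cpt : pt n (k n) @[n --> \oo] --> s.
  apply: (@squeeze_h _ _ 1) => n; have [_ k1 k2 k3] := kP n.
  by rewrite mul1r ler_norml; rewrite ptS in k2; apply/andP; split; lra.
have cptS : pt n (k n).+1 @[n --> \oo] --> s.
  apply: (@squeeze_h _ _ 1) => n; have [_ k1 k2 k3] := kP n.
  by rewrite mul1r ler_norml; rewrite ptS in k2 k3 *; apply/andP; split; lra.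
have ptn n : 0 <= pt n (k n) <= T by rewrite pt_ge0 ptT// ltnW// ltnS.
apply: cvgD.
  have mf n := mdrift (kn n).
  have [||_ _] := @cvg_Rintegral_bounded _ O R P setT (fun n o =>
    (phi (pt n (k n).+1) (X n (k n) o) - phi (pt n (k n)) (X n (k n) o)) / h n)
    (fun o => psi s (W (tau_at s o) o)) M measurableT mf.
  - by move=> n o _; exact: driftM.
  - move=> o _.
    (* By the mean value theorem the difference quotient is [psi] at an intermediate time [th n],
       evaluated at the path position of time [rho n]. These times converge to [s] and to the
       stopped time at [s]. *)
    have /choice[th thP] : forall n, exists c, pt n (k n) < c < pt n (k n).+1 /\
        phi (pt n (k n).+1) (X n (k n) o) - phi (pt n (k n)) (X n (k n) o) =
        psi c (X n (k n) o) * h n.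
      move=> n; have [] := @phi_increment (pt n (k n)) (pt n (k n).+1) (X n (k n) o) (pt_ge0 n (k n)) _ _.
      - by rewrite ptS ltrDl.
      - by apply: pt_le; rewrite ltnS.
      by move=> c c1 cE; exists c; split => //; rewrite cE ptS addrAC subrr add0r.
    have /choice[rho rhoP] : forall n, exists r, 0 <= r <= T /\ (X n (k n) o = W r o /\
        `|r - tau_at (pt n (k n)) o| <= h n).
      move=> n; have /andP[_ kT] := ptn n.
      have [r r1 r2] := grid_stopped_near xi T0 BM cG ndG rcG (h_gt0 n) o kT.
      by exists r.
    rewrite (_ : (fun n => _) = fun n => psi (th n) (W (rho n) o)); last first.
      apply/funext => n; have [_ ->] := thP n.
      by have [_ [-> _]] := rhoP n; rewrite mulfK// gt_eqF.
    apply: cvg_uncurry => //.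
      apply: (@squeeze_h _ _ 1) => n; have [/andP[th1 th2] _] := thP n.
      have [_ k1 k2 k3] := kP n; rewrite mul1r ler_norml; rewrite ptS in k2 k3 th2.
      by apply/andP; split; lra.
    apply: cvg_started.
    - have /andP[-> t2] := stopping_itv xi B G o (ltW s0) sT.
      exact: le_trans sT.
    - by move=> n; have [] := rhoP n.
    apply: (@squeeze_h _ _ 2) => n; have [_ [_ r1]] := rhoP n.
    have [_ k1 k2 k3] := kP n.
    have /andP[l1 l2] := stopping_lipschitz xi B G o (pt_ge0 n (k n)) k1 sT.
    move: r1; rewrite !ler_norml => /andP[r1 r2]; rewrite ptS in k2.
    by apply/andP; split; lra.
  exact.
have mf n : measurable_fun setT (fun o =>
    \1_(A (pt n (k n).+1)) o * lap (pt n (k n).+1) (W (pt n (k n)) o)).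
  by apply: mdiffusion => //; rewrite ltnS.
have [||_ _] := @cvg_Rintegral_bounded _ O R P setT (fun n o =>
  \1_(A (pt n (k n).+1)) o * lap (pt n (k n).+1) (W (pt n (k n)) o))
  (fun o => \1_(A s) o * lap s (W s o)) (d%:R * M) measurableT mf.
- move=> n o _; apply: indicM => x; by apply: lapM; rewrite pt_ge0 pt_le// ltnS kn.
- move=> o _; apply: cvgM; last first.
    apply: cvg_uncurry => //.
    by apply: cvg_started => //; rewrite ltW.
  have sT' : s \in `[0, T] by rewrite in_itv/= ltW.
  (* If the path is alive at [s], tau lies strictly beyond [s], hence eventually beyond the right
     end points. If it is dead at [s], it is dead at every right end point, since these exceed
     [s]. *)
  have [oA|oA] := boolP (o \in A s).
    have H : (s%:E < hitting_time T G (W ^~ o))%E.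
      by apply/(lt_hitting_time cG ndG rcG sT' (@started_continuous R d T dO O P xi B BM o)); exact: set_mem oA.
    have [r sr rH] : exists2 r, s < r & (r%:E <= hitting_time T G (W ^~ o))%E.
      move: H; case: (hitting_time _ _ _) => [r| |]// H; first by exists r.
      by exists (s + 1); rewrite ?ltrDl// leey.
    rewrite indicE oA; apply: cvg_near_cst.
    have : \forall n \near \oo, pt n (k n).+1 < r.
      exact: (cvgr_lt s cptS).
    apply: filterS => n nr; rewrite indicE mem_set//.
    apply/(lt_hitting_time cG ndG rcG _ (@started_continuous R d T dO O P xi B BM o)).
      by apply: pt_itv; rewrite ltnS.
    by rewrite (lt_le_trans _ rH)// lte_fin.
  rewrite indicE (negbTE oA); apply: cvg_near_cst; apply: nearW => n.
  rewrite indicE memNset// => H; move/negP : oA; apply; apply/mem_set.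
  by apply: aliveS H; have [_ _ /ltW] := kP n.
exact.
Qed.

(** In the bound of [grid_total] the total change converges to the left-hand side, the sum to the
    integral of [L], and the bound itself to 0. *)
Theorem dynkin_formula :
  [/\ measurable_fun `]0, t[ L, (@lebesgue_measure R).-integrable `]0, t[ (EFin \o L) &
  \int[P]_o phi t (W (tau_at t o) o) - \int[P]_o phi 0 (W 0 o) =
  \int[lebesgue_measure]_(s in `]0, t[) L s].
Proof.
have [mL iL cL] := @riemann_sum_cvg R t (M + d%:R * M)
  (fun n k => drift n k + diffusion n k) L t0 coef_bound coef_cvg.
split => //.
have cE : E n n.+1 - E n 0 @[n --> \oo] -->
    \int[P]_o phi t (W (tau_at t o) o) - \int[P]_o phi 0 (W 0 o).
  apply: cvgB; last first.
    by apply: cvg_near_cst; apply: nearW => n; rewrite /E /pt mul0r.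
  rewrite /E; under eq_fun do rewrite pt_last.
  have mf n : measurable_fun setT (fun o => phi t (X n n.+1 o)).
    by apply: measurableT_comp => //; exact: mX.
  have [||_ _] := @cvg_Rintegral_bounded _ O R P setT (fun n o => phi t (X n n.+1 o))
    (fun o => phi t (W (tau_at t o) o)) M measurableT mf.
  - by move=> n o _; apply: phiM; rewrite lexx ltW.
  - move=> o _; apply: (cvg_comp _ (phi t)); last exact: cphi.
    have /choice[rho rhoP] : forall n, exists r, 0 <= r <= T /\ (X n n.+1 o = W r o /\
        `|r - tau_at t o| <= h n).
      move=> n; have kT := @ptT n n.+1 (leqnn _).
      have [r r1 r2] := grid_stopped_near xi T0 BM cG ndG rcG (h_gt0 n) o kT.
      by exists r; split => //; rewrite -/(pt n n.+1) pt_last in r2.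
    rewrite (_ : (fun n => _) = fun n => W (rho n) o); last first.
      by apply/funext => n; have [_ []] := rhoP n.
    apply: cvg_started.
    - have /andP[-> t2] := stopping_itv xi B G o (ltW t0) tT.
      exact: le_trans tT.
    - by move=> n; have [] := rhoP n.
    by apply: (@squeeze_h _ _ 1) => n; have [_ [_ r1]] := rhoP n; rewrite mul1r.
  exact.
apply/eqP; rewrite -subr_eq0; apply/eqP.
have c0 : E n n.+1 - E n 0 - \sum_(k < n.+1) (drift n k + diffusion n k) * h n
    @[n --> \oo] --> (\int[P]_o phi t (W (tau_at t o) o) - \int[P]_o phi 0 (W 0 o) -
      \int[lebesgue_measure]_(s in `]0, t[) L s : R).
  exact: cvgB cE cL.
have c1 : E n n.+1 - E n 0 - \sum_(k < n.+1) (drift n k + diffusion n k) * h n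
    @[n --> \oo] --> (0 : R); last exact: cvg_unique c0 c1.
apply: (@norm_cvg0 R R^o).
apply: (@squeeze_cvgr _ _ _ _ (cst 0) (fun n =>
    (heat_constant R d * M * t) * Num.sqrt (h n) + d%:R * M * h n)).
- by apply: nearW => n; rewrite normr_ge0/=; exact: grid_total.
- exact: cvg_cst.
- rewrite -[X in _ --> X](_ : heat_constant R d * M * t * Num.sqrt 0 + d%:R * M * 0 = 0).
    apply: cvgD; apply: cvgM; try exact: cvg_cst; last exact: h_cvg0.
    by apply: (cvg_comp _ _ h_cvg0); exact: sqrt_continuous.
  by rewrite sqrtr0 !mulr0 addr0.
Qed.

End dynkin.

(** * Compactly supported space-time test functions and their bounds *)

Section test_functions.
Context (R : realType) (d : nat).
Local Notation V := 'rV[R]_d.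
Implicit Types f : R -> V -> R.

Lemma is_derive_along (W : normedModType R) (f : W -> R) (x v : W) (a : R) :
  derivable f (x + a *: v) v ->
  is_derive a (1 : R) (fun b => f (x + b *: v)) ('D_v f (x + a *: v)).
Proof.
move=> df; have E : (fun h : R => h^-1 *: ((f \o (fun b => x + b *: v)) \o shift a) (h *: (1 : R)) -
    h^-1 *: (f (x + a *: v))) = fun h => h^-1 *: ((f \o shift (x + a *: v)) (h *: v)) - h^-1 *: f (x + a *: v).
  by apply/funext => h /=; rewrite /shift /= [h *: 1]mulr1 scalerDl addrCA addrA [h *: v + x]addrC.
have E' : (fun h : R => h^-1 *: (((fun b => f (x + b *: v)) \o shift a) (h *: (1 : R)) - f (x + a *: v))) =
    fun h => h^-1 *: ((f \o shift (x + a *: v)) (h *: v) - f (x + a *: v)).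
  by apply/funext => h; rewrite !scalerBr; move: E => /(congr1 (fun F => F h)).
by apply: DeriveDef; rewrite ?/derivable ?/derive E'.
Qed.

Lemma continuous_section f s : continuous (fun z : R * V => f z.1 z.2) ->
  continuous (f s).
Proof.
move=> cf x; apply: (@continuous_comp _ _ _ (fun x => (s, x)) (fun z => f z.1 z.2)).
  apply: (@cvg_pair _ _ _ (nbhs x) (nbhs s) (nbhs x) _ _ _ (cst s) id); [exact: cvg_cst|exact: cvg_id].
exact: (cf (s, x)).
Qed.

Lemma spacetime_Ck_section n f s : spacetime_Ck n f -> Ck n (f s).
Proof.
elim: n f => [|n IH] f /= [cf].
  by move=> _; split => //; exact: continuous_section.
move=> [dt ct dx]; split; first exact: continuous_section.
by move=> i; have [di ci] := dx i; split; [move=> x; exact: di|exact: (IH (space_partial i f))].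
Qed.

Lemma spacetime_CkW n f : spacetime_Ck n f -> continuous (fun z : R * V => f z.1 z.2).
Proof. by case: n => [|n] []. Qed.

Variables (t : R) (phi : R -> V -> R).
Hypothesis t0 : 0 <= t.
Hypothesis tphi : Cc_infty_upto t phi.

(** The projection to space of the compact space-time support: one compact set that serves all times
    in [0, t]. *)
Definition spatial_support : set V :=
  snd @` closure [set z : R * V | z.1 \in `[0, t] /\ phi z.1 z.2 != 0].

Lemma spatial_support_compact : compact spatial_support.
Proof.
apply: continuous_compact; last exact: tphi.2.
by apply: continuous_subspaceT => z; exact: (@cvg_snd _ _ (nbhs z.1) (nbhs z.2)).
Qed.

Lemma spatial_support_closed : closed spatial_support.
Proof. by apply: compact_closed; [exact: norm_hausdorff|exact: spatial_support_compact]. Qed.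

Lemma vanish_off_support s x : s \in `[0, t] -> ~ spatial_support x -> phi s x = 0.
Proof.
move=> st xK; apply: contrapT => /eqP fx; apply: xK; exists (s, x) => //.
exact: subset_closure.
Qed.

Lemma space_partial_vanish (D : set R) f i :
  (forall s x, D s -> ~ spatial_support x -> f s x = 0) ->
  forall s x, D s -> ~ spatial_support x -> space_partial i f s x = 0.
Proof.
move=> f0 s x st xK; have : \near x, ~ spatial_support x.
  by apply: open_nbhs_nbhs; split => //; exact/closed_openC/spatial_support_closed.
move=> nx; rewrite /space_partial /partial.
rewrite (@near_eq_derive _ _ _ (f s) (cst 0)) ?derive_cst//.
by apply: filterS nx => y; exact: f0.
Qed.

(** The values of [phi] outside [0, t] are unconstrained, so the neighbourhood argument works at
    interior times; the two end points are null for the time integral. *)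
Lemma time_partial_vanish s x : s \in `]0, t[ -> ~ spatial_support x ->
  time_partial phi s x = 0.
Proof.
move=> st xK; rewrite /time_partial derive1E (@near_eq_derive _ _ _ _ (cst 0)) ?derive_cst//.
have := near_in_itvoo st; apply: filterS => r rt.
by apply: vanish_off_support => //; exact: subset_itv_oo_cc rt.
Qed.

Lemma bounded_on_strip (D : set R) f : D `<=` `[0, t] ->
  continuous (fun z : R * V => f z.1 z.2) ->
  (forall s x, D s -> ~ spatial_support x -> f s x = 0) ->
  exists2 M, 0 <= M & forall s x, D s -> `|f s x| <= M.
Proof.
move=> Dt cf f0.
have cK : compact ((fun z : R * V => f z.1 z.2) @` (`[0, t]%classic `*` spatial_support)).
  apply: continuous_compact; first exact: continuous_subspaceT.
  by apply: compact_setX; [exact: segment_compact|exact: spatial_support_compact].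
have [M [_ HM]] := @compact_bounded R R^o _ cK.
have M1 : M < `|M| + 1 by rewrite (le_lt_trans (ler_norm M))// ltrDl.
exists (`|M| + 1) => // s x Ds; have [xK|xK] := pselect (spatial_support x).
  by apply: (HM _ M1); exists (s, x) => //; split => //; exact: Dt.
by rewrite f0// normr0.
Qed.

Lemma Cc_infty_section f (D : set R) : D `<=` `[0, t] ->
  (forall n, spacetime_Ck n f) ->
  (forall s x, D s -> ~ spatial_support x -> f s x = 0) ->
  forall s, D s -> Cc_infty (f s).
Proof.
move=> Dt cf f0 s Ds; split; first by move=> n; exact: spacetime_Ck_section.
apply: (subclosed_compact _ spatial_support_compact); first exact: closed_closure.
have -> : spatial_support = closure spatial_support.
  exact/closure_id/spatial_support_closed.
apply: closure_subset => x /= /eqP fx; apply: contrapT => xK; apply: fx.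
exact: f0.
Qed.

Lemma test_smooth n : spacetime_Ck n phi. Proof. exact: tphi.1. Qed.

Lemma test_space_smooth n i : spacetime_Ck n (space_partial i phi).
Proof. by have [_ [_ _ /(_ i)[]]] := test_smooth n.+1. Qed.

Lemma test_space2_smooth n i j : spacetime_Ck n (space_partial j (space_partial i phi)).
Proof. by have [_ [_ _ /(_ j)[]]] := test_space_smooth n.+1 i. Qed.

Lemma test_space3_smooth n i j k :
  spacetime_Ck n (space_partial k (space_partial j (space_partial i phi))).
Proof. by have [_ [_ _ /(_ k)[]]] := test_space2_smooth n.+1 i j. Qed.

Lemma test_time_smooth n : spacetime_Ck n (time_partial phi).
Proof. by have [_ []] := test_smooth n.+1. Qed.

Lemma test_Cc_infty s : s \in `[0, t] -> Cc_infty (phi s).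
Proof.
apply: (@Cc_infty_section phi `[0, t]%classic) => //; first exact: test_smooth.
by move=> r x; exact: vanish_off_support.
Qed.

Lemma test_time_Cc_infty s : s \in `]0, t[ -> Cc_infty (time_partial phi s).
Proof.
apply: (@Cc_infty_section _ `]0, t[%classic); first exact: subset_itv_oo_cc.
  exact: test_time_smooth.
by move=> r x; exact: time_partial_vanish.
Qed.

Lemma space_derivative_along f i s x (a : R) : spacetime_Ck 1 f ->
  is_derive a (1 : R) (fun b => f s (x + b *: basis_vec R i))
    (space_partial i f s (x + a *: basis_vec R i)).
Proof. by move=> [_ [_ _ /(_ i)[df _]]]; apply: is_derive_along. Qed.

Lemma test_bounds : exists2 M, 0 <= M &
  [/\ forall s x, 0 <= s <= t -> `|phi s x| <= M,
      forall i s x, 0 <= s <= t -> `|space_partial i (space_partial i phi) s x| <= M,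
      forall i j s x, 0 <= s <= t ->
        `|space_partial j (space_partial i (space_partial i phi)) s x| <= M &
      forall s x, 0 < s < t -> `|time_partial phi s x| <= M].
Proof.
have v0 s x : `[0, t]%classic s -> ~ spatial_support x -> phi s x = 0.
  exact: vanish_off_support.
have v1 i := space_partial_vanish i v0.
have v2 i := space_partial_vanish i (v1 i).
have v3 i j := space_partial_vanish j (v2 i).
have [M0 M00 H0] := bounded_on_strip (@subset_refl _ _) (spacetime_CkW (test_smooth 0)) v0.
have [M1 M10 H1] := bounded_on_strip (@subset_itv_oo_cc _ _ 0 t)
  (spacetime_CkW (test_time_smooth 0)) time_partial_vanish.
have /choice[M2 H2] : forall i, exists M, 0 <= M /\ forall s x, s \in `[0, t] ->
    `|space_partial i (space_partial i phi) s x| <= M.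
  move=> i; have [M ? ?] := bounded_on_strip (@subset_refl _ _) (spacetime_CkW (test_space2_smooth 0 i i)) (v2 i).
  by exists M.
have /choice[M3 H3] : forall ij : 'I_d * 'I_d, exists M, 0 <= M /\ forall s x, s \in `[0, t] ->
    `|space_partial ij.2 (space_partial ij.1 (space_partial ij.1 phi)) s x| <= M.
  move=> [i j]; have [M ? ?] := bounded_on_strip (@subset_refl _ _) (spacetime_CkW (test_space3_smooth 0 i i j)) (v3 i j).
  by exists M.
have S2 : 0 <= \sum_i M2 i by apply: sumr_ge0 => i _; have [] := H2 i.
have S3 : 0 <= \sum_ij M3 ij by apply: sumr_ge0 => i _; have [] := H3 i.
exists (M0 + M1 + \sum_i M2 i + \sum_ij M3 ij); first by rewrite !addr_ge0.
split.
- move=> s x st; have := H0 s x; rewrite /= in_itv/= => /(_ st); lra.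
- move=> i s x st; have [_ /(_ s x)] := H2 i; rewrite in_itv/= => /(_ st).
  have : M2 i <= \sum_i M2 i.
    by rewrite (bigD1 i)//= lerDl sumr_ge0// => j _; have [] := H2 j.
  lra.
- move=> i j s x st; have [_ /(_ s x)] := H3 (i, j); rewrite in_itv/= => /(_ st).
  have : M3 (i, j) <= \sum_ij M3 ij.
    by rewrite (bigD1 (i, j))//= lerDl sumr_ge0// => k _; have [] := H3 k.
  by move=> /=; lra.
- move=> s x st; have := H1 s x; rewrite /= in_itv/= => /(_ st); lra.
Qed.

(** A bound on third derivatives and the mean value theorem give the Lipschitz condition under which
    the heat expansion holds. *)
Lemma laplacian_lipschitz (M : R) i j s x a :
  (forall y, `|space_partial j (space_partial i (space_partial i phi)) s y| <= M) ->
  `|space_partial i (space_partial i phi) s (x + a *: basis_vec R j) -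
    space_partial i (space_partial i phi) s x| <= M * `|a|.
Proof.
move=> H.
pose f b := space_partial i (space_partial i phi) s (x + b *: basis_vec R j).
have df (b : R) : is_derive b (1 : R) (fun c => f c - f 0)
    (space_partial j (space_partial i (space_partial i phi)) s (x + b *: basis_vec R j)).
  rewrite -[X in is_derive _ _ _ X]subr0; apply: is_deriveB.
  exact: (space_derivative_along j s x b (test_space2_smooth 1 i i)).
have := @mean_value_bound R _ _ M a df.
by rewrite /f scale0r addr0; apply => //; rewrite subrr.
Qed.

End test_functions.

(** * Path space and the law of the stopped path *)

Section canonical_process.
Context (R : realType) (d : nat) (T : R).
Local Notation V := 'rV[R]_d.
Hypothesis T0 : 0 < T.

Lemma canonical_process_continuous (p : path_space d T) :
  {within `[0, T], continuous (fun s => canonical_process s p)}.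
Proof. by apply/subspace_valL_continuousP'; exact: cts_fun. Qed.

Lemma canonical_processE (s : R) (sT : s \in (`[0, T]%classic : set R)) (p : path_space d T) :
  canonical_process s p = p (exist _ s sT).
Proof.
rewrite /canonical_process.
by have := congr1 (fun f => f (exist _ s sT)) (valLK (0 : V) (p : `[0, T]%classic -> V)).
Qed.

Lemma canonical_process_measurable (s : R) : s \in `[0, T] ->
  measurable_fun setT (canonical_process s : path_space d T -> V).
Proof.
move=> sT; have sT' : s \in (`[0, T]%classic : set R) by exact: mem_set.
apply: (measurability (@open V)) => // _ [U oU <-]; rewrite setTI.
apply: sub_sigma_algebra.
rewrite (_ : _ @^-1` _ = (fun p : path_space d T =>
   (p : `[0, T]%classic -> V) : {uniform `[0, T]%classic -> V}) @^-1`
   [set g | U (g (exist _ s sT'))]); last first.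
  by apply/seteqP; split => p /=; rewrite (@canonical_processE _ sT' p).
rewrite /path_open.
apply: (@open_comp (initial_topology (fun p : path_space d T =>
   (p : `[0, T]%classic -> V) : {uniform `[0, T]%classic -> V}))).
  by move=> p _; exact: initial_continuous.
rewrite openE => g /= Ug.
have /nbhs_ballP[e /= e0 He] : nbhs (g (exist _ s sT')) U by exact: open_nbhs_nbhs.
apply/uniform_nbhs; exists [set xy | ball xy.1 e xy.2]; split.
  exact: entourage_ball (PosNum e0).
by move=> h /= H; apply: He; exact: H.
Qed.

(** Composing with the projection onto [0, T] extends each path continuously to all real times, the
    form to which the joint measurability lemma applies. *)
Definition clamp (s : R) : R := Num.max 0 (Num.min s T).

Lemma clamp_itv s : clamp s \in `[0, T].
Proof. by rewrite in_itv/= /clamp le_max lexx/= ge_max (ltW T0) ge_min lexx orbT. Qed.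

Lemma clamp_id s : s \in `[0, T] -> clamp s = s.
Proof. by rewrite in_itv/= /clamp => /andP[s0 sT]; rewrite min_l// max_r. Qed.

Lemma clamp_continuous : continuous clamp.
Proof.
move=> s; apply: (@continuous_max _ _ (cst 0) (id \min cst T)).
  exact: cst_continuous.
apply: (@continuous_min _ _ id (cst T)); [by []|exact: cst_continuous].
Qed.

Lemma clamped_process_continuous (p : path_space d T) :
  continuous (fun s => canonical_process (clamp s) p).
Proof.
move=> s; have := @canonical_process_continuous p.
move=> /subspace_continuousP/(_ (clamp s) (clamp_itv s)) H.
move=> U /H; rewrite /= /within/= => HU.
have H1 : \forall r \near s, clamp r \in `[0, T] ->
  U (canonical_process (clamp r) p) by exact: (@clamp_continuous s _ HU).
suff H2 : \forall r \near s, U (canonical_process (clamp r) p) by exact: H2.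
by apply: filterS H1 => r; apply; exact: clamp_itv.
Qed.

Lemma clamped_process_measurable :
  measurable_fun setT (fun z : measurableTypeR R * path_space d T =>
    canonical_process (clamp z.1) z.2).
Proof.
apply: (measurable_uncurry_rV (f := fun s p => canonical_process (clamp s) p)).
  exact: clamped_process_continuous.
by move=> s; apply: canonical_process_measurable; exact: clamp_itv.
Qed.

End canonical_process.

Section stopped_law.
Context (R : realType) (d : nat) (T : R) (dO : measure_display)
  (O : measurableType dO).
Local Notation V := 'rV[R]_d.
Variables (P : probability O R) (xi : O -> V) (B : R -> O -> V) (G : R -> set V)
  (Y : O -> path_space d T).
Hypothesis T0 : 0 < T.
Hypothesis BM : standard_brownian_motion P B.
Hypothesis cG : closed_family T G.
Hypothesis ndG : nondecreasing_family T G.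
Hypothesis rcG : right_continuous_family T G.
Local Notation W := (started xi B).
Local Notation A := (survival xi B G).
Hypothesis YE : forall o t, t \in `[0, T] ->
  canonical_process t (Y o) = W (stopping T xi B G t o) o.

Let cW o : {within `[0, T], continuous (W ^~ o)}.
Proof. exact: (@started_continuous R d T dO O P xi B BM o). Qed.

Lemma stopped_survival s o : s \in `[0, T] -> o \in A s ->
  canonical_process s (Y o) = W s o.
Proof.
move=> sT oA; have := sT; rewrite in_itv/= => /andP[s0 s1].
by rewrite YE// (stoppingE BM cG ndG rcG).
Qed.

(** A dead path rests at its hitting point, which lies in [G] at the hitting time and hence, by
    monotonicity, in [G s]. Survival can therefore be read off the position at time [s] alone. *)
Lemma stopped_notin s o : s \in `[0, T] ->
  (o \in A s) = (canonical_process s (Y o) \in ~` G s).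
Proof.
move=> sT; have := sT; rewrite in_itv/= => /andP[s0 s1].
have [oA|nA] := boolP (o \in A s).
  rewrite stopped_survival//; apply/esym/mem_set.
  by have := set_mem oA; apply; rewrite in_itv/= s0 lexx.
apply/esym/negbTE; rewrite notin_setE /= => H; apply: H.
have H : (hitting_time T G (W ^~ o) <= s%:E)%E.
  rewrite leNgt; apply: contra nA => /(lt_hitting_time cG ndG rcG sT (@cW o)) H.
  exact: mem_set.
have [r [rs rE Gr _]] := hitting_time_le cG ndG rcG sT (@cW o) H.
rewrite YE// /stopping rE min_r; last first.
  by rewrite lee_fin; move: rs; rewrite in_itv/= => /andP[].
move: (rs); rewrite in_itv/= => /andP[r0 rs'].
by apply: ndG Gr => //; rewrite in_itv/= r0 (le_trans rs').
Qed.

Lemma stopped_alive s o : s \in `[0, T] ->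
  alive G (fun r => canonical_process r (Y o)) s <-> o \in A s.
Proof.
move=> sT; have := sT; rewrite in_itv/= => /andP[s0 s1]; split.
  move=> H; rewrite stopped_notin//; apply/mem_set; apply: H.
  by rewrite in_itv/= s0 lexx.
move=> oA r rs; have := rs; rewrite in_itv/= => /andP[r0 rs'].
have rT : r \in `[0, T] by rewrite in_itv/= r0 (le_trans rs').
suff : o \in A r by rewrite stopped_notin// => /set_mem.
by apply/mem_set; apply: aliveS (set_mem oA).
Qed.

Lemma stopped_hitting_le s o : s \in `[0, T] ->
  (hitting_time T G (fun r => canonical_process r (Y o)) <= s%:E)%E = (o \notin A s).
Proof.
move=> sT; rewrite leNgt; congr (~~ _); apply/idP/idP.
  move/(lt_hitting_time cG ndG rcG sT (@canonical_process_continuous R d T (Y o))).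
  by move/(stopped_alive o sT).
by move/(stopped_alive o sT)/(lt_hitting_time cG ndG rcG sT (@canonical_process_continuous R d T (Y o))).
Qed.

(** At its own hitting time the stopped path is in the set, so the underlying path is already dead
    there; from then on the stopped path is constant. *)
Lemma stopped_hitting_value s o : s \in `[0, T] -> o \notin A s ->
  canonical_process (fine (hitting_time T G (fun r => canonical_process r (Y o)))) (Y o) =
  canonical_process s (Y o).
Proof.
move=> sT nA; have H := nA; rewrite -(stopped_hitting_le o sT) in H.
have [r [rs rE Gr _]] := hitting_time_le cG ndG rcG sT (@canonical_process_continuous R d T (Y o)) H.
move: (rs) (sT); rewrite !in_itv/= => /andP[r0 rs'] /andP[s0 s1].
have rT : r \in `[0, T] by rewrite in_itv/= r0 (le_trans rs').
rewrite rE /= !YE//; congr (W _ o); apply/esym.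
apply: (stopping_dead BM cG ndG rcG) => //.
by rewrite stopped_notin// notin_setE => H'; exact: H'.
Qed.

End stopped_law.

(** * Existence of a jointly measurable density of the surviving mass *)

Section rational_boxes.
Context (R : realType) (d : nat).
Local Notation V := 'rV[R]_d.

Definition rational_box (ab : {ffun 'I_d -> rat * rat}) : set V :=
  [set v | forall i, ratr (ab i).1 < v ord0 i < ratr (ab i).2].

(** A countable pi-system generating the Borel sets; countability lets an identity that holds at
    almost every time for each box hold at almost every time for all Borel sets at once. The whole
    space is included to compare total masses. *)
Definition rational_boxes : set_system V :=
  [set A | exists o : option {ffun 'I_d -> rat * rat},
    A = if o is Some ab then rational_box ab else setT].

Lemma rational_boxesI : setI_closed rational_boxes.
Proof.
move=> _ _ [[ab|] ->] [[ab'|] ->]; rewrite ?setIT ?setTI; last by exists None.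
- exists (Some [ffun i => (Num.max (ab i).1 (ab' i).1, Num.min (ab i).2 (ab' i).2)]).
  apply/seteqP; split => v /=.
    move=> [H H'] i; rewrite ffunE/=.
    have /andP[a b] := H i; have /andP[a' b'] := H' i.
    by case: (leP (ab i).1 (ab' i).1); case: (leP (ab i).2 (ab' i).2) => _ _; rewrite ?a ?b ?a' ?b'.
  move=> H; split => i; have := H i; rewrite ffunE/= => /andP[H1 H2];
    apply/andP; split; (apply: (le_lt_trans _ H1) || apply: (lt_le_trans H2 _));
    by rewrite ler_rat ?le_max ?ge_min lexx ?orbT.
- by exists (Some ab).
- by exists (Some ab').
Qed.

Lemma rational_boxes_measurable : rational_boxes `<=` measurable.
Proof.
move=> _ [[ab|] ->] //.
rewrite (_ : rational_box ab = \bigcap_(i in [set: 'I_d])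
    ((fun v : V => v ord0 i) @^-1` `]ratr (ab i).1, ratr (ab i).2[)).
  apply: countable_bigcap_measurable => i _; rewrite -[X in measurable X]setTI.
  by apply: (measurable_coord i) => //; exact: measurable_itv.
apply/seteqP; split => v /= H i; first by move=> _; rewrite /= in_itv/=; exact: H.
by have := H i I; rewrite /= in_itv.
Qed.

Lemma measurable_rational_boxes : (measurable : set_system V) = <<s rational_boxes >>.
Proof.
apply/seteqP; split; last first.
  by apply: smallest_sub; [exact: sigma_algebra_measurable|exact: rational_boxes_measurable].
apply: smallest_sub; first exact: smallest_sigma_algebra.
move=> U oU; rewrite (open_rV_bigcup_rat oU) bigcup_mkcond.
apply: (@countable_bigcupT_measurable _ (g_sigma_algebraType rational_boxes)).
  exact/countableP.
move=> q; case: ifPn => // _.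
have [q0|q0] := ltP 0 q.2; last first.
  rewrite (_ : ball _ _ = set0); first exact: (@measurable0 _ (g_sigma_algebraType rational_boxes)).
  by apply/seteqP; split => v //= -[]; rewrite ltr0q ltNge q0.
apply: sub_sigma_algebra; exists (Some [ffun i => (q.1 i - q.2, q.1 i + q.2)]).
apply/seteqP; split => v /=.
  move=> [_ H] i; have := H ord0 i; rewrite mxE ffunE/= /ball/= ltr_distlC.
  by rewrite rmorphB rmorphD/= ltrBlDr -ltrBlDl.
move=> H; split; first by rewrite ltr0q.
move=> i j; rewrite ord1 mxE /ball/= ltr_distlC; have := H j.
by rewrite ffunE/= rmorphB rmorphD.
Qed.

Lemma eq_measure_rational_boxes (m1 m2 : {measure set V -> \bar R}) :
  (m1 setT < +oo)%E ->
  (forall o : option {ffun 'I_d -> rat * rat},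
    let A := if o is Some ab then rational_box ab else setT in m1 A = m2 A) ->
  forall A, measurable A -> m1 A = m2 A.
Proof.
move=> m1oo H; apply: (measure_unique rational_boxes (fun=> setT)) => //.
- exact: measurable_rational_boxes.
- exact: rational_boxesI.
- by move=> _; exists None.
- by rewrite bigcup_const//; exists 0%N.
- by move=> _ [p ->]; exact: (H p).
Qed.

End rational_boxes.

Section sigma_finite_product.
Context d1 d2 (T1 : measurableType d1) (T2 : measurableType d2) (R : realType).
Variables (m1 : {sigma_finite_measure set T1 -> \bar R})
  (m2 : {sigma_finite_measure set T2 -> \bar R}).
Local Open Scope ereal_scope.

(* The library's sigma-finite structure on [m1 \x m2] is not inferred: its
   canonical instance is the one for subprobability measures. *)
Definition sigma_finite_product : set (T1 * T2) -> \bar R := m1 \x m2.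

HB.instance Definition _ := Measure.on sigma_finite_product.

Let product_sigma_finite : sigma_finite setT sigma_finite_product.
Proof.
have /sigma_finiteP[F [TF ndF Foo]] := sigma_finiteT m1.
have /sigma_finiteP[K [TK ndK Koo]] := sigma_finiteT m2.
exists (fun n => F n `*` K n).
  apply/esym; rewrite -subTset => -[x y] _.
  have [[n _ Fn] [k _ Kk]] : (\bigcup_n F n) x /\ (\bigcup_n K n) y by rewrite -TF -TK.
  exists (maxn n k) => //; split => /=.
    by move: Fn; exact/subsetPset/ndF/leq_maxl.
  by move: Kk; exact/subsetPset/ndK/leq_maxr.
move=> n; have [mF Fn] := Foo n; have [mK Kn] := Koo n.
split; first exact: measurableX.
rewrite /sigma_finite_product product_measure1E// lte_mul_pinfty//.
by rewrite ge0_fin_numE.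
Qed.

HB.instance Definition _ := Measure_isSigmaFinite.Build _ _ _
  sigma_finite_product product_sigma_finite.

Lemma ae_null_xsection (C : set (T1 * T2)) : measurable C -> (m1 \x m2) C = 0 ->
  {ae m1, forall s, m2 (xsection C s) = 0}.
Proof.
move=> mC C0; have mx : measurable_fun setT (m2 \o xsection C).
  exact: measurable_fun_xsection.
have : ae_eq m1 setT (m2 \o xsection C) (cst 0).
  apply/(ae_eq_integral_abs m1 measurableT mx).
  by rewrite -[RHS]C0; apply: eq_integral => s _ /=; rewrite gee0_abs.
by apply: filterS => s /=; exact.
Qed.

End sigma_finite_product.

Section radon_nikodym.
Context d (X : measurableType d) (R : realType).
Local Open Scope ereal_scope.

Lemma radon_nikodym_density (m : {measure set X -> \bar R})
    (mu : {sigma_finite_measure set X -> \bar R}) : m setT < +oo ->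
  (forall A, measurable A -> mu A = 0 -> m A = 0) ->
  exists f : X -> R, [/\ measurable_fun setT f, (forall x, (0 <= f x)%R) &
    forall A, measurable A -> m A = \int[mu]_(x in A) (f x)%:E].
Proof.
move=> moo mu0.
pose nu : {finite_measure set X -> \bar R} := mfrestr measurableT moo.
have nuE A : nu A = m A by rewrite /nu /= /mfrestr /mrestr setIT.
have numu : nu `<< mu.
  by apply/null_content_dominatesP => A mA A0; rewrite nuE; exact: mu0.
have [f [f0 ffin fint fE]] := radon_nikodym_sigma_finite numu.
exists (fine \o f); split.
- by apply: measurableT_comp => //; exact: measurable_int fint.
- by move=> x /=; rewrite fine_ge0.
- move=> A mA; rewrite -nuE (fE A mA); apply: eq_integral => x _.
  by rewrite /= fineK.
Qed.

End radon_nikodym.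

Section density_measure.
Context d (X : measurableType d) (R : realType)
  (mu : {measure set X -> \bar R}) (f : X -> R).
Hypothesis mf : measurable_fun setT f.
Hypothesis f0 : forall x, 0 <= f x.
Local Open Scope ereal_scope.

(** The two proofs are arguments so that the measure structure, which depends on them, can be
    attached to the term. *)
Definition density_measure (_ : measurable_fun setT f) (_ : forall x, (0 <= f x)%R)
  (A : set X) : \bar R := \int[mu]_(x in A) (f x)%:E.

Let density0 : density_measure mf f0 set0 = 0.
Proof. by rewrite /density_measure integral_set0. Qed.

Let density_ge0 A : 0 <= density_measure mf f0 A.
Proof. by apply: integral_ge0 => x _; rewrite lee_fin. Qed.

Let density_sigma_additive : semi_sigma_additive (density_measure mf f0).
Proof.
move=> A mA tA mUA; rewrite /density_measure ge0_integral_bigcup//.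
- apply: is_cvg_ereal_nneg_natsum_cond => n _ _.
  by apply: integral_ge0 => x _; rewrite lee_fin.
- by apply/measurable_EFinP; exact: measurable_funTS.
- by move=> x _; rewrite lee_fin.
Qed.

HB.instance Definition _ := isMeasure.Build _ _ _ (density_measure mf f0)
  density0 density_ge0 density_sigma_additive.

End density_measure.

Section alive_density_exists.
Context (R : realType) (d : nat) (T : R).
Local Notation V := 'rV[R]_d.
Local Notation leb := (@lebesgue_measure_rV R d).
Local Notation leb1 := (@lebesgue_measure R).
Variables (mu : probability (path_space d T) R) (G : R -> set V).
Hypothesis T0 : 0 < T.
Hypothesis cG : closed_family T G.
Hypothesis ndG : nondecreasing_family T G.
Hypothesis rcG : right_continuous_family T G.

Definition alive_part (s : R) (A : set V) : set (path_space d T) :=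
  canonical_process s @^-1` (A `&` ~` G s).

Hypothesis alive_null : forall s A, s \in `[0, T] -> measurable A ->
  leb A = 0%E -> mu (alive_part s A) = 0%E.

Definition alive_region : set (measurableTypeR R * V) :=
  [set z | z.1 \in `[0, T] /\ ~ G z.1 z.2].

(** By right continuity and monotonicity, a point outside [G s] with s < T is outside [G q] for some
    rational q > s, so the region is a countable union of rectangles together with the slice at time
    T. *)
Lemma alive_region_measurable : measurable alive_region.
Proof.
have mGC (q : R) : q \in `[0, T] -> measurable (~` G q).
  by move=> qT; apply: measurableC; apply: closed_measurable_rV; exact: cG.
have TT : T \in `[0, T] by rewrite in_itv/= lexx ltW.
rewrite (_ : alive_region = (\bigcup_(q in [set q : rat | (ratr q : R) \in `[0, T]])
    ((`[0, ratr q[%classic : set R) `*` ~` G (ratr q))) `|` ([set T] `*` ~` G T)).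
  apply: measurableU; last by apply: measurableX; [exact: measurable_set1|exact: mGC].
  rewrite bigcup_mkcond; apply: countable_bigcupT_measurable => [|q].
    exact/countableP.
  case: ifPn => // /[!inE] qT; apply: measurableX; last exact: mGC.
  exact: measurable_itv.
apply/seteqP; split => [[s x] [/= sT Gx]|[s x]].
  have := sT; rewrite in_itv/= => /andP[s0]; rewrite le_eqVlt => /predU1P[sE|sltT].
    by right; split => //=; rewrite -sE.
  left; have [r [/andP[sr rT] Gr]] : exists r, s < r <= T /\ ~ G r x.
    apply: contrapT => H; apply: Gx; rewrite rcG; last by rewrite in_itv/= s0.
    move=> r /=; rewrite in_itv/= => srT; apply: contrapT => Gr; apply: H; by exists r.
  have [q] := rat_in_itvoo sr; rewrite in_itv/= => /andP[sq qr].
  have q0 : 0 <= ratr q :> R by rewrite (le_trans s0)// ltW.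
  have qT : (ratr q : R) \in `[0, T] by rewrite in_itv/= q0 (le_trans (ltW qr)).
  exists q => //; split; first by rewrite /= in_itv/= s0.
  move=> Gq; apply: Gr; apply: ndG Gq => //; last exact: ltW.
  by rewrite in_itv/= rT andbT (le_trans q0)// ltW.
move=> [[q /= qT [+ Gq]]|[/= -> GT]]; last by split.
rewrite /= in_itv/= => /andP[s0 sq]; have := qT; rewrite in_itv/= => /andP[q0 qT'].
have sT : s \in `[0, T] by rewrite in_itv/= s0 (le_trans (ltW sq)).
by split => //= Gs; apply: Gq; apply: ndG Gs => //; exact: ltW.
Qed.

Lemma alive_part_measurable s A : s \in `[0, T] -> measurable A ->
  measurable (alive_part s A).
Proof.
move=> sT mA; rewrite -[X in measurable X]setTI.
apply: canonical_process_measurable => //; apply: measurableI => //.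
by apply: measurableC; apply: closed_measurable_rV; exact: cG.
Qed.

Let Psi (z : measurableTypeR R * path_space d T) : measurableTypeR R * V :=
  (z.1, canonical_process (clamp T z.1) z.2).

Let mPsi : measurable_fun setT Psi.
Proof.
apply: measurable_fun_pair; first exact: measurable_fst.
exact: clamped_process_measurable.
Qed.

Let mE : measurable (Psi @^-1` alive_region).
Proof. by rewrite -[X in measurable X]setTI; apply: mPsi => //; exact: alive_region_measurable. Qed.

(** Lebesgue measure in time combined with the law of the position at that time, restricted to
    surviving positions. Its slices are the measures whose densities are sought. *)
Let nu : {measure set (measurableTypeR R * V) -> \bar R} :=
  pushforward_measure (mrestr (leb1 \x mu)%E mE) mPsi.

Let nuE (C : set (measurableTypeR R * V)) : measurable C ->
  nu C = (\int[leb1]_(s in `[0%R, T]) mu (alive_part s (xsection C s)))%E.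
Proof.
move=> mC; transitivity (\int[leb1]_s
    mu (xsection (Psi @^-1` C `&` Psi @^-1` alive_region) s))%E; first by [].
rewrite [RHS]integral_mkcond; apply: eq_integral => s _; rewrite patchE.
case: ifPn => [/[!inE] /= sT|/negP sT].
  congr (mu _); apply/seteqP; split => p; rewrite /xsection/= inE/= /Psi/= clamp_id//.
    by move=> [Cp [_ Gp]]; split => //; rewrite /xsection/= inE.
  by move=> [/xsectionP/= Cp Gp].
rewrite (_ : xsection _ _ = set0) ?measure0//.
apply/seteqP; split => p //; rewrite /xsection/= inE/= => -[_ [/= sT' _]].
by apply: sT; rewrite inE.
Qed.

Let nu_finite : (nu setT < +oo)%E.
Proof.
have mI : measurable (`[0, T]%classic : set (measurableTypeR R)) by exact: measurable_itv.
apply: (@le_lt_trans _ _ ((leb1 \x mu)%E (`[0, T]%classic `*` setT))).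
  apply: le_measure; rewrite ?inE//.
  - apply: measurableI; last exact: mE.
    by rewrite preimage_setT.
  - exact: measurableX.
  - by move=> [s p] [_ [/= sT _]]; split.
rewrite product_measure1E// [X in (_ * X)%E]probability_setT mule1.
by have := lebesgue_measure_itv `[0, T]; rewrite /= lte_fin T0 => ->; rewrite ltry.
Qed.

Let nu_null (C : set (measurableTypeR R * V)) : measurable C ->
  ((leb1 \x leb)%E C = 0 -> nu C = 0)%E.
Proof.
move=> mC C0; rewrite nuE// (@integral_ae_eqN _ _ _ _ _ _ (cst 0%E)) ?integral0//.
apply: filterS (ae_null_xsection mC C0) => s /= Cs sT; apply: alive_null => //.
exact: measurable_xsection.
Qed.

Let aboxes (q : option {ffun 'I_d -> rat * rat}) : set V :=
  if q is Some ab then rational_box ab else setT.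

Let maboxes q : measurable (aboxes q).
Proof. by rewrite measurable_rational_boxes; apply: sub_sigma_algebra; exists q. Qed.

(** The derivative [U] of [nu] is jointly measurable, and its slice is a density at almost every
    time. At each exceptional time a separate derivative [v s] is used; this changes the function
    only over a null set of times, so measurability up to null sets survives. *)
Theorem alive_density_exists : exists u, alive_density mu G u.
Proof.
have [U [mU U0 UE]] := @radon_nikodym_density _ _ _ nu
  (sigma_finite_product leb1 leb) nu_finite nu_null.
pose good s := forall A, measurable A ->
  (mu (alive_part s A) = \int[leb]_(x in A) (U (s, x))%:E)%E.
have mI : measurable (`[0, T]%classic : set (measurableTypeR R)) by exact: measurable_itv.
have mUs s : measurable_fun setT (fun x => U (s, x)).
  exact: (measurableT_comp mU (pair1_measurable (s : measurableTypeR R))).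
have restrictE s A : measurable A -> (\int[leb]_(x in A) (U (s, x))%:E =
    \int[leb]_x (U (s, x) * \1_A x)%:E)%E.
  move=> mA; rewrite integral_mkcond; apply: eq_integral => x _.
  by rewrite patchE indicE; case: (x \in A); rewrite ?mulr1 ?mulr0.
(* For a fixed space set, both functions of time have the same integral over every measurable time
   set, namely the [nu]-mass of the rectangle, and hence agree almost everywhere. *)
have part_ae A : measurable A -> ae_eq leb1 `[0, T]%classic
    (fun s => mu (alive_part s A)) (fun s => \int[leb]_(x in A) (U (s, x))%:E)%E.
  move=> mA; apply: ae_eq_sym.
  have mUA : measurable_fun setT
      (fun z : measurableTypeR R * V => (U z * \1_A z.2)%:E).
    apply/measurable_EFinP; apply: measurable_funM => //.
    by apply: measurableT_comp; [exact: measurable_indic|exact: measurable_snd].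
  have UA0 (z : measurableTypeR R * V) : (0 <= (U z * \1_A z.2)%:E)%E.
    by rewrite lee_fin mulr_ge0// indicE.
  have mF := @measurable_fun_fubini_tonelli_F _ _ _ _ _ leb _ mUA UA0.
  have nuI I : measurable I -> (nu (I `*` A) =
      \int[leb1]_(s in I) \int[leb]_(x in A) (U (s, x))%:E)%E.
    move=> mI'; rewrite UE; last exact: measurableX.
    rewrite integral_mkcond [RHS]integral_mkcond.
    transitivity (\int[(leb1 \x leb)%E]_z (\1_I z.1 * (U z * \1_A z.2))%:E)%E.
      apply: eq_integral => z _; rewrite patchE !indicE in_setX.
      by case: (z.1 \in I); case: (z.2 \in A); rewrite ?mul1r ?mul0r ?mulr1 ?mulr0.
    rewrite fubini_tonelli1; last 2 first.
    - apply/measurable_EFinP; apply: measurable_funM; last exact/measurable_EFinP.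
      by apply: measurableT_comp; [exact: measurable_indic|exact: measurable_fst].
    - by move=> z; rewrite lee_fin mulr_ge0 ?mulr_ge0// indicE.
    apply: eq_integral => s _; rewrite /fubini_F patchE /= restrictE// indicE.
    case: (s \in I); first by apply: eq_integral => x _; rewrite mul1r.
    by rewrite integral0_eq// => x _; rewrite mul0r.
  apply: integral_ae_eq => //.
  - apply/integrableP; split.
      rewrite (_ : (fun s => _) = fubini_F leb (fun z => (U z * \1_A z.2)%:E)).
        exact: measurable_funTS.
      by apply/funext => s; rewrite /fubini_F restrictE.
    have i0 s : (0 <= \int[leb]_(x in A) (U (s, x))%:E)%E.
      by apply: integral_ge0 => x _; rewrite lee_fin.
    under eq_integral => s _ do rewrite gee0_abs//.
    rewrite -nuI//; apply: le_lt_trans nu_finite.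
    by apply: le_measure => //; rewrite inE//; exact: measurableX.
  - apply: (eq_measurable_fun (fun s => mu (xsection (Psi @^-1` (setT `*` A) `&`
        Psi @^-1` alive_region) s))); last first.
      apply: measurable_funTS; apply: measurable_fun_xsection.
      apply: measurableI; last exact: mE.
      by rewrite -[X in measurable X]setTI; apply: mPsi => //; exact: measurableX.
    move=> s /[!inE] /= sT; congr (mu _); apply/seteqP.
    split => p; rewrite /xsection/= inE/= /Psi/= clamp_id//.
      by move=> [[_ Ap] [_ Gp]].
    by move=> [Ap Gp].
  - move=> I IT mI'; rewrite -nuI// nuE; last exact: measurableX.
    rewrite [LHS]integral_mkcond [RHS]integral_mkcond; apply: eq_integral => s _.
    rewrite !patchE; have [sI|sI] := boolP (s \in I).
      rewrite mem_set; last by apply: IT; exact: set_mem.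
      by rewrite in_xsectionX.
    case: ifPn => // _; rewrite notin_xsectionX//.
    rewrite (_ : alive_part s set0 = set0) ?measure0//.
    by apply/seteqP; split => p // [].
have good_ae : {ae leb1, forall s, `[0, T]%classic s -> good s}.
  (* The boxes are enumerated by [unpickle], so that the countable union of exceptional time sets is
     null. *)
  have boxes_ae : {ae leb1, forall s, forall n, `[0, T]%classic s ->
      if unpickle n is Some q then
      mu (alive_part s (aboxes q)) = (\int[leb]_(x in aboxes q) (U (s, x))%:E)%E
      else True}.
    apply: ae_foralln => n; case: (unpickle n) => [q|]; last exact: aeW.
    by apply: filterS (part_ae _ (maboxes q)) => s.
  move: boxes_ae; apply: (@filterS _ _ (ae_filter_ringOfSetsType (lebesgue_measure : {measure set (measurableTypeR R) -> \bar R}))) => s H sT A mA.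
  have mX : measurable_fun setT (canonical_process s : path_space d T -> V).
    exact: canonical_process_measurable.
  have mD := alive_part_measurable sT (@measurableT _ V).
  have partE C : alive_part s C = canonical_process s @^-1` C `&` alive_part s setT.
    by apply/seteqP; split => p /=; [move=> [Cp Gp]|move=> [Cp [_ Gp]]].
  rewrite partE.
  apply: (@eq_measure_rational_boxes R d (pushforward_measure (mrestr mu mD) mX)
    (density_measure leb (mUs s) (fun x => U0 (s, x)))) => //.
    apply: (@le_lt_trans _ _ 1%E); last exact: ltry.
    change (mu (canonical_process s @^-1` setT `&` alive_part s setT) <= 1)%E.
    by rewrite preimage_setT setTI probability_le1.
  move=> q A'; have [pK] := pickleK q; have := H (pickle q) sT.
  by rewrite /= pK partE.
have v_ s : exists v : V -> R, s \in `[0, T] -> [/\ measurable_fun setT v,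
    (forall x, 0 <= v x) & forall A, measurable A ->
    mu (alive_part s A) = (\int[leb]_(x in A) (v x)%:E)%E].
  have [sT|sT] := boolP (s \in `[0, T]); last by exists (cst 0).
  have mX : measurable_fun setT (canonical_process s : path_space d T -> V).
    exact: canonical_process_measurable.
  have mD := alive_part_measurable sT (@measurableT _ V).
  have partE C : alive_part s C = canonical_process s @^-1` C `&` alive_part s setT.
    by apply/seteqP; split => p /=; [move=> [Cp Gp]|move=> [Cp [_ Gp]]].
  have [||v [mv v0 vE]] := @radon_nikodym_density _ _ _
      (pushforward_measure (mrestr mu mD) mX) leb.
  - apply: (@le_lt_trans _ _ 1%E); last exact: ltry.
    change (mu (canonical_process s @^-1` setT `&` alive_part s setT) <= 1)%E.
    by rewrite preimage_setT setTI probability_le1.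
  - move=> A mA A0; rewrite -[RHS](alive_null sT mA A0) (partE A); by [].
  - exists v => _; split => // A mA; rewrite -vE// (partE A); by [].
pose v s := projT1 (cid (v_ s)).
have vP s (sT : s \in `[0, T]) := projT2 (cid (v_ s)) sT.
pose u (s : R) x := (if pselect (good s) then U (s, x) else v s x) * \1_(~` G s) x.
have mGC (s : R) : s \in `[0, T] -> measurable (~` G s).
  by move=> sT; apply: measurableC; apply: closed_measurable_rV; exact: cG.
exists u; split.
- exists (fun z => U z * \1_alive_region z).
    apply: measurable_funM => //; apply: measurable_indic.
    exact: alive_region_measurable.
  have [N [mN N0 sN]] := good_ae.
  exists (N `*` setT); split.
  + exact: measurableX.
  + apply: (eq_trans (product_measure1E _ _ mN measurableT)).
    rewrite [X in (X * _)%E](_ : _ = 0%E) ?mul0e//; exact: N0.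
  + move=> [s x] /= H; split => //; apply: sN => /= sG; apply: H => -[/= sT _].
    rewrite /u /=; case: pselect => [sG'|/(_ (sG sT))//] /=.
    congr (_ * _); rewrite !indicE; congr (_%:R); congr nat_of_bool.
    by apply/idP/idP => /[!inE]; [split|case].
- move=> s sT; have [mv _ _] := vP _ sT.
  exists (u s); last exact: aeW.
  apply: measurable_funM; last by apply: measurable_indic; exact: mGC.
  by case: (pselect (good s)) => ? /=; [exact: mUs|exact: mv].
- move=> s x sT; have [_ v0 _] := vP _ sT.
  by rewrite /u mulr_ge0// ?indicE//; case: (pselect (good s)) => ? /=; [exact: U0|exact: v0].
- move=> s A sT mA AG; have [_ _ vE] := vP _ sT.
  transitivity (mu (alive_part s A)).
    congr (mu _); apply/seteqP; split => p /=; last by case.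
    by move=> Ap; split => //; exact: AG.
  transitivity (\int[leb]_(x in A) (if pselect (good s) then U (s, x) else v s x)%:E)%E.
    by case: pselect => [sG|nG] /=; [exact: sG|exact: vE].
  apply: eq_integral => x /[!inE] Ax; rewrite /u indicE mem_set ?mulr1//.
  exact: AG.
- move=> s x sT Gx; rewrite /u indicE memNset ?mulr0//.
Qed.

End alive_density_exists.

(** * Integrals of functions measurable up to null sets, and local integrability *)

Section has_integral.
Context d (X : measurableType d) (R : realType)
  (mu : {sigma_finite_measure set X -> \bar R}).
Implicit Types (f g h : X -> R) (r k : R).

(* The functions of a Stefan problem are only ae-measurable, so that the
   linearity of the library's integral does not apply to them directly. *)
Definition has_integral f r := exists g,
  [/\ mu.-integrable setT (EFin \o g), f = g %[ae mu] &
      (\int[mu]_x (g x)%:E = r%:E)%E].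

Lemma has_integral_integral f r :
  has_integral f r -> (\int[mu]_x (f x)%:E = r%:E)%E.
Proof.
move=> [g [_ fg <-]]; apply: integral_ae_eqN.
by apply: filterS fg => x /= H _; rewrite H.
Qed.

Lemma has_integralD f1 f2 r1 r2 : has_integral f1 r1 -> has_integral f2 r2 ->
  has_integral (fun x => f1 x + f2 x) (r1 + r2).
Proof.
move=> [g1 [i1 e1 E1]] [g2 [i2 e2 E2]]; exists (fun x => g1 x + g2 x); split.
- by apply: integrable_EFinD.
- by apply: filterS2 e1 e2 => x /= H1 H2 _; rewrite H1// H2.
- by rewrite integral_EFinD// E1 E2 EFinD.
Qed.

Lemma has_integralZ k f r : has_integral f r ->
  has_integral (fun x => k * f x) (k * r).
Proof.
move=> [g [i1 e1 E1]]; exists (fun x => k * g x); split.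
- by apply: (integrable_EFinZ measurableT k).
- by apply: filterS e1 => x /= H1 _; rewrite H1.
- by rewrite (integral_EFinZ measurableT k)// E1 EFinM.
Qed.

Lemma has_integralN f r : has_integral f r -> has_integral (fun x => - f x) (- r).
Proof.
move=> /(has_integralZ (-1)); rewrite mulN1r.
by under eq_fun do rewrite mulN1r.
Qed.

Lemma has_integral_integrable f :
  mu.-integrable setT (EFin \o f) -> has_integral f (\int[mu]_x f x).
Proof.
move=> fi; exists f; split => //; first exact: aeW.
by rewrite /Rintegral fineK//; exact: integrable_fin_num fi.
Qed.

Lemma has_integral_density (nu : {finite_measure set X -> \bar R}) f h (M : R) :
  ae_measurable_on mu setT f -> (forall x, 0 <= f x) ->
  (forall A, measurable A -> nu A = \int[mu]_(x in A) (f x)%:E)%E ->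
  measurable_fun setT h -> (forall x, `|h x| <= M) ->
  has_integral (fun x => h x * f x) (\int[nu]_x h x).
Proof.
(* The measurable version of [f] may be negative on a null set; its positive part is still a
   version. *)
move=> [g mg fg] f0 nuE mh hM; pose g' x := Num.max (g x) 0.
have fg' : f = g' %[ae mu].
  by apply: filterS fg => x /= H _; rewrite /g' -H// max_l.
have hi : nu.-integrable setT (EFin \o h).
  by apply: (@integrable_bounded _ _ _ nu setT h M).
have [||A mA|ig E] := @integral_density _ _ _ nu mu g' h _ _ _ hi mh.
- by apply: measurable_maxr.
- by move=> x; rewrite /g' le_max lexx orbT.
- rewrite nuE//; apply: integral_ae_eqN.
  by apply: filterS fg' => x /= H _; rewrite H.
exists (fun x => h x * g' x); split => //.
  by apply: filterS fg' => x /= H _; rewrite H.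
by rewrite E /Rintegral fineK//; exact: integrable_fin_num hi.
Qed.

End has_integral.

Section restriction.
Context d (X : measurableType d) (R : realType) (P : probability X R).
Variables (A : set X) (h : X -> R) (M : R).
Hypothesis mA : measurable A.
Hypothesis mh : measurable_fun setT h.
Hypothesis hM : forall x, `|h x| <= M.

Lemma Rintegral_mfrestr (Aoo : (P A < +oo)%E) :
  \int[mfrestr mA Aoo]_x h x = \int[P]_x (\1_A x * h x).
Proof.
have hi : (mfrestr mA Aoo : {finite_measure set X -> \bar R}).-integrable
    setT (EFin \o h).
  by apply: (@integrable_bounded _ _ _ _ setT h M).
rewrite /Rintegral; congr fine.
have [||C mC|_ <-] := @integral_density _ _ _
    (mfrestr mA Aoo : {finite_measure set X -> \bar R}) P (\1_A) h _ _ _ hi mh.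
- exact: measurable_indic.
- by move=> x; rewrite indicE.
- by rewrite integral_indic// setIC.
by apply: eq_integral => x _; rewrite mulrC.
Qed.

End restriction.

Section local_integrability.
Context (R : realType) (d : nat).
Local Notation V := 'rV[R]_d.
Local Notation leb := (@lebesgue_measure_rV R d).

Lemma measurable_rV_box n (M : R) :
  measurable [set x : 'rV[R]_n | forall i, - M <= x ord0 i <= M].
Proof.
rewrite (_ : [set x | _] = \bigcap_(i in [set: 'I_n])
    ((fun v : 'rV[R]_n => v ord0 i) @^-1` `[- M, M])).
  apply: countable_bigcap_measurable => i _; rewrite -[X in measurable X]setTI.
  by apply: (measurable_coord i) => //; exact: measurable_itv.
apply/seteqP; split => v /= H i; first by move=> _; rewrite /= in_itv/=; exact: H.
by have := H i I; rewrite /= in_itv.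
Qed.

Lemma lebesgue_measure_rV_box n (M : R) :
  (@lebesgue_measure_rV R n [set x | forall i, (- M <= x ord0 i <= M)%R] < +oo)%E.
Proof.
elim: n => [|n IH].
  by rewrite /= diracE; case: (_ \in _); rewrite ltry.
rewrite /= /lebesgue_measure_rV_step /pushforward.
rewrite (_ : _ @^-1` _ = `[- M, M]%classic `*`
  [set x : 'rV[R]_n | forall i, - M <= x ord0 i <= M]); last first.
  apply/seteqP; split => [z H|z [H1 H2] i] /=.
    split => [|i]; first by have := H ord0; rewrite cons_rV0 /= in_itv.
    by have := H (lift ord0 i); rewrite cons_rV_lift.
  case: (unliftP ord0 i) => [j ->|->]; first by rewrite cons_rV_lift.
  by rewrite cons_rV0; move: H1; rewrite /= in_itv.
rewrite product_measure1E; last 2 first.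
- exact: measurable_itv.
- exact: measurable_rV_box.
apply: lte_mul_pinfty => //; rewrite ge0_fin_numE//.
have := lebesgue_measure_itv `[- M, M]; rewrite /= => ->.
by case: ifPn => _; rewrite ltry.
Qed.

Lemma compact_lebesgue_measure_rV (K : set V) : compact K -> (leb K < +oo)%E.
Proof.
move=> cK; have cK' : closed K by apply: compact_closed cK; exact: norm_hausdorff.
have [M [Mr KM]] := compact_bounded cK.
have MK x : K x -> `|x| <= M + 1 by apply: KM; rewrite ltrDl.
apply: le_lt_trans (lebesgue_measure_rV_box d (M + 1)).
apply: le_measure; rewrite ?inE.
- exact: closed_measurable_rV.
- exact: measurable_rV_box.
- move=> x /MK xM i; rewrite -ler_norml; apply: le_trans xM.
  rewrite /Num.norm/= mx_normrE.
  exact: (le_bigmax (0 : R) (fun ij : 'I_1 * 'I_d => `|x ij.1 ij.2|) (ord0, i)).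
Qed.

Lemma locally_integrable_rV_indic (A : set V) : measurable A ->
  locally_integrable_rV (\1_A : V -> R).
Proof.
move=> mA; split; first by exists (\1_A); [exact: measurable_indic|exact: aeW].
move=> K cK; have mK : measurable K.
  by apply: closed_measurable_rV; apply: compact_closed cK; exact: norm_hausdorff.
apply: le_lt_trans (compact_lebesgue_measure_rV cK).
under eq_integral do rewrite ger0_norm//.
rewrite integral_indic//; apply: le_measure; rewrite ?inE//.
exact: measurableI.
Qed.

Lemma compact_support_bounded (psi : V -> R) : continuous psi ->
  compact (closure [set x | psi x != 0]) -> exists2 M, 0 <= M & forall x, `|psi x| <= M.
Proof.
move=> cpsi cK.
have cI : compact (psi @` closure [set x | psi x != 0]).
  by apply: continuous_compact => //; exact: continuous_subspaceT.
have [M [_ HM]] := @compact_bounded R R^o _ cI.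
exists (Num.max M 0 + 1); first by rewrite addr_ge0// le_max lexx orbT.
move=> x; have [px|px] := eqVneq (psi x) 0.
  by rewrite px normr0 addr_ge0// le_max lexx orbT.
apply: HM; last by exists x => //; exact: subset_closure.
by rewrite (@le_lt_trans _ _ (Num.max M 0))// ?le_max ?lexx// ltrDl.
Qed.

Lemma has_integral_mul (f psi : V -> R) : locally_integrable_rV f ->
  continuous psi -> compact (closure [set x | psi x != 0]) ->
  exists r, has_integral leb (fun x => psi x * f x) r.
Proof.
move=> [[g mg fg] fK] cpsi cK.
have [M M0 psiM] := compact_support_bounded cpsi cK.
set K := closure _ in cK.
have mK : measurable K by apply: closed_measurable_rV; exact: closed_closure.
have mpsi : measurable_fun setT psi by exact: continuous_measurable_rV.
have iK : leb.-integrable K (EFin \o g).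
  apply/integrableP; split; first by apply/measurable_EFinP; exact: measurable_funTS.
  rewrite (_ : (\int[leb]_(x in K) _ = \int[leb]_(x in K) `|f x|%:E)%E) ?fK//.
  by apply: integral_ae_eqN; apply: filterS fg => x /= H _; rewrite H.
have iM : leb.-integrable setT (fun x => (M * (g \_ K) x)%:E).
  apply: (integrable_EFinZ measurableT M).
  rewrite (_ : EFin \o (g \_ K) = (EFin \o g) \_ K); last first.
    by apply/funext => x /=; rewrite !patchE; case: ifPn.
  by rewrite -integrable_mkcond.
have ig : leb.-integrable setT (fun x => (psi x * g x)%:E).
  apply: le_integrable iM => //.
    by apply/measurable_EFinP; apply: measurable_funM.
  move=> x _ /=; rewrite lee_fin !normrM (ger0_norm M0) patchE.
  case: ifPn => [_|/negP xK]; first exact: ler_wpM2r.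
  suff -> : psi x = 0 by rewrite normr0 mul0r mulr_ge0.
  apply: contrapT => /eqP px; apply: xK; rewrite inE; exact: subset_closure.
exists (\int[leb]_x (psi x * g x)).
have [h [ih eh Eh]] := @has_integral_integrable _ _ _ leb (fun x => psi x * g x) ig.
exists h; split => //; apply: filterS2 fg eh => x /= H H' _.
by rewrite H// H'.
Qed.

End local_integrability.

(** * Measurability of the hitting time, and transfer from the law to the sample space *)

Section hitting_time.
Context (R : realType) (d : nat) (T : R).
Local Notation V := 'rV[R]_d.
Variable G : R -> set V.

Lemma hitting_time_ge0 f : (0 <= hitting_time T G f)%E.
Proof.
by apply: le_ereal_inf_tmp => _ [s [/[!in_itv]/= /andP[s0 _] _] <-]; rewrite lee_fin.
Qed.

(** A hitting time is either at most [T] or infinite, so beyond the horizon all level events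
    coincide. *)
Lemma hitting_time_gt_horizon (f : R -> V) (r : R) : T <= r ->
  (r%:E < hitting_time T G f)%E = (T%:E < hitting_time T G f)%E.
Proof.
move=> Tr; apply/idP/idP => H; first by apply: le_lt_trans H; rewrite lee_fin.
rewrite /hitting_time (_ : [set _ | _ in _] = set0) ?ereal_inf0 ?ltry//.
apply/seteqP; split => // _ [s [sT Gs] <-]; move: H; rewrite ltNge => /negP; apply.
apply: ge_ereal_inf; exists s%:E; first by exists s.
by move: sT; rewrite lee_fin in_itv/= => /andP[].
Qed.

Hypothesis T0 : 0 < T.
Hypothesis cG : closed_family T G.
Hypothesis ndG : nondecreasing_family T G.
Hypothesis rcG : right_continuous_family T G.

Lemma hitting_time_measurable : measurable_fun setT
  (fun p : path_space d T => hitting_time T G (fun s => canonical_process s p)).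
Proof.
have mal s : s \in `[0, T] -> measurable [set p : path_space d T |
    (s%:E < hitting_time T G (fun r => canonical_process r p))%E].
  move=> sT; rewrite (_ : [set p | _] =
      [set p : path_space d T | alive G (fun r => canonical_process r p) s]).
    apply: (measurable_alive cG ndG rcG sT).
      exact: canonical_process_continuous.
    move=> r rs; apply: canonical_process_measurable => //.
    move: rs sT; rewrite !in_itv/= => /andP[-> rs] /andP[_ sT] /=.
    exact: le_trans sT.
  have cX := @canonical_process_continuous R d T.
  apply/seteqP; split => p /=; first by move/(lt_hitting_time cG ndG rcG sT (cX p)).
  by move=> H; apply/(lt_hitting_time cG ndG rcG sT (cX p)).
apply: (measurability _ (ErealGenOInfty.measurableE R)) => _ [_ [r ->] <-].
rewrite setTI (_ : _ @^-1` _ = [set p : path_space d T |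
    (r%:E < hitting_time T G (fun s => canonical_process s p))%E]); last first.
  by apply/seteqP; split => p /=; rewrite in_itv/= andbT.
have [r0|r0] := ltP r 0.
  rewrite (_ : [set p | _] = setT)//; apply/seteqP; split => p //= _.
  by apply: lt_le_trans (hitting_time_ge0 _); rewrite lte_fin.
have [rT|Tr] := leP r T; first by apply: mal; rewrite in_itv/= r0.
under eq_set do rewrite (hitting_time_gt_horizon _ (ltW Tr)).
by apply: mal; rewrite in_itv/= lexx ltW.
Qed.

Lemma hitting_value_measurable (psi : V -> R) s : measurable_fun setT psi ->
  s \in `[0, T] -> measurable_fun setT (fun p : path_space d T =>
    let tau := hitting_time T G (fun r => canonical_process r p) in
    psi (canonical_process (fine tau) p) * (tau <= s%:E)%E%:R).
Proof.
move=> mpsi sT.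
pose tau p := hitting_time T G (fun r => @canonical_process R d T r p).
have mtau : measurable_fun setT tau := hitting_time_measurable.
(* On tau <= s the clamp does nothing; elsewhere the indicator removes the default value that [fine]
   gives at infinity. *)
apply: (eq_measurable_fun (fun p =>
    psi (canonical_process (clamp T (fine (tau p))) p) *
    \1_[set p | (tau p <= s%:E)%E] p)) => [p _|].
  rewrite indicE /= -/(tau p).
  have E : (p \in [set p | (tau p <= s%:E)%E]) = (tau p <= s%:E)%E.
    by apply/idP/idP => [/set_mem|/mem_set].
  rewrite E; have [H|_] := boolP (tau p <= s%:E)%E; last by rewrite !mulr0.
  rewrite clamp_id//.
  have cX := @canonical_process_continuous R d T p.
  have [r [rs rE _ _]] := hitting_time_le cG ndG rcG sT cX H.
  rewrite -/(tau p) in rE; rewrite rE /=.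
  move: rs sT; rewrite !in_itv/= => /andP[-> rs] /andP[_ sT'] /=.
  exact: le_trans sT'.
apply: measurable_funM.
  apply: measurableT_comp => //.
  have mft : measurable_fun setT (fun p => (fine (tau p) : measurableTypeR R, p)).
    apply: measurable_fun_pair => //.
    by apply: measurableT_comp mtau; exact: fine_measurable.
  exact: measurableT_comp (clamped_process_measurable T0) mft.
apply: measurable_indic.
by have := emeasurable_fun_infty_c measurableT mtau s%:E; rewrite setTI.
Qed.

End hitting_time.

Section law.
Context (R : realType) (d : nat) (T : R) (dO : measure_display)
  (O : measurableType dO).
Local Notation V := 'rV[R]_d.
Local Notation leb := (@lebesgue_measure_rV R d).
Variables (P : probability O R) (xi : {RV P >-> V}) (B : R -> O -> V)
  (G : R -> set V) (Y : {RV P >-> path_space d T}) (u0 : V -> R)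
  (mu : probability (path_space d T) R).
Hypothesis T0 : 0 < T.
Hypothesis BM : standard_brownian_motion P B.
Hypothesis xiE : forall A, measurable A ->
  distribution P xi A = (\int[leb]_(x in A) (u0 x)%:E)%E.
Hypothesis xiB : independent_systems P (preimage_set_system setT xi measurable)
  (sigma_generated `[0, +oo[ B).
Hypothesis cG : closed_family T G.
Hypothesis ndG : nondecreasing_family T G.
Hypothesis rcG : right_continuous_family T G.
Hypothesis YE : forall o t, t \in `[0, T] ->
  canonical_process t (Y o) = started xi B (stopping T xi B G t o) o.
Hypothesis muE : forall A, measurable A -> mu A = distribution P Y A.
Local Notation W := (started xi B).
Local Notation A := (survival xi B G).

Let mxi : measurable_fun setT xi.
Proof. exact: measurable_funP. Qed.

(** With [B s] frozen at a value b, the variable xi + b misses null sets because [xi] has a density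
    and Lebesgue measure is translation invariant. The argument also covers s = 0. *)
Lemma started_null s C : 0 <= s -> measurable C -> leb C = 0%E ->
  P (W s @^-1` C) = 0%E.
Proof.
move=> s0 mC C0.
have mB := bm_measurable BM s0.
have mF : measurable_fun setT (fun z : V * V => \1_C (z.2 + z.1) : R).
  apply: measurableT_comp; first exact: measurable_indic.
  by apply: measurable_rVD; [exact: measurable_snd|exact: measurable_fst].
have mWC : measurable (W s @^-1` C).
  by rewrite -[X in measurable X]setTI; exact: (started_measurable mxi BM).
have FM (z : V * V) : `|\1_C (z.2 + z.1) : R| <= 1.
  by rewrite ger0_norm// indicE; case: (_ \in _).
have BX D E : measurable D -> measurable E ->
    P (B s @^-1` D `&` xi @^-1` E) = (P (B s @^-1` D) * P (xi @^-1` E))%E.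
  move=> mD mE; rewrite setIC muleC; apply: xiB.
    by exists E => //; rewrite setTI.
  by apply: sub_sigma_algebra; exists s, D; split => //; rewrite /= in_itv/= s0.
have E o : \int[distribution P xi]_y \1_C (y + B s o) = 0.
  have mCB : measurable ((fun y => y + B s o) @^-1` C).
    rewrite -[X in measurable X]setTI.
    by apply: measurable_rVD => //; exact: measurable_cst.
  transitivity (fine (\int[distribution P xi]_x (\1_((fun y => y + B s o) @^-1` C) x)%:E)).
    by [].
  rewrite integral_indic// setIT.
  rewrite -[RHS]/(fine 0%E); congr fine; apply: (eq_trans (xiE mCB)).
  rewrite (@integral_ae_eqN _ _ _ _ _ _ (cst 0%E)) ?integral0//.
  exists ((fun y => y + B s o) @^-1` C); split => //.
    exact: (eq_trans (lebesgue_measure_rV_translation _ mC)).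
  by move=> x /= nx; apply: contrapT => nC; apply: nx => /nC.
have := @Rintegral_independent _ _ _ O V V R P (B s) xi _ 1 mB mxi mF FM BX.
rewrite /= (_ : \int[P]_x \1_C (xi x + B s x) = fine (P (W s @^-1` C))); last first.
  rewrite -[in RHS](setIT (W s @^-1` C)) -integral_indic//.
move=> H; rewrite -[LHS]fineK ?fin_num_measure// H; congr EFin.
transitivity (\int[P]_(o in setT) (0 : R)); first by apply: eq_Rintegral => o _; exact: E.
exact: Rintegral_cst_probability.
Qed.

Lemma alive_partE s C : s \in `[0, T] -> measurable C ->
  mu (alive_part G s C) = P (A s `&` W s @^-1` C).
Proof.
move=> sT mC; rewrite muE; last exact: alive_part_measurable.
congr (P _); apply/seteqP; split => o /=; rewrite /alive_part /=.
  move=> [CY GY]; have oA : o \in A s.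
    by rewrite (stopped_notin BM cG ndG rcG YE)//; exact/mem_set.
  by split; [exact: set_mem|rewrite -(stopped_survival BM cG ndG rcG YE sT oA)].
move=> [/mem_set oA WC]; split.
  by rewrite (stopped_survival BM cG ndG rcG YE sT oA).
by move: oA; rewrite (stopped_notin BM cG ndG rcG YE)// => /set_mem.
Qed.

Lemma alive_part_null s C : s \in `[0, T] -> measurable C ->
  leb C = 0%E -> mu (alive_part G s C) = 0%E.
Proof.
move=> sT mC C0; have := sT; rewrite in_itv/= => /andP[s0 _].
have mW : measurable_fun setT (W s) by exact: (started_measurable mxi BM).
have mWC : measurable (W s @^-1` C) by rewrite -[X in measurable X]setTI; exact: mW.
rewrite alive_partE//; apply/eqP; rewrite eq_le measure_ge0 andbT.
rewrite -(started_null s0 mC C0); apply: le_measure; rewrite ?inE//.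
apply: measurableI => //; exact: (survival_measurable mxi BM cG ndG rcG).
Qed.

Lemma has_integral_start (h : V -> R) (M : R) :
  ae_measurable_on leb setT u0 -> (forall x, 0 <= u0 x) ->
  measurable_fun setT h -> (forall x, `|h x| <= M) ->
  has_integral leb (fun x => h x * u0 x) (\int[P]_o h (xi o)).
Proof.
move=> mu0 u00 mh hM.
rewrite (_ : \int[P]_o h (xi o) = \int[distribution P xi]_x h x).
  exact: (@has_integral_density _ _ _ leb (distribution P xi) u0 h M).
rewrite /Rintegral integral_distribution//; first exact/measurable_EFinP.
by apply: (@integrable_bounded _ _ _ P setT _ M) => //; exact: measurableT_comp.
Qed.

(** The image under [W s] of [P] restricted to survival is the alive part of the law at time [s],
    which has density [u s]; both live off [G s]. *)
Lemma has_integral_alive u s (h : V -> R) (M : R) : alive_density mu G u ->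
  s \in `[0, T] -> measurable_fun setT h -> (forall x, `|h x| <= M) ->
  has_integral leb (fun x => h x * u s x) (\int[P]_o (\1_(A s) o * h (W s o))).
Proof.
move=> uP sT mh hM; have := sT; rewrite in_itv/= => /andP[s0 _].
have mA : measurable (A s) by exact: (survival_measurable mxi BM cG ndG rcG).
have mW : measurable_fun setT (W s) by exact: (started_measurable mxi BM).
have Aoo : (P (A s) < +oo)%E by rewrite ltey_eq fin_num_measure.
rewrite -(@Rintegral_mfrestr _ _ _ P (A s) (h \o W s) M mA
  (measurableT_comp mh mW) (fun o => hM _) Aoo).
pose nu0 := pushforward_measure (mfrestr mA Aoo) mW.
have nu0oo : (nu0 setT < +oo)%E.
  change (P (W s @^-1` setT `&` A s) < +oo)%E.
  by rewrite preimage_setT setTI.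
pose nu : {finite_measure set V -> \bar R} := mfrestr measurableT nu0oo.
have nuE C : measurable C -> nu C = nu0 C by move=> mC; rewrite /nu /= /mfrestr /mrestr setIT.
rewrite (_ : \int[_]_x _ = \int[nu]_x h x); last first.
  rewrite /Rintegral; congr fine; apply/esym.
  rewrite (@eq_measure_integral _ _ _ _ nu0); last by move=> C mC _; exact: nuE.
  apply: (@integral_pushforward _ _ _ _ _ _ mW (mfrestr mA Aoo) setT (EFin \o h)) => //.
    exact/measurable_EFinP.
  apply: (@integrable_bounded _ _ _ (mfrestr mA Aoo) _ (h \o W s) M).
  - by rewrite preimage_setT.
  - exact: measurable_funTS (measurableT_comp mh mW).
  - by move=> o _; exact: hM.
have [_ mu_ u_ge0 uE uG] := uP.
apply: (@has_integral_density _ _ _ leb nu (u s) h M) => //.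
- exact: mu_.
- by move=> x; exact: u_ge0.
move=> C mC; have mGC : measurable (~` G s).
  by apply: measurableC; apply: closed_measurable_rV; exact: cG.
transitivity (mu (alive_part G s C)).
  by rewrite nuE// alive_partE// setIC.
transitivity (\int[leb]_(x in C `&` ~` G s) (u s x)%:E)%E.
  by apply: uE => //; exact: measurableI.
rewrite integral_mkcond [RHS]integral_mkcond; apply: eq_integral => x _.
rewrite !patchE in_setI; case: (x \in C) => //=; case: ifPn => // /negP nG.
by rewrite uG//; apply: contrapT => nGx; apply: nG; rewrite inE.
Qed.

(** The right-hand side of the growth condition, moved to the sample space: tau <= s is the
    complement of survival, and there the position at tau is the stopped position at [s]. *)
Lemma expectation_hitting_value (psi : V -> R) (M : R) s :
  measurable_fun setT psi -> (forall x, `|psi x| <= M) -> s \in `[0, T] ->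
  ('E_mu[fun p => let tau := hitting_time T G (fun r => canonical_process r p) in
     (psi (canonical_process (fine tau) p) * (tau <= s%:E)%E%:R)%R] =
  (\int[P]_o (\1_(~` A s) o * psi (canonical_process s (Y o))))%:E)%E.
Proof.
move=> mpsi psiM sT.
pose F p := let tau := hitting_time T G (fun r => @canonical_process R d T r p) in
  psi (canonical_process (fine tau) p) * (tau <= s%:E)%E%:R.
have mF : measurable_fun setT F := hitting_value_measurable T0 cG ndG rcG mpsi sT.
have FM p : `|F p| <= M.
  rewrite /F /= normrM (le_trans _ (psiM (canonical_process (fine
    (hitting_time T G (fun r => canonical_process r p))) p)))//.
  by rewrite ler_piMr//; case: (_ <= _)%E; rewrite ?normr1// normr0.
have iF : P.-integrable setT (EFin \o (F \o Y)).
  apply: (@integrable_bounded _ _ _ P setT (F \o Y) M).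
  - by [].
  - have mY : measurable_fun setT Y by exact: measurable_funPT.
    exact: (measurableT_comp mF mY).
  - by move=> o _; exact: FM.
rewrite unlock -/F (@eq_measure_integral _ _ _ _ (distribution P Y)); last first.
  by move=> C mC _; exact: muE.
rewrite (@integral_distribution _ _ _ _ _ P Y (EFin \o F))//; last first.
  exact/measurable_EFinP.
rewrite -[LHS]fineK; last exact: integrable_fin_num iF.
congr EFin; apply: eq_Rintegral => o _ /=; rewrite /F /=.
rewrite (stopped_hitting_le BM cG ndG rcG YE)// indicE in_setC mulrC.
have [//|nA] := boolP (o \in A s); rewrite ?mul0r// !mul1r.
by rewrite (stopped_hitting_value BM cG ndG rcG YE sT nA).
Qed.

End law.

(** * Time derivatives of test functions integrated over a fixed set *)

Lemma integral_itv_ccoo (R : realType) (t : R) (f : R -> \bar R) :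
  (\int[lebesgue_measure]_(s in `[0%R, t]) f s =
   \int[lebesgue_measure]_(s in `]0%R, t[) f s)%E.
Proof.
rewrite integral_mkcond [RHS]integral_mkcond; apply: integral_ae_eqN.
exists [set 0; t]; split.
- by apply: measurableU; exact: measurable_set1.
- by apply/eqP; rewrite eq_le measure_ge0 andbT (le_trans (measureU2 _ _ _))//= !lebesgue_measure_set1 adde0.
- move=> s /= H; apply: contrapT => ns; apply: H => _; rewrite !patchE.
  rewrite (_ : (s \in (`[0, t]%classic : set R)) = (s \in (`]0, t[%classic : set R)))//.
  apply/idP/idP => /set_mem/=; rewrite in_itv/= => /andP[s0 st]; apply/mem_set;
    rewrite /= in_itv/=; last by rewrite !ltW.
  rewrite !lt_neqAle s0 st !andbT; apply/andP; split; apply/eqP => E; apply: ns;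
    by [left|right].
Qed.

Lemma integrable_bounded_support d (X : measurableType d) (R : realType)
    (mu : {measure set X -> \bar R}) (K : set X) (f : X -> R) (M : R) :
  measurable K -> (mu K < +oo)%E -> measurable_fun setT f ->
  (forall x, K x -> `|f x| <= M) -> (forall x, ~ K x -> f x = 0) ->
  mu.-integrable setT (EFin \o f).
Proof.
move=> mK Koo mf fM f0.
have -> : EFin \o f = (EFin \o f) \_ K.
  apply/funext => x; rewrite patchE; case: ifPn => // /negP nK /=.
  by rewrite f0// => Kx; apply: nK; rewrite inE.
rewrite -integrable_mkcond//; apply: measurable_bounded_integrable => //.
  exact: measurable_funTS.
exists M; split; [exact: num_real|move=> r Mr x Kx]; exact: le_trans (fM _ Kx) (ltW Mr).
Qed.

Section indicator_time_derivative.
Context (R : realType) (d : nat).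
Local Notation V := 'rV[R]_d.
Local Notation leb := (@lebesgue_measure_rV R d).
Local Notation leb1 := (@lebesgue_measure R).
Variables (t : R) (phi : R -> V -> R) (A : set V).
Hypothesis t0 : 0 < t.
Hypothesis tphi : Cc_infty_upto t phi.
Hypothesis mA : measurable A.

Let psi := time_partial phi.
Let K := spatial_support t phi.
Let mK : measurable K.
Proof. by apply: closed_measurable_rV; exact: spatial_support_closed tphi. Qed.
Let Koo : (leb K < +oo)%E.
Proof. by apply: compact_lebesgue_measure_rV; exact: spatial_support_compact tphi. Qed.

Let cpsi s : continuous (psi s).
Proof. exact: continuous_section (spacetime_CkW (test_time_smooth tphi 0)). Qed.

Let mpsi s : measurable_fun setT (psi s).
Proof. exact: continuous_measurable_rV. Qed.

Let cpsi1 x : continuous (psi ^~ x).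
Proof.
move=> s; apply: (@continuous_comp _ _ _ (fun s => (s, x)) (fun z => psi z.1 z.2)).
  apply: (@cvg_pair _ _ _ (nbhs s) (nbhs s) (nbhs x) _ _ _ id (cst x)); [exact: cvg_id|exact: cvg_cst].
have H : continuous (fun z : R * V => psi z.1 z.2).
  exact: spacetime_CkW (test_time_smooth tphi 0).
exact: (H (s, x)).
Qed.

Lemma integrable_section_indic (f : V -> R) : continuous f ->
  (forall x, ~ K x -> f x = 0) ->
  leb.-integrable setT (fun x => (f x * \1_A x)%:E).
Proof.
move=> cf f0.
have cI : compact (f @` K).
  apply: continuous_compact; first exact: continuous_subspaceT.
  exact: spatial_support_compact tphi.
have [M [_ HM]] := @compact_bounded R R^o _ cI.
have M1 : M < `|M| + 1 by rewrite (le_lt_trans (ler_norm M))// ltrDl.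
apply: (@integrable_bounded_support _ _ _ leb K (fun x => f x * \1_A x) (`|M| + 1)) => //.
- apply: measurable_funM; last exact: measurable_indic.
  exact: continuous_measurable_rV.
- move=> x Kx; rewrite normrM (@le_trans _ _ `|f x|)//.
    by rewrite ler_piMr// ger0_norm// indicE; case: (_ \in _).
  by apply: (HM _ M1); exists x.
- by move=> x Kx; rewrite f0// mul0r.
Qed.

(** Fubini and the fundamental theorem of calculus at each fixed point. With [A] the initial set,
    this cancels the indicator terms that the growth condition brings into the weak equation. *)
Lemma indicator_time_derivative :
  leb1.-integrable `]0, t[ (fun s => (\int[leb]_x (psi s x * \1_A x))%:E) /\
  \int[leb]_x (phi t x * \1_A x) - \int[leb]_x (phi 0 x * \1_A x) =
  \int[leb1]_(s in `]0, t[) \int[leb]_x (psi s x * \1_A x).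
Proof.
have [M M0 [_ _ _ psiM]] := test_bounds tphi.
have mI : measurable (`]0, t[%classic : set (measurableTypeR R)) by exact: measurable_itv.
(* The open time interval matters: the bound on [psi] and its vanishing off [K] are available at
   interior times. *)
pose F (z : measurableTypeR R * V) : R := \1_(`]0, t[%classic : set R) z.1 * (psi z.1 z.2 * \1_A z.2).
have mF : measurable_fun setT F.
  apply: measurable_funM.
    by apply: measurableT_comp; [exact: measurable_indic|exact: measurable_fst].
  apply: measurable_funM.
    exact: (@measurable_uncurry_continuous R _ V psi).
  by apply: measurableT_comp; [exact: measurable_indic|exact: measurable_snd].
have F0 s x : ~ K x -> F (s, x) = 0.
  move=> Kx; rewrite /F /= indicE; case: (boolP (s \in _)) => [/set_mem/= st|_]; last by rewrite mul0r.
  by rewrite [psi s x](time_partial_vanish st Kx) mul0r mulr0.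
have iF : (leb1 \x leb)%E.-integrable setT (EFin \o F).
  apply: (@integrable_bounded_support _ (measurableTypeR R * V)%type R (leb1 \x leb)%E (`]0, t[%classic `*` K) F M) => //.
  - exact: measurableX.
  - rewrite [ltLHS](_ : _ = leb1 `]0%R, t[%classic * leb K)%E; last exact: product_measure1E.
    apply: lte_mul_pinfty => //; rewrite ge0_fin_numE//.
    have := lebesgue_measure_itv `]0, t[; rewrite /= => ->.
    by case: ifPn => _; rewrite ltry.
  - move=> [s x] [/= st Kx]; rewrite /F /= indicE mem_set// mul1r normrM.
    rewrite (@le_trans _ _ `|psi s x|)//.
      by rewrite ler_piMr// ger0_norm// indicE; case: (_ \in _).
    by apply: psiM; move: st; rewrite /= in_itv.
  - move=> [s x] H; have [Kx|/F0//] := pselect (K x).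
    rewrite /F /= indicE memNset ?mul0r// => st; exact: H.
have sectE s : s \in `]0, t[ -> (\int[leb]_x (F (s, x))%:E =
    (\int[leb]_x (psi s x * \1_A x))%:E)%E.
  move=> st; rewrite /Rintegral fineK; last first.
    apply: (@integrable_fin_num _ _ _ leb setT measurableT).
    apply: integrable_section_indic => // x Kx.
    exact: (time_partial_vanish st Kx).
  by apply: eq_integral => x _; rewrite /F /= indicE mem_set ?mul1r.
have iI : leb1.-integrable `]0, t[ (fun s => (\int[leb]_x (psi s x * \1_A x))%:E).
  have := integrable_fubini_F iF; rewrite /fubini_F /= => H.
  have := integrableS measurableT mI (@subsetT _ _) H.
  apply: eq_integrable => // s /set_mem/= st; exact: sectE.
split => //.
have v0 s x : s \in `[0, t] -> ~ K x -> phi s x = 0 by exact: vanish_off_support.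
have cphi s : continuous (phi s).
  exact: continuous_section (spacetime_CkW (test_smooth tphi 0)).
have i0 : leb.-integrable setT (fun x => (phi 0 x * \1_A x)%:E).
  by apply: integrable_section_indic => // x; apply: v0; rewrite in_itv/= lexx ltW.
have it : leb.-integrable setT (fun x => (phi t x * \1_A x)%:E).
  by apply: integrable_section_indic => // x; apply: v0; rewrite in_itv/= lexx ltW.
apply: EFin_inj; rewrite EFinB.
rewrite /Rintegral fineK; last exact: (@integrable_fin_num _ _ _ leb setT measurableT).
rewrite fineK; last exact: (@integrable_fin_num _ _ _ leb setT measurableT).
rewrite fineK; last exact: (@integrable_fin_num _ _ _ leb1 _ mI).
rewrite -(integral_EFinB measurableT it i0).
transitivity (\int[leb1]_s \int[leb]_x (F (s, x))%:E)%E; last first.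
  rewrite [RHS]integral_mkcond; apply: eq_integral => s _; rewrite patchE.
  case: ifPn => [/set_mem/= st|nst]; first exact: sectE.
  rewrite integral0_eq// => x _; rewrite /F /= indicE.
  by rewrite (negbTE nst) mul0r.
rewrite (Fubini iF); apply: eq_integral => x _.
transitivity ((\1_A x)%:E * \int[leb1]_(s in `]0%R, t[) (psi s x)%:E)%E; last first.
  rewrite -integral_EFinZ//; last first.
    apply: (@measurable_bounded_integrable _ _ _ leb1 (psi ^~ x)) => //.
    - have := lebesgue_measure_itv `]0, t[; rewrite /= => ->.
      by case: ifPn => _; rewrite ltry.
    - apply: measurable_funTS; exact: continuous_measurable_fun.
    exists M; split; [exact: num_real|move=> r Mr s /=; rewrite in_itv/= => st].
    exact: le_trans (psiM _ _ st) (ltW Mr).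
  rewrite integral_mkcond; apply: eq_integral => s _; rewrite patchE /F /= [in RHS]indicE.
  by case: ifPn => _; rewrite ?mul0r// mul1r mulrC.
rewrite -integral_itv_ccoo.
have dphi s : derivable (phi ^~ x) s 1.
  by have [_ [+ _ _]] := test_smooth tphi 1.
rewrite (@continuous_FTC2 R _ (phi ^~ x) 0 t)//.
- by rewrite -EFinB -EFinM; congr EFin; ring.
- exact: continuous_subspaceT.
- split => //.
  + apply: cvg_at_right_filter; apply: differentiable_continuous; exact/derivable1_diffP.
  + apply: cvg_at_left_filter; apply: differentiable_continuous; exact/derivable1_diffP.
Qed.

End indicator_time_derivative.

(** * Local integrability of the alive density *)

Lemma subset_integral_ae d (X : measurableType d) (R : realType)
    (mu : {measure set X -> \bar R}) (f : X -> R) (D : set X) :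
  ae_measurable_on mu setT f -> (forall x, 0 <= f x) -> measurable D ->
  (\int[mu]_(x in D) (f x)%:E <= \int[mu]_x (f x)%:E)%E.
Proof.
move=> [g mg fg] f0 mD; pose g' x := Num.max (g x) 0.
have E C : (\int[mu]_(x in C) (f x)%:E = \int[mu]_(x in C) (g' x)%:E)%E.
  apply: integral_ae_eqN; apply: filterS fg => x /= H _.
  by rewrite /g' -H// max_l.
rewrite !E; apply: ge0_subset_integral => //.
- by apply/measurable_EFinP; exact: measurable_maxr.
- by move=> x _; rewrite lee_fin le_max lexx orbT.
Qed.

Section local_integrability_facts.
Context (R : realType) (d : nat).
Local Notation V := 'rV[R]_d.
Local Notation leb := (@lebesgue_measure_rV R d).

Lemma locally_integrable_rV_ge0 (f : V -> R) : ae_measurable_on leb setT f ->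
  (forall x, 0 <= f x) -> (\int[leb]_x (f x)%:E < +oo)%E -> locally_integrable_rV f.
Proof.
move=> mf f0 foo; split => // K cK; apply: le_lt_trans foo.
have mK : measurable K.
  by apply: closed_measurable_rV; apply: compact_closed cK; exact: norm_hausdorff.
under eq_integral do rewrite ger0_norm//.
exact: subset_integral_ae.
Qed.

Lemma ae_measurable_onN d' (X : measurableType d') (mu : {measure set X -> \bar R})
    (D : set X) (f : X -> R) :
  ae_measurable_on mu D f -> ae_measurable_on mu D (fun x => - f x).
Proof.
move=> [g mg fg]; exists (fun x => - g x); first exact: measurable_funN.
by apply: filterS fg => x /= H Dx; rewrite H.
Qed.

Lemma locally_integrable_rVN (f : V -> R) :
  locally_integrable_rV f -> locally_integrable_rV (fun x => - f x).
Proof.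
move=> [mf fK]; split; first exact: ae_measurable_onN.
by move=> K cK; under eq_integral do rewrite normrN; exact: fK.
Qed.

Lemma locally_integrable_spacetimeN (T : R) (f : R -> V -> R) :
  locally_integrable_spacetime T f ->
  locally_integrable_spacetime T (fun s x => - f s x).
Proof.
move=> [mf fK ft]; split.
- exact: ae_measurable_onN.
- by move=> K cK; under eq_integral do rewrite normrN; exact: fK.
- by move=> t tT; apply: locally_integrable_rVN; exact: ft.
Qed.

End local_integrability_facts.

Section alive_density_integrable.
Context (R : realType) (d : nat) (T : R).
Local Notation V := 'rV[R]_d.
Local Notation leb := (@lebesgue_measure_rV R d).
Local Notation leb1 := (@lebesgue_measure R).
Variables (mu : probability (path_space d T) R) (G : R -> set V) (u : R -> V -> R).
Hypothesis cG : closed_family T G.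
Hypothesis uP : alive_density mu G u.

Lemma alive_density_mass s : s \in `[0, T] -> (\int[leb]_x (u s x)%:E <= 1)%E.
Proof.
move=> sT; have mGC : measurable (~` G s).
  by apply: measurableC; apply: closed_measurable_rV; exact: cG.
rewrite (_ : (\int[leb]_x _ = \int[leb]_(x in ~` G s) (u s x)%:E)%E); last first.
  rewrite [RHS]integral_mkcond; apply: eq_integral => x _; rewrite patchE.
  case: ifPn => // /negP nG; rewrite (ad_extension uP sT)//.
  by apply: contrapT => nGx; apply: nG; rewrite inE.
rewrite -(ad_density uP sT mGC)//; apply: probability_le1.
rewrite -[X in measurable X]setTI; exact: canonical_process_measurable.
Qed.

(** By Tonelli the space-time integral is that of the mass over time, and the mass is at most 1 at
    every time. Tonelli is applied to the jointly measurable version [g], whose slices agree with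
    [u s] at almost every time. *)
Lemma alive_density_locally_integrable : 0 <= T -> locally_integrable_spacetime T u.
Proof.
move=> T0; have [[g mg ug] mu_ u0 _ _] := uP; split; first by exists g.
- move=> K cK; have mK : measurable K.
    by apply: closed_measurable_rV; apply: compact_closed cK; exact: norm_hausdorff.
  have mI : measurable (`[0, T]%classic : set (measurableTypeR R)) by exact: measurable_itv.
  rewrite (@integral_ae_eqN _ _ _ _ _ _ (fun z => `|g z|%:E)); last first.
    apply: filterS ug => z /= H [zT _]; by rewrite H.
  pose h (z : measurableTypeR R * V) : \bar R := (\1_(`[0, T]%classic : set R) z.1 * `|g z|)%:E.
  have mh : measurable_fun setT h.
    apply/measurable_EFinP; apply: measurable_funM; last exact: measurableT_comp.
    by apply: measurableT_comp; [exact: measurable_indic|exact: measurable_fst].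
  have h0 z : (0 <= h z)%E by rewrite lee_fin mulr_ge0// indicE.
  apply: (@le_lt_trans _ _ (\int[spacetime_measure R d]_z h z)%E).
    rewrite integral_mkcond; apply: ge0_le_integral => //.
    + by move=> z _; rewrite patchE; case: ifPn => // _; rewrite lee_fin.
    + apply/(measurable_restrictT _ _).1; first exact: measurableX.
      by apply/measurable_EFinP; apply: measurable_funTS; exact: measurableT_comp.
    + move=> z _; rewrite patchE; case: ifPn => [/set_mem[zT _]|//].
      by rewrite /h indicE mem_set// mul1r.
  have [N [mN N0 sN]] := ug.
  rewrite fubini_tonelli1//.
  apply: (@le_lt_trans _ _ (\int[leb1]_(s in `[0%R, T]) (1 : \bar R))%E); last first.
    rewrite integral_cst// mul1e.
    have := lebesgue_measure_itv `[0, T]; rewrite /= => ->.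
    by case: ifPn => _; rewrite ltry.
  rewrite [leRHS]integral_mkcond.
  have mF := @measurable_fun_fubini_tonelli_F _ _ _ _ _ leb _ mh h0.
  apply: ae_ge0_le_integral => //.
  + by move=> s _; apply: integral_ge0.
  + by move=> s _; rewrite patchE; case: ifPn.
  + apply/(measurable_restrictT _ _).1 => //.
  apply: filterS (ae_null_xsection mN N0) => s Ns _.
  rewrite patchE /fubini_F /h; case: ifPn => [/set_mem sT|sT]; last first.
    by rewrite integral0_eq// => x _; rewrite /= indicE (negbTE sT) mul0r.
  apply: le_trans (alive_density_mass sT).
  rewrite (@integral_ae_eqN _ _ _ _ _ _ (fun x => (u s x)%:E))//.
  exists (xsection N s); split => //; first exact: measurable_xsection.
  move=> x /= H; rewrite /xsection/= inE; apply: sN => /= H'; apply: H => _.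
  by rewrite indicE mem_set// mul1r -H'// ger0_norm// u0.
- move=> s sT; apply: locally_integrable_rV_ge0; [exact: mu_|by move=> x; exact: u0|].
  by apply: le_lt_trans (alive_density_mass sT) _; rewrite ltry.
Qed.

End alive_density_integrable.

(** * The weak equation *)

Section weak_equation.
Context (R : realType) (d : nat) (T : R) (dO : measure_display)
  (O : measurableType dO).
Local Notation V := 'rV[R]_d.
Local Notation leb := (@lebesgue_measure_rV R d).
Variables (P : probability O R) (xi : {RV P >-> V}) (B : R -> O -> V)
  (G : R -> set V) (Y : {RV P >-> path_space d T}) (u0 : V -> R) (G0 : set V)
  (mu : probability (path_space d T) R) (u chi : R -> V -> R).
Hypothesis T0 : 0 < T.
Hypothesis BM : standard_brownian_motion P B.
Hypothesis xiE : forall A, measurable A ->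
  distribution P xi A = (\int[leb]_(x in A) (u0 x)%:E)%E.
Hypothesis xiB : independent_systems P (preimage_set_system setT xi measurable)
  (sigma_generated `[0, +oo[ B).
Hypothesis cG : closed_family T G.
Hypothesis ndG : nondecreasing_family T G.
Hypothesis rcG : right_continuous_family T G.
Hypothesis YE : forall o t, t \in `[0, T] ->
  canonical_process t (Y o) = started xi B (stopping T xi B G t o) o.
Hypothesis muE : forall A, measurable A -> mu A = distribution P Y A.
Hypothesis cG0 : closed G0.
Hypothesis u0P : probability_density u0.
Hypothesis chiL : locally_integrable_spacetime T chi.
Hypothesis growth : forall (phi : V -> R) (t : R), Cc_infty phi -> t \in `[0, T] ->
  (\int[leb]_x (phi x * (chi t x - \1_G0 x))%:E =
   'E_mu[fun p => (phi (canonical_process (fine (hitting_time T G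
       (fun s => canonical_process s p))) p) *
     (hitting_time T G (fun s => canonical_process s p) <= t%:E)%E%:R)%R])%E.
Hypothesis uP : alive_density mu G u.
Local Notation W := (started xi B).
Local Notation A := (survival xi B G).

Let mxi : measurable_fun setT xi.
Proof. exact: measurable_funPT. Qed.

Let mG0 : measurable G0. Proof. exact: closed_measurable_rV. Qed.

Let X (s : R) o := W (stopping T xi B G s o) o.

Let mX s : s \in `[0, T] -> measurable_fun setT (X s).
Proof.
move=> sT; apply: (eq_measurable_fun (canonical_process s \o Y)) => [p _|].
  by rewrite /= YE.
by apply: measurableT_comp (measurable_funPT Y); exact: canonical_process_measurable.
Qed.

Let mA s : s \in `[0, T] -> measurable (A s).
Proof. by move=> sT; exact: (survival_measurable mxi BM cG ndG rcG). Qed.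

(** The expectation is split by survival at [s]: surviving paths contribute the density [u s], and
    dead ones contribute [chi s] minus the indicator of [G0] by the growth condition. *)
Lemma has_integral_growth psi s : Cc_infty psi -> s \in `[0, T] ->
  has_integral leb (fun x => psi x * (u s x + chi s x - \1_G0 x))
    (\int[P]_o psi (X s o)).
Proof.
move=> cpsi sT; have [Cpsi Kpsi] := cpsi; have [cont _] := Cpsi 0%N.
have mpsi : measurable_fun setT psi by exact: continuous_measurable_rV.
have [M M0 psiM] := compact_support_bounded cont Kpsi.
have hu := has_integral_alive BM cG ndG rcG YE muE uP sT mpsi psiM.
have [_ _ chis] := chiL.
have [r1 h1] := has_integral_mul (chis _ sT) cont Kpsi.
have [r2 h2] := has_integral_mul (locally_integrable_rV_indic mG0) cont Kpsi.
have h12 := has_integralD h1 (has_integralN h2).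
(* Local integrability makes the integrals against [chi s] and against the indicator finite
   separately; the growth condition then identifies their difference. *)
have E12 : r1 - r2 = \int[P]_o (\1_(~` A s) o * psi (canonical_process s (Y o))).
  apply: EFin_inj; rewrite -(has_integral_integral h12).
  rewrite -(expectation_hitting_value T0 BM cG ndG rcG YE muE mpsi psiM sT) -growth//.
  by apply: eq_integral => x _; rewrite mulrBr.
rewrite E12 in h12.
rewrite (_ : \int[P]_o psi (X s o) = \int[P]_o (\1_(A s) o * psi (W s o)) +
  \int[P]_o (\1_(~` A s) o * psi (canonical_process s (Y o)))).
  rewrite (_ : (fun x => _) = (fun x => psi x * u s x +
    (psi x * chi s x - psi x * \1_G0 x))); first exact: has_integralD.
  by apply/funext => x; ring.
have s0 : 0 <= s by move: sT; rewrite in_itv/= => /andP[].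
rewrite -RintegralD//.
- apply: eq_Rintegral => o _; rewrite !indicE in_setC.
  have [oA|nA] := boolP (o \in A s); rewrite ?mul1r ?mul0r ?addr0 ?add0r.
    by rewrite -(stopped_survival BM cG ndG rcG YE sT oA) YE.
  by rewrite YE.
- apply: (@integrable_bounded _ _ _ P setT (fun o => \1_(A s) o * psi (W s o)) M) => //.
    apply: measurable_funM; first by apply: measurable_indic; exact: mA.
    by apply: measurableT_comp => //; exact: (started_measurable mxi BM).
  move=> o _; rewrite normrM (le_trans _ (psiM (W s o)))// ler_piMl//.
  by rewrite ger0_norm// indicE; case: (_ \in _).
- apply: (@integrable_bounded _ _ _ P setT
    (fun o => \1_(~` A s) o * psi (canonical_process s (Y o))) M) => //.
    apply: measurable_funM; first by apply: measurable_indic; apply: measurableC; exact: mA.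
    apply: measurableT_comp => //.
    by apply: measurableT_comp (measurable_funPT Y); exact: canonical_process_measurable.
  move=> o _; rewrite normrM (le_trans _ (psiM (canonical_process s (Y o))))// ler_piMl//.
  by rewrite ger0_norm// indicE; case: (_ \in _).
Qed.

(** Each side is rewritten as expectations of the stopped process plus integrals over [G0]. The
    expectations match by the Dynkin formula, and the remaining integrals by
    [indicator_time_derivative]. *)
Lemma weak_equation t phi : t \in `[0, T] -> Cc_infty_upto t phi ->
  (\int[leb]_x (phi t x * (- u t x - chi t x)
                - phi 0%R x * (- u0 x - \1_G0 x))%:E =
   \int[lebesgue_measure]_(s in `[0%R, t]) \int[leb]_x
      (time_partial phi s x * (- u s x - chi s x)
       + 2^-1 * laplacian phi s x * - u s x)%:E)%E.
Proof.
move=> tT tphi; have := tT; rewrite in_itv/= => /andP[t0 tT'].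
have [u0m u0_ge0 _] := u0P.
have [M M0 [phiM g2M g3M psiM]] := test_bounds tphi.
have c0 : Cc_infty (phi 0) by apply: (test_Cc_infty tphi); rewrite in_itv/= lexx.
have ct : Cc_infty (phi t) by apply: (test_Cc_infty tphi); rewrite in_itv/= lexx t0.
pose I (psi : V -> R) := \int[leb]_x (psi x * \1_G0 x).
have hI (psi : V -> R) : Cc_infty psi -> has_integral leb (fun x => psi x * \1_G0 x) (I psi).
  move=> [Cpsi Kpsi]; have [cont _] := Cpsi 0%N.
  have [r h] := has_integral_mul (locally_integrable_rV_indic mG0) cont Kpsi.
  by rewrite /I /Rintegral (has_integral_integral h).
have lhs : has_integral leb (fun x => phi t x * (- u t x - chi t x)
    - phi 0%R x * (- u0 x - \1_G0 x))
    (- (\int[P]_o phi t (X t o)) - I (phi t) + (\int[P]_o phi 0 (xi o) + I (phi 0))).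
  have [cont _] := c0.1 0%N.
  have h0 := @has_integral_start _ _ _ _ P xi u0 xiE (phi 0) M u0m u0_ge0.
  have := has_integralD (has_integralD (has_integralN (has_integral_growth ct tT))
    (has_integralN (hI _ ct))) (has_integralD (h0 _ _) (hI _ c0)).
  rewrite (_ : (fun x => _ + _) = (fun x => phi t x * (- u t x - chi t x)
    - phi 0%R x * (- u0 x - \1_G0 x))).
    apply; first exact: continuous_measurable_rV.
    by move=> x; apply: phiM; rewrite lexx.
  by apply/funext => x; ring.
rewrite (has_integral_integral lhs).
have start0 o : X 0 o = xi o.
  have : 0 <= stopping T xi B G 0 o <= 0 by exact: (stopping_itv xi B G o (lexx 0) (ltW T0)).
  rewrite /X => /le_anti <-; by rewrite /started (bm_start BM) addr0.
(* At t = 0 the time integral is over one point, and the left-hand side vanishes because the stopped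
   process starts at [xi]. *)
have [t00|t_neq0] := eqVneq t 0.
  rewrite t00 set_itv1 integral_set1; congr EFin.
  rewrite (_ : \int[P]_o phi 0 (X 0 o) = \int[P]_o phi 0 (xi o)); first by ring.
  by apply: eq_Rintegral => o _; rewrite start0.
have {t_neq0}t0' : 0 < t by rewrite lt_neqAle eq_sym t_neq0.
pose g1 i s := space_partial i phi s.
pose g2 i s := space_partial i (space_partial i phi) s.
have dphi s x : is_derive s (1 : R) (phi ^~ x) (time_partial phi s x).
  have [_ [H _ _]] := test_smooth tphi 1; rewrite /time_partial derive1E.
  exact/derivableP/H.
have cg2 i : continuous (fun z : R * V => g2 i z.1 z.2).
  exact: spacetime_CkW (test_space2_smooth tphi 0 i i).
have [mL iL] := @dynkin_formula R d T dO O P xi B G T0 mxi BM xiB cG ndG rcG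
  t phi (time_partial phi) g1 g2 M t0' tT' phiM
  (fun s => continuous_section (spacetime_CkW (test_smooth tphi 0)))
  (fun i s x a => space_derivative_along i s x a (test_smooth tphi 1))
  (fun i s x a => space_derivative_along i s x a (test_space_smooth tphi 1 i))
  (fun i j s x a st => laplacian_lipschitz tphi x a (fun y => g3M i j s y st))
  g2M dphi psiM
  (spacetime_CkW (test_time_smooth tphi 0)) cg2.
set L := (fun s => _ + _) in mL iL *; rewrite -/L => LE.
have [iI IE] := indicator_time_derivative t0' tphi mG0.
pose J s := I (time_partial phi s).
(* The drift part uses [has_integral_growth] with the time derivative as test function; the
   Laplacian part involves surviving paths alone, hence only [u s]. *)
have inner s : s \in `]0, t[ -> (\int[leb]_x (time_partial phi s x * (- u s x - chi s x)
    + 2^-1 * laplacian phi s x * - u s x)%:E = (- L s - J s)%:E)%E.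
  move=> st; have cs := test_time_Cc_infty tphi st.
  have sT : s \in `[0, T].
    by move: st; rewrite !in_itv/= => /andP[s0 st]; rewrite ltW//= (le_trans (ltW st)).
  have st' : 0 <= s <= t by move: st; rewrite in_itv/= => /andP[s0 st]; rewrite !ltW.
  pose h x := 2^-1 * laplacian phi s x.
  have mh : measurable_fun setT h.
    apply: measurable_funM => //; apply: measurable_sum => i.
    apply: continuous_measurable_rV.
    exact: continuous_section (spacetime_CkW (test_space2_smooth tphi 0 i i)).
  have hM x : `|h x| <= d%:R * M.
    rewrite normrM (@le_trans _ _ `|laplacian phi s x|)//.
      by rewrite ler_piMl// ger0_norm ?invr_ge0// invf_le1// ler1n.
    rewrite (le_trans (ler_norm_sum _ _ _))// (le_trans (ler_sum _ (fun i _ => g2M i s x st')))//.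
    by rewrite sumr_const card_ord mulr_natl.
  have := has_integralD (has_integralD (has_integralN (has_integral_growth cs sT))
    (has_integralN (hI _ cs)))
    (has_integralN (has_integral_alive BM cG ndG rcG YE muE uP sT mh hM)).
  rewrite (_ : (fun x => _ + _) = (fun x => time_partial phi s x * (- u s x - chi s x)
    + 2^-1 * laplacian phi s x * - u s x)); last by apply/funext => x; rewrite /h; ring.
  by move=> /has_integral_integral ->; congr EFin; rewrite /L /J; ring.
rewrite integral_itv_ccoo.
under eq_integral => s /set_mem/= st do rewrite inner//.
have mI : measurable (`]0, t[%classic : set (measurableTypeR R)) by exact: measurable_itv.
have iL' := integrable_EFinZ mI (-1) iL.
rewrite (_ : (\int[_]_(s in _) _ = \int[lebesgue_measure]_(s in `]0%R, t[)
  (-1 * L s - J s)%:E)%E); last by apply: eq_integral => s _; rewrite mulN1r.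
rewrite (integral_EFinB mI iL' iI) (integral_EFinZ mI (-1) iL).
rewrite -[X in (_ * X - _)%E]fineK; last exact: integrable_fin_num iL.
rewrite -[X in (_ - X)%E]fineK; last exact: integrable_fin_num iI.
rewrite -EFinM -EFinB; congr EFin; rewrite -[fine _]LE.
rewrite [X in _ = _ - X](_ : _ = I (phi t) - I (phi 0)); last exact: esym IE.
rewrite (_ : \int[P]_o phi 0 (W 0 o) = \int[P]_o phi 0 (xi o)).
  by rewrite /X /I; ring.
by apply: eq_Rintegral => o _; rewrite /started (bm_start BM) addr0.
Qed.

End weak_equation.

(** * Existence of the density, and the weak solution for every version of it *)

Theorem proposition5p6 (R : realType) (d : nat) (T : R) (T_gt0 : 0 < T)
    (u0 : 'rV[R]_d -> R) (Gamma0 : set 'rV[R]_d)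
    (mu : probability (path_space d T) R) (Gamma : R -> set 'rV[R]_d)
    (chi : R -> 'rV[R]_d -> R) :
  probabilistic_solution u0 Gamma0 mu Gamma chi ->
  (exists u : R -> 'rV[R]_d -> R, alive_density mu Gamma u) /\
  (forall u : R -> 'rV[R]_d -> R, alive_density mu Gamma u ->
    weak_solution T (fun x => - u0 x) Gamma0 (fun t x => - u t x) Gamma chi).
Proof.
move=> [G0_neq0 cG0 u0P u0G0 cG ndG rcG chi0 chiL phase G0G law growth].
have [dS [S [P [xi [B [Y [BM xiE xiB YE muE]]]]]]] := law.
split.
  apply: (alive_density_exists T_gt0 cG ndG rcG) => s A sT mA.
  exact: (alive_part_null BM xiE xiB cG ndG rcG YE muE).
move=> u uP; have [u0m u0_ge0 u01] := u0P.
split => //.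
- by move=> x; rewrite oppr_le0.
- apply: locally_integrable_rVN; apply: locally_integrable_rV_ge0 => //.
  by rewrite u01 ltry.
- by apply: filterS u0G0 => x /= H Gx; rewrite H// oppr0.
- apply: locally_integrable_spacetimeN.
  exact: (alive_density_locally_integrable cG uP (ltW T_gt0)).
- move=> t phi tT tphi.
  exact: (weak_equation T_gt0 BM xiE xiB cG ndG rcG YE muE cG0 u0P chiL growth uP).
- apply: aeW => -[s x] /= sT; have [Gx|nGx] := pselect (Gamma s x).
    by rewrite (ad_extension uP sT Gx) oppr0 mulr0.
  by rewrite indicE memNset// mul0r.
Qed.
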